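(* Let $\alpha\in(0,2)$, $c_l,c_U>0$, let $\Omega\subset\mathbb{R}^d$ be bounded and open, and assume that $k$ satisfies condition (E$_\ge$) with constant $c_l$ and condition (U1) with constant $c_U$. Then the Green function $G$ on $\Omega$ is symmetric: $G(x,y)=G(y,x)$ for all $x,y\in\Omega$ with $x\neq y$.
   Context: Throughout, $d\ge 3$ and $k:(\mathbb{R}^d\times\mathbb{R}^d)\setminus\{x=y\}\to[0,\infty)$ is a measurable function with $k(x,y)=k(y,x)$ and $\sup_{x\in\mathbb{R}^d}\int_{\mathbb{R}^d}(1\wedge|y-x|^2)k(x,y)\,dy<\infty$. For an open set $U\subset\mathbb{R}^d$ and measurable $u,v$, $\mathcal{E}_U(u,v)=\int_U\int_U(u(y)-u(x))(v(y)-v(x))k(x,y)\,dy\,dx$ (when finite), and $\mathcal{E}=\mathcal{E}_{\mathbb{R}^d}$. For $0<\alpha<2$ let $k^{(\alpha)}(x,y)=\frac{2^\alpha\Gamma((d+\alpha)/2)}{\pi^{d/2}|\Gamma(-\alpha/2)|}|y-x|^{-d-\alpha}$ and let $\mathcal{E}^\alpha_U$, $\mathcal{E}^\alpha$ denote the same forms with $k$ replaced by $k^{(\alpha)}$. $H(\mathbb{R}^d;k)=\{u\in L^2(\mathbb{R}^d):\mathcal{E}(u,u)<\infty\}$ and, for open $\Omega$, $H_\Omega(\mathbb{R}^d;k)=\{u\in H(\mathbb{R}^d;k): u=0\text{ a.e. on }\mathbb{R}^d\setminus\Omega\}$; $\langle f,g\rangle=\int fg\,dx$. Condition (E$_\ge$)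 with constant $c_l>0$: for every ball $B=B_r(x_0)\subset\mathbb{R}^d$ and every $u\in L^2(B)$, $\mathcal{E}_B(u,u)\ge c_l\,\mathcal{E}^\alpha_B(u,u)$. Condition (U1) with constant $c_U>0$: for all $r>0$, $\sup_{x\in\mathbb{R}^d}\int_{\mathbb{R}^d}(r^2\wedge|y-x|^2)k(x,y)\,dy\le c_U r^{2-\alpha}$. Green function: for a bounded open $\Omega\subset\mathbb{R}^d$, a measurable $G:\mathbb{R}^d\times\mathbb{R}^d\to[0,\infty]$ is a Green function on $\Omega$ if $G(\cdot,y)\in L^1(\Omega)$ for each $y\in\Omega$, $G=0$ a.e. on $(\mathbb{R}^d\times\mathbb{R}^d)\setminus(\Omega\times\Omega)$, and $\int_{\mathbb{R}^d}G(x,y)\psi(x)\,dx=\varphi(y)$ for every $y\in\Omega$, every $\varphi\in H_\Omega(\mathbb{R}^d;k)\cap C(\Omega)$ and every $\psi\in L^\infty(\Omega)$ such that $\mathcal{E}(\varphi,v)=\langle\psi,v\rangle$ for all $v\in H_\Omega(\mathbb{R}^d;k)$. Under (E$_\ge$) and (U1) it exists and is unique.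
   Formalization: The definition fixes a Green function only up to null sets (changing G at one point keeps it a Green function), so the claim is stated as: there exists a Green function G on Ω with G(x,y)=G(y,x) for all x≠y in Ω; uniqueness is not part of the statement. *)

(* Defs.v *)
From HB Require Import structures.
From mathcomp Require Import all_boot all_order all_algebra.
From mathcomp Require Import all_classical all_reals all_analysis measurable_realfun.
Set Implicit Arguments. Unset Strict Implicit. Unset Printing Implicit Defensive.
Import Order.TTheory GRing.Theory Num.Theory.
Import numFieldNormedType.Exports.
Local Open Scope classical_set_scope.
Local Open Scope ring_scope.

(* R^d is modelled as d.-tuple R, with the product (= Borel) sigma-algebra
   provided by MathComp-Analysis (measure_theory/measurable_structure.v).  *)
Section Rd.
Variable R : realType.

Definition edist (d : nat) (x y : d.-tuple R) : R :=
  Num.sqrt (\sum_(i < d) (tnth y i - tnth x i) ^+ 2).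

Definition eball (d : nat) (x0 : d.-tuple R) (r : R) : set (d.-tuple R) :=
  [set x | edist x0 x < r].

Definition eopen (d : nat) (U : set (d.-tuple R)) : Prop :=
  forall x, U x -> exists2 r : R, 0 < r & eball x r `<=` U.

Definition ebounded (d : nat) (U : set (d.-tuple R)) : Prop :=
  exists M : R, forall x, U x -> edist (nseq_tuple d 0) x <= M.

(* Lebesgue integral on R^d, as the iterated Lebesgue integral
   dx_1 ... dx_d (equal to the integral w.r.t. d-dimensional Lebesgue
   measure for nonnegative measurable or integrable integrands). *)
Fixpoint lint (n : nat) : (n.-tuple R -> \bar R) -> \bar R :=
  match n return (n.-tuple R -> \bar R) -> \bar R with
  | 0 => fun f => f [tuple]
  | S n' => fun f =>
      (\int[@lebesgue_measure R]_t lint (fun x : n'.-tuple R => f (cons_tuple t x)))%E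
  end.

Definition ind (d : nat) (A : set (d.-tuple R)) (x : d.-tuple R) : \bar R :=
  (\1_A x)%:E.

Definition lint_on (d : nat) (U : set (d.-tuple R)) (f : d.-tuple R -> \bar R) :=
  lint (fun x => (ind U x * f x)%E).

Definition leb (d : nat) (A : set (d.-tuple R)) : \bar R := lint (ind A).
Definition leb2 (d : nat) (A : set (d.-tuple R * d.-tuple R)) : \bar R :=
  lint (fun x => lint (fun y => (\1_A (x, y))%:E)).

Definition formU (d : nat) (k : d.-tuple R -> d.-tuple R -> R)
  (U : set (d.-tuple R)) (u v : d.-tuple R -> R) : \bar R :=
  lint_on U (fun x => lint_on U (fun y =>
     ((u y - u x) * (v y - v x) * k x y)%:E)).

Definition form (d : nat) k (u v : d.-tuple R -> R) : \bar R :=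
  formU k setT u v.

(* Gamma function: integral for s > 0, and Gamma(s) = Gamma(s+1)/s for
   -1 < s <= 0 (only s = -alpha/2 in (-1,0) is used). *)
Definition Gamma_int (s : R) : R :=
  fine (\int[@lebesgue_measure R]_(t in [set t : R | (0 <= t)%R])
          ((t `^ (s - 1)) * expR (- t))%R%:E)%E.
Definition GammaR (s : R) : R :=
  if 0 < s then Gamma_int s else Gamma_int (s + 1) / s.

Definition kalpha (d : nat) (alpha : R) (x y : d.-tuple R) : R :=
  (2 `^ alpha * GammaR ((d%:R + alpha) / 2)
     / (pi `^ (d%:R / 2) * `|GammaR (- (alpha / 2))|))
  * (edist x y) `^ (- (d%:R + alpha)).

Definition admissible_kernel (d : nat) (k : d.-tuple R -> d.-tuple R -> R) :=
  [/\ measurable_fun setT (fun p : d.-tuple R * d.-tuple R => k p.1 p.2),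
      (forall x y, x <> y -> 0 <= k x y),
      (forall x y, x <> y -> k x y = k y x) &
      exists C : R, forall x,
        (lint (fun y => (Num.min 1 (edist x y ^+ 2) * k x y)%:E) <= C%:E)%E].

Definition cond_Ege (d : nat) k (alpha cl : R) :=
  forall (x0 : d.-tuple R) (r : R) (u : d.-tuple R -> R),
    measurable_fun setT u ->
    (lint_on (eball x0 r) (fun x => (u x ^+ 2)%:E) < +oo)%E ->
    (cl%:E * formU (kalpha alpha) (eball x0 r) u u
       <= formU k (eball x0 r) u u)%E.

Definition cond_U1 (d : nat) k (alpha cU : R) :=
  forall (r : R), 0 < r -> forall x : d.-tuple R,
    (lint (fun y => (Num.min (r ^+ 2) (edist x y ^+ 2) * k x y)%:E)
       <= (cU * r `^ (2 - alpha))%:E)%E.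

Definition inL2 (d : nat) (u : d.-tuple R -> R) :=
  measurable_fun setT u /\ (lint (fun x => (u x ^+ 2)%:E) < +oo)%E.

Definition inH (d : nat) k (u : d.-tuple R -> R) :=
  inL2 u /\ (form k u u < +oo)%E.

Definition inH0 (d : nat) k (Om : set (d.-tuple R)) (u : d.-tuple R -> R) :=
  inH k u /\ leb [set x | ~ Om x /\ u x <> 0] = 0%E.

Definition contOn (d : nat) (Om : set (d.-tuple R)) (f : d.-tuple R -> R) :=
  forall x, Om x -> forall e : R, 0 < e -> exists2 del : R, 0 < del &
    forall y, Om y -> edist x y < del -> `|f y - f x| < e.

Definition inLinf (d : nat) (Om : set (d.-tuple R)) (f : d.-tuple R -> R) :=
  measurable_fun setT f /\
  exists M : R, leb [set x | Om x /\ M < `|f x|] = 0%E.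

Definition isGreen (d : nat) k (Om : set (d.-tuple R))
    (G : d.-tuple R -> d.-tuple R -> \bar R) :=
  [/\ (forall x y, (0 <= G x y)%E),
      measurable_fun setT (fun p : d.-tuple R * d.-tuple R => G p.1 p.2),
      (forall y, Om y -> measurable_fun setT (G^~ y) /\
          (lint_on Om (fun x => `|G x y|) < +oo)%E),
      leb2 [set p | ~ (Om p.1 /\ Om p.2) /\ G p.1 p.2 <> 0%E] = 0%E &
      forall (y : d.-tuple R) (phi psi : d.-tuple R -> R), Om y ->
        inH0 k Om phi -> contOn Om phi -> inLinf Om psi ->
        (forall v, inH0 k Om v ->
            form k phi v = lint_on Om (fun x => (psi x * v x)%:E)) ->
        lint_on Om (fun x => (G x y * (psi x)%:E)%E) = (phi y)%:E].

End Rd.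

(* Main.v *)
From HB Require Import structures.
From mathcomp Require Import all_boot all_order all_algebra.
From mathcomp Require Import all_classical all_reals all_analysis measurable_realfun.
From mathcomp Require Import ring lra.
Require Import Defs.
Set Implicit Arguments. Unset Strict Implicit. Unset Printing Implicit Defensive.
Import Order.TTheory GRing.Theory Num.Theory.
Import numFieldNormedType.Exports.
Local Open Scope classical_set_scope.
Local Open Scope ring_scope.

(* For measurable E in Om let U_E be the solution of form k (U_E, v) = int_E v, obtained from the
   Riesz representation theorem. Comparing k with the fractional kernel on a large ball yields a
   Faber-Krahn inequality, and Stampacchia's iteration then bounds U_E, uniformly small when E
   is small. The symmetry of the form says int_F U_E = int_E U_F.
   For y in Om and the dyadic cubes Q_n around y, the functions U_{Q_n} / |Q_n| are uniformly
   integrable, so along a subsequence chosen measurably in y they converge weakly to a density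
   G(., y). A jointly measurable version comes from dyadic differentiation; the symmetry of the
   potentials makes it symmetric almost everywhere, and it can be modified to be symmetric
   everywhere without changing any section G(., y) up to null sets.
   G is a Green function because only continuous phi have to be tested: testing the equation
   of phi with U_{Q_n} shows that the mean of phi over Q_n is int psi U_{Q_n} / |Q_n|; the former
   tends to phi(y), the latter to int G(., y) psi. No regularity theory is needed. *)

(** * Differentiation along refining partitions *)

Section negligible_small.
Context d (T : measurableType d) (R : realType) (mu : {measure set T -> \bar R}).

Lemma negligible_le_eps (A : set T) :
  (forall e : R, 0 < e -> exists2 B, measurable B & A `<=` B /\ (mu B <= e%:E)%E) ->
  mu.-negligible A.
Proof.
move=> h.
have hn n : exists B, [/\ measurable B, A `<=` B & (mu B <= (n.+1%:R^-1)%:E)%E].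
  have [|B mB [AB Be]] := h n.+1%:R^-1; first by rewrite invr_gt0.
  by exists B.
have [B hB] := choice hn.
exists (\bigcap_n B n); split.
- by apply: bigcapT_measurable => n; case: (hB n).
- apply/eqP; rewrite eq_le measure_ge0 andbT; apply/lee_addgt0Pr => e e0.
  rewrite add0e; pose n := Num.truncn e^-1; have [mB AB Be] := hB n.
  apply: (@le_trans _ _ (mu (B n))).
    apply: le_measure; rewrite ?inE//; last by move=> x; exact.
    by apply: bigcapT_measurable => k; case: (hB k).
  apply: le_trans Be _; rewrite lee_fin -[leRHS]invrK lef_pV2 ?posrE ?invr_gt0//.
  by rewrite ltW// truncnS_gt.
- by move=> x Ax n _; case: (hB n) => _ AB _; exact: AB.
Qed.

End negligible_small.

Lemma measure_tail_cvg0 d (T : measurableType d) (R : realType)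
    (nu : {finite_measure set T -> \bar R}) (F : (set T)^nat) :
  (forall n, measurable (F n)) -> trivIset setT F ->
  nu (\bigcup_(k >= n) F k) @[n --> \oo] --> 0%E.
Proof.
move=> mF tF.
rewrite -(_ : nu (\bigcap_n \bigcup_(k >= n) F k) = 0%E).
  have mT n : measurable (\bigcup_(k >= n) F k) by exact: bigcup_measurable.
  apply: nonincreasing_cvg_mu => //.
  - by rewrite ltey_eq fin_num_measure.
  - exact: bigcapT_measurable.
  - by move=> m n mn; apply/subsetPset => x [k /= nk Fk]; exists k => //=; exact: leq_trans nk.
rewrite (_ : \bigcap_n _ = set0) ?measure0//.
apply/seteqP; split => // x h; have [k _ Fk] := h 0%N I.
have [l /= kl Fl] := h k.+1 I.
move/trivIsetP : tF => /(_ k l I I).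
by rewrite ltn_eqF// => /(_ isT)/seteqP[/(_ x)]; case.
Qed.

Import HBSimple.

Section partition.
Context d (T : measurableType d) (R : realType).
Variable nu : {finite_measure set T -> \bar R}.
(* [c m] numbers the cells of the [m]-th of a sequence of refining countable partitions. *)
Variable c : nat -> T -> nat.
Hypothesis mc : forall m, measurable_fun setT (c m).
Hypothesis cS : forall m x y, c m.+1 x = c m.+1 y -> c m x = c m y.

Definition cell m x : set T := c m @^-1` [set c m x].

Definition avg m (f : T -> R) x : R :=
  (fine (nu (cell m x)))^-1 * \int[nu]_(z in cell m x) f z.

Lemma measurable_code_preimage m (S : set nat) : measurable (c m @^-1` S).
Proof. by rewrite -[X in measurable X]setTI; exact: mc. Qed.

Lemma measurable_cell m x : measurable (cell m x).
Proof. exact: measurable_code_preimage. Qed.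
Local Hint Resolve measurable_cell : core.

Lemma cell_code m x y : c m x = c m y -> cell m x = cell m y.
Proof. by rewrite /cell => ->. Qed.

Lemma code_refine m n x y : (m <= n)%N -> c n x = c n y -> c m x = c m y.
Proof.
elim: n => [|n IH]; first by rewrite leqn0 => /eqP ->.
rewrite leq_eqVlt => /predU1P[->//|]; rewrite ltnS => mn /cS; exact: IH.
Qed.

Lemma cell_subset m n x : (m <= n)%N -> cell n x `<=` cell m x.
Proof. by move=> mn y; exact: code_refine. Qed.

Lemma avg_code m f x y : c m x = c m y -> avg m f x = avg m f y.
Proof. by move=> cxy; rewrite /avg (cell_code cxy). Qed.

Lemma measurable_code_factor d' (T' : measurableType d') m (g : T -> T') :
  (forall x y, c m x = c m y -> g x = g y) -> measurable_fun setT g.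
Proof.
move=> gc _ Y mY; rewrite setTI.
rewrite (_ : _ @^-1` _ = c m @^-1` (c m @` (g @^-1` Y))).
  exact: measurable_code_preimage.
apply/seteqP; split => [x Yx|x [y Yy cyx]] /=; first by exists x.
by rewrite -(gc _ _ cyx).
Qed.

Lemma null_cells : {ae nu, forall x m, nu (cell m x) != 0}.
Proof.
apply: ae_foralln => m.
exists (\bigcup_i (if nu (c m @^-1` [set i]) == 0 then c m @^-1` [set i] else set0)).
split.
- apply: bigcupT_measurable => i; case: ifP => // _; exact: measurable_code_preimage.
- apply/eqP; rewrite eq_le measure_ge0 andbT.
  apply: (le_trans (measure_sigma_subadditive nu (F := fun i => if nu (c m @^-1` [set i]) == 0 then c m @^-1` [set i] else set0) _ _ _)) => //.
  + by move=> i; case: ifP => // _; exact: measurable_code_preimage.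
  + by apply: bigcupT_measurable => i; case: ifP => // _; exact: measurable_code_preimage.
  + by rewrite eseries0// => i _ _; case: ifPn => [/eqP//|_]; rewrite measure0.
- move=> x /= /negP; rewrite negbK => h; exists (c m x) => //=.
  by move: h; rewrite /cell => ->.
Qed.

Lemma avgB m f g x : nu.-integrable setT (EFin \o f) ->
  nu.-integrable setT (EFin \o g) ->
  avg m f x - avg m g x = avg m (f \- g) x.
Proof.
move=> fi gi; rewrite /avg -mulrBr RintegralB//.
  exact: integrableS fi.
exact: integrableS gi.
Qed.

Lemma avgD m f g x : nu.-integrable setT (EFin \o f) ->
  nu.-integrable setT (EFin \o g) ->
  avg m (f \+ g) x = avg m f x + avg m g x.
Proof.
move=> fi gi; rewrite /avg -mulrDr RintegralD//.
  exact: integrableS fi.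
exact: integrableS gi.
Qed.

Lemma avgZ m k f x : nu.-integrable setT (EFin \o f) ->
  avg m (fun x => k * f x) x = k * avg m f x.
Proof.
move=> fi; rewrite /avg RintegralZl//; last exact: integrableS fi.
by rewrite mulrCA.
Qed.

Lemma inv_fine_ge0 A : 0 <= (fine (nu A))^-1.
Proof. by rewrite invr_ge0 fine_ge0. Qed.

Lemma norm_avg_le m f x : nu.-integrable setT (EFin \o f) ->
  `|avg m f x| <= avg m (fun z => `|f z|) x.
Proof.
move=> fi; rewrite /avg normrM (ger0_norm (inv_fine_ge0 _)).
apply: ler_wpM2l; first exact: inv_fine_ge0.
by apply: le_normr_Rintegral => //; exact: integrableS fi.
Qed.

Lemma code_sum_le m (S : set nat) (f : T -> R) (t : R) : 0 <= t ->
  (forall x, 0 <= f x) -> measurable_fun setT f ->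
  (forall i, S i -> t%:E * nu (c m @^-1` [set i]) <=
     \int[nu]_(x in c m @^-1` [set i]) (f x)%:E)%E ->
  (t%:E * nu (c m @^-1` S) <= \int[nu]_(x in c m @^-1` S) (f x)%:E)%E.
Proof.
move=> t0 f0 mf h.
pose F i := c m @^-1` (S `&` [set i]).
have mF i : measurable (F i) by exact: measurable_code_preimage.
have FE : c m @^-1` S = \bigcup_i F i.
  apply/seteqP; split => [x Sx|x [i _ [Sx /= _]]]//.
  by exists (c m x) => //; split.
have tF : trivIset setT F.
  by apply/trivIsetP => i j _ _ ij; apply/seteqP; split => // x [[_ /= e1] [_ /= e2]]; move: ij; rewrite -e1 -e2 eqxx.
have mf' D : measurable_fun D (EFin \o f).
  by apply/measurable_EFinP; exact: measurable_funTS.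
rewrite FE measure_semi_bigcup//; last exact: bigcupT_measurable.
rewrite ge0_integral_bigcup//; last by move=> x _; rewrite lee_fin.
rewrite -nneseriesZl//; apply: lee_nneseries => [i *|i _].
  by rewrite mule_ge0.
have [Si|Si] := pselect (S i); last first.
  have -> : F i = set0 by apply/seteqP; split => // x [/= + /= e]; rewrite e.
  by rewrite measure0 mule0 integral_set0.
have -> : F i = c m @^-1` [set i]; last exact: h.
by apply/seteqP; split => [x [_ /= e]//|x /= xi]; split => //=; rewrite xi.
Qed.

Lemma maximal_inequality (f : T -> R) (t : R) : 0 < t ->
  (forall x, 0 <= f x) -> nu.-integrable setT (EFin \o f) ->
  measurable [set x | exists m, t < avg m f x] /\
  (t%:E * nu [set x | exists m, (t < avg m f x)%R] <= \int[nu]_x (f x)%:E)%E.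
Proof.
move=> t0 f0 fi.
have mf : measurable_fun setT f by apply/measurable_EFinP; exact: measurable_int fi.
have mf' D : measurable_fun D (EFin \o f).
  by apply/measurable_EFinP; exact: measurable_funTS.
pose A m := [set x | t < avg m f x /\ forall k, (k < m)%N -> avg k f x <= t].
have AE : [set x | exists m, t < avg m f x] = \bigcup_m A m.
  apply/seteqP; split => [x [m]|x [m _ [? _]]]; last by exists m.
  elim/ltn_ind: m => m IH tm.
  have [h|] := pselect (exists2 k, (k < m)%N & t < avg k f x).
    by case: h => k km /(IH _ km).
  move=> /forall2NP h; exists m => //; split => // k km.
  by have [//|/negP] := h k; rewrite -leNgt.
have AS m : A m = c m @^-1` (c m @` A m).
  apply/seteqP; split => [x Ax|x [y [ty hy] yx]] /=; first by exists x.
  split; first by rewrite -(avg_code _ yx).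
  by move=> k km; rewrite -(avg_code f (code_refine (ltnW km) yx)); exact: hy.
have mA m : measurable (A m) by rewrite AS; exact: measurable_code_preimage.
have tA : trivIset setT A.
  apply/trivIsetP => i j _ _; rewrite neq_lt => /orP[|] ij; apply/seteqP; split => // x [[ti hi] [tj hj]].
    by have := hj _ ij; rewrite leNgt ti.
  by have := hi _ ij; rewrite leNgt tj.
have hA m : (t%:E * nu (A m) <= \int[nu]_(x in A m) (f x)%:E)%E.
  rewrite AS; apply: code_sum_le => //; first exact: ltW.
  move=> _ [x [tx _] <-].
  have fS : nu.-integrable (cell m x) (EFin \o f) by exact: integrableS fi.
  rewrite -/(cell m x) -[leRHS]fineK; last exact: integrable_fin_num.
  rewrite -[X in (_ * X)%E]fineK; last exact: fin_num_measure.
  rewrite -EFinM lee_fin.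
  have [n0|n0] := eqVneq (fine (nu (cell m x))) 0.
    by rewrite n0 mulr0 fine_ge0// integral_ge0// => z _; rewrite lee_fin.
  have np : 0 < fine (nu (cell m x)) by rewrite lt_neqAle eq_sym n0 fine_ge0.
  rewrite -ler_pdivlMr// ltW//; move: tx; rewrite /avg mulrC; exact.
rewrite AE; split; first exact: bigcupT_measurable.
rewrite measure_semi_bigcup//; last exact: bigcupT_measurable.
apply: (@le_trans _ _ (\int[nu]_(x in \bigcup_m A m) (f x)%:E)%E).
  rewrite -nneseriesZl// ge0_integral_bigcup//; last by move=> x _; rewrite lee_fin.
  by apply: lee_nneseries => [i *|i _]; [rewrite mule_ge0// lee_fin ltW|exact: hA].
apply: ge0_subset_integral => //; first exact: bigcupT_measurable.
by move=> x _; rewrite lee_fin.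
Qed.

Definition diffable (f : T -> R) := nu.-integrable setT (EFin \o f) /\
  {ae nu, forall x, avg m f x @[m --> \oo] --> f x}.

Lemma diffableD f g : diffable f -> diffable g -> diffable (f \+ g).
Proof.
move=> [fi fc] [gi gc]; split.
  by have := integrableD measurableT fi gi; apply: eq_integrable => // x _ /=; rewrite EFinD.
apply: filterS2 fc gc => x fx gx.
by rewrite (_ : (fun m => _) = (fun m => avg m f x + avg m g x));
  [exact: cvgD|apply/funext => m; exact: avgD].
Qed.

Lemma diffableZ k f : diffable f -> diffable (fun x => k * f x).
Proof.
move=> [fi fc]; split.
  by have := integrableZl measurableT k fi; apply: eq_integrable => // x _ /=; rewrite EFinM.
apply: filterS fc => x fx.
by rewrite (_ : (fun m => _) = (fun m => k * avg m f x));
  [exact: cvgMr|apply/funext => m; exact: avgZ].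
Qed.

Lemma diffable_closed f : nu.-integrable setT (EFin \o f) ->
  (forall e : R, 0 < e -> exists2 g, diffable g &
     (\int[nu]_x `|f x - g x|%:E <= e%:E)%E) -> diffable f.
Proof.
move=> fi h; split => //.
have key k : nu.-negligible
    [set x | ~ exists M, forall m, (M <= m)%N -> `|avg m f x - f x| <= 3 * k.+1%:R^-1].
  apply: negligible_le_eps => e e0.
  set t : R := k.+1%:R^-1; have t0 : 0 < t by rewrite invr_gt0.
  have [|g [gi [N [mN N0 gN]]] hg] := h (e * t / 2).
    by rewrite divr_gt0// mulr_gt0.
  have fgi : nu.-integrable setT (EFin \o (f \- g)).
    by have := integrableB measurableT fi gi; apply: eq_integrable => // x _ /=; rewrite EFinB.
  have fgn := integrable_norm fgi.
  have [mM hM] := maximal_inequality t0 (fun x => normr_ge0 ((f \- g) x)) fgn.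
  set M := [set x | _] in mM hM.
  pose D := [set x | (t%:E <= `|((f \- g) x)%:E|)%E].
  have mD : measurable (setT `&` D).
    apply: emeasurable_fun_c_infty => //.
    by apply: measurableT_comp => //; exact: measurable_int fgi.
  rewrite setTI in mD.
  have hD : (t%:E * nu D <= \int[nu]_x `|((f \- g) x)%:E|)%E.
    by have := le_integral_abse nu measurableT (measurable_int _ fgi) t0; rewrite setTI.
  exists (M `|` D `|` N); first by do 2 apply: measurableU => //.
  split.
    move=> x /= nx; apply: contrapT => /not_orP[/not_orP[nM nD] nN].
    apply: nx; have : avg m g x @[m --> \oo] --> g x.
      by apply: contrapT => ng; apply: nN; apply: gN.
    move=> /cvgrPdist_lt/(_ _ t0)[m0 _ gm].
    exists m0 => m mm; have := gm m mm => /= gmt.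
    have a1 : `|avg m f x - avg m g x| <= t.
      rewrite avgB//; apply: le_trans (norm_avg_le _ _ fgi) _; rewrite leNgt; apply/negP => ?.
      by apply: nM; exists m.
    have a2 : `|f x - g x| < t.
      by rewrite ltNge; apply/negP => ?; apply: nD; rewrite /D /= lee_fin.
    have -> : avg m f x - f x = (avg m f x - avg m g x) - (g x - avg m g x) - (f x - g x) by ring.
    rewrite (_ : 3 * t = t + t + t); last by ring.
    apply: le_trans (ler_normB _ _) _; apply: lerD; last exact: ltW.
    by apply: le_trans (ler_normB _ _) _; apply: lerD => //; exact: ltW.
  have U3 : (nu (M `|` D `|` N) <= nu M + nu D + nu N)%E.
    apply: le_trans (measureU2 _ _ _) _ => //; first exact: measurableU.
    by apply: leeD => //; exact: measureU2.
  have N0' : nu N = 0%E by exact: N0.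
  apply: le_trans U3 _; rewrite N0' adde0.
  rewrite -(@lee_pmul2l _ t%:E)// ?lte_fin// -EFinM muleDr ?ge0_adde_def ?inE//.
  rewrite (_ : t * e = e * t / 2 + e * t / 2); last by field.
  rewrite EFinD; apply: leeD; first exact: le_trans hM hg.
  exact: le_trans hD hg.
have := negligible_bigcup key.
case=> N [mN N0 sN]; exists N; split => //; apply: subset_trans sN => x /= nx.
apply: contrapT => h2; apply: nx; apply/cvgrPdist_le => e e0.
pose k := Num.truncn (3 / e).
have [M hM] : exists M, forall m, (M <= m)%N -> `|avg m f x - f x| <= 3 * k.+1%:R^-1.
  by apply: contrapT => ?; apply: h2; exists k.
exists M => // m Mm /=; rewrite distrC (le_trans (hM m Mm))//.
by rewrite ler_pdivrMr// mulrC -ler_pdivrMr// ltW// truncnS_gt.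
Qed.

Lemma code_in_cell k m i x : (k <= m)%N -> c k x = i ->
  cell m x `<=` c k @^-1` [set i].
Proof. by move=> km xi y /(cell_subset km) /= ->. Qed.

Lemma code_notin_cell k m i x : (k <= m)%N -> c k x <> i ->
  cell m x `&` c k @^-1` [set i] = set0.
Proof.
move=> km xi; apply/seteqP; split => // y [/(cell_subset km)/= yx /= yi].
by apply: xi; rewrite -yx.
Qed.

Lemma integrable_indicr A : measurable A -> nu.-integrable setT (EFin \o \1_A).
Proof. exact: integrable_indic. Qed.

Lemma Rintegral_indicr A B : measurable A -> measurable B ->
  \int[nu]_(x in A) \1_B x = fine (nu (A `&` B)).
Proof. by move=> mA mB; rewrite /Rintegral integral_indic// setIC. Qed.

Lemma diffable_code k i : diffable (\1_(c k @^-1` [set i])).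
Proof.
have mi : measurable (c k @^-1` [set i]) by exact: measurable_code_preimage.
split; first exact: integrable_indicr.
apply: filterS null_cells => x hx.
apply: cvg_near_cst; exists k => // m /= km; rewrite /avg Rintegral_indicr//.
have [e|ne] := eqVneq (c k x) i.
  rewrite (setIidl (code_in_cell km e)) mulVf.
    by rewrite indicE mem_set.
  by apply/negP => /eqP h; move: (hx m); rewrite -[nu _]fineK ?h ?eqxx// fin_num_measure.
by rewrite (code_notin_cell km (elimN eqP ne)) measure0 mulr0 indicE memNset//=; exact/eqP.
Qed.

Lemma diffable_cst1 : diffable (\1_[set: T]).
Proof.
split; first exact: integrable_indicr.
apply: filterS null_cells => x hx.
rewrite (_ : (fun m => _) = fun=> \1_[set: T] x); first exact: cvg_cst.
apply/funext => m; rewrite /avg Rintegral_indicr// setIT mulVf ?indicT//.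
by apply/negP => /eqP h; move: (hx m); rewrite -[nu _]fineK ?h ?eqxx// fin_num_measure.
Qed.

Hypothesis cgen : @measurable _ T = <<s [set A | exists k i, A = c k @^-1` [set i]] >>.

Lemma diffable0 : diffable (cst 0).
Proof.
have := diffableZ 0 diffable_cst1; congr diffable.
by apply/funext => x; rewrite mul0r.
Qed.

Lemma diffable_sum (J : Type) (s : seq J) (f : J -> T -> R) :
  (forall j, diffable (f j)) -> diffable (fun x => \sum_(j <- s) f j x).
Proof.
move=> h; elim: s => [|a s IH].
  by under eq_fun do rewrite big_nil; exact: diffable0.
by under eq_fun do rewrite big_cons; exact: diffableD.
Qed.

Definition cells : set (set T) := [set A | A = set0 \/ exists k i, A = c k @^-1` [set i]].

Lemma cells_gen : @measurable _ T = <<s cells >>.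
Proof.
apply/seteqP; split => A.
  rewrite cgen; apply: sub_smallest2r => //; last by move=> B; right.
apply: smallest_sub; first exact: sigma_algebra_measurable.
by move=> B [->//|[k [i ->]]]; exact: measurable_code_preimage.
Qed.

Lemma cells_setI : setI_closed cells.
Proof.
move=> A B [->|[k [i ->]]]; first by rewrite set0I; left.
move=> [->|[l [j ->]]]; first by rewrite setI0; left.
wlog kl : k l i j / (k <= l)%N.
  have [kl|/ltnW lk] := leqP k l; first exact.
  by rewrite setIC; exact.
have [[x [/= xi xj]]|/forallNP h] := pselect (exists x, (c k @^-1` [set i] `&` c l @^-1` [set j]) x).
  right; exists l, j; apply: setIidr => y /= yj; rewrite -xi.
  by apply: (code_refine kl); rewrite yj xj.
by left; apply/seteqP; split => // x /h.
Qed.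

Lemma diffable_indic A : measurable A -> diffable (\1_A).
Proof.
move=> mA.
apply: (@dynkin_induction _ _ cells (fun A => diffable (\1_A)) cells_gen cells_setI).
- exact: diffable_cst1.
- by move=> B [->|[k [i ->]]]; [rewrite indic0; exact: diffable0|exact: diffable_code].
- move=> S mS dS; have := diffableD diffable_cst1 (diffableZ (-1) dS).
  congr diffable; apply/funext => x; rewrite /= !indicE in_setT in_setC.
  by case: (x \in S); rewrite /= ?mulr1 ?mulr0 ?subrr ?addr0.
- move=> F mF tF dF.
  have mU : measurable (\bigcup_k F k) by exact: bigcupT_measurable.
  apply: diffable_closed; first exact: integrable_indicr.
  move=> e e0.
  have mT n : measurable (\bigcup_(k >= n) F k) by exact: bigcup_measurable.
  have := measure_tail_cvg0 nu mF tF.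
  move=> /fine_cvgP[_ /cvgrPdist_le/(_ _ e0)[n _ /(_ n (leqnn _))]] /= hn.
  exists (fun x => \sum_(k <- iota 0 n) \1_(F k) x); first exact: diffable_sum.
  rewrite (eq_integral (fun x => (\1_(\bigcup_(k >= n) F k) x)%:E)).
    rewrite integral_indic// setIT -[leLHS]fineK ?fin_num_measure// lee_fin.
    by move: hn; rewrite sub0r normrN ger0_norm// fine_ge0.
  move=> x _; congr (_%:E).
  have -> : \1_(\bigcup_k F k) x = \sum_(k <- iota 0 n) \1_(F k) x + \1_(\bigcup_(k >= n) F k) x :> R.
    have [[k _ Fk]|nk] := pselect ((\bigcup_k F k) x); last first.
      rewrite indicE memNset// [X in _ + X]indicE memNset; last by move=> [k _ Fk]; apply: nk; exists k.
      by rewrite big1 ?addr0// => k _; rewrite indicE memNset// => Fk; apply: nk; exists k.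
    have oth j : j != k -> \1_(F j) x = 0 :> R.
      move=> jk; rewrite indicE memNset// => Fj.
      by move/trivIsetP : tF => /(_ j k I I jk)/seteqP[/(_ x)]; case.
    rewrite indicE mem_set; last by exists k.
    have [kn|nk] := ltnP k n.
      rewrite [X in _ + X]indicE memNset; last first.
        move=> [l /= nl Fl]; have := oth l; rewrite indicE mem_set//= => /(_ _)/eqP.
        by rewrite oner_eq0 => h; apply: notF; apply: h; rewrite gtn_eqF// (leq_trans kn).
      rewrite (bigD1_seq k)/= ?iota_uniq ?mem_iota//= indicE mem_set// big1 ?addr0//.
    rewrite [X in _ + X]indicE mem_set; last by exists k.
    rewrite big_seq big1 ?add0r// => j; rewrite mem_iota add0n => /andP[_ jn].
    by apply: oth; rewrite ltn_eqF// (leq_trans jn).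
  by rewrite addrAC subrr add0r ger0_norm.
- by rewrite -cells_gen.
Qed.

Theorem dyadic_differentiation f : nu.-integrable setT (EFin \o f) -> diffable f.
Proof.
move=> fi; apply: diffable_closed => // e e0.
have [g [gi _ gc]] := approximation_sfun_integrable measurableT fi.
have gd n : diffable (g n).
  rewrite (_ : (g n : T -> R) =
    fun x => \sum_(y \in range (g n)) y * \1_(g n @^-1` [set y]) x); last first.
    by apply/funext => x; rewrite fimfunE.
  under eq_fun do rewrite fsbig_finite//=.
  apply: diffable_sum => y; apply: diffableZ; apply: diffable_indic.
  exact: measurable_sfunP.
have mi n : (\int[nu]_z `|(EFin \o f) z - (g n z)%:E|)%E \is a fin_num.
  have := integrable_fin_num measurableT (integrable_abse (integrableB measurableT fi (gi n))).
  exact.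
move: gc => /fine_cvgP[_ /cvgrPdist_le/(_ _ e0)[n _ /(_ n (leqnn _))]] /= hn.
exists (g n) => //; rewrite -[leLHS]fineK; last exact: mi.
rewrite lee_fin; apply: le_trans hn; rewrite sub0r normrN.
exact: ler_norm.
Qed.

End partition.

(** * Measurable choice of convergent subsequences *)

Definition least (P : nat -> Prop) : nat :=
  if pselect (exists n, `[< P n >]) is left e then ex_minn e else 0.

Lemma leastP (P : nat -> Prop) : (exists n, P n) ->
  P (least P) /\ forall k, (k < least P)%N -> ~ P k.
Proof.
move=> [n Pn]; rewrite /least; case: pselect => [e|[]]; last by exists n; exact/asboolP.
case: ex_minnP => m /asboolP Pm h; split => // k km Pk.
by have := h k (introT (asboolP _) Pk); rewrite leqNgt km.
Qed.

Lemma bounded_limn_esup (R : realType) (b : nat -> R) (K : R) :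
  (forall n, `|b n| <= K) ->
  let L := fine (limn_esup (fun n => (b n)%:E)) in
  (forall e N, 0 < e -> exists2 n, (N <= n)%N & L - e < b n) /\
  (forall e, 0 < e -> exists N, forall n, (N <= n)%N -> b n < L + e).
Proof.
move=> hK L; set u := fun n => (b n)%:E in L *.
have LE : limn_esup u = ereal_inf (range (esups u)).
  by rewrite limn_esup_lim; apply/cvg_lim => //; exact: cvg_esups_inf.
have usup n : (esups u n <= K%:E)%E.
  apply: ub_ereal_sup => _ [k /= nk <-]; rewrite lee_fin.
  exact: le_trans (ler_norm _) (hK k).
have usup2 n k : (n <= k)%N -> (u k <= esups u n)%E.
  by move=> nk; apply: ereal_sup_ubound; exists k.
have Lfin : limn_esup u = L%:E.
  rewrite /L fineK//; rewrite LE fin_numE; apply/andP; split.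
    rewrite -ltNye; apply: (@lt_le_trans _ _ (- K)%:E); first exact: ltNyr.
    apply: le_ereal_inf_tmp => _ [n _ <-]; apply: le_trans (usup2 n n (leqnn _)).
    by rewrite lee_fin; have := hK n; rewrite ler_norml => /andP[].
  rewrite -ltey; apply: (@le_lt_trans _ _ K%:E); last exact: ltry.
  by apply: le_trans (usup 0); apply: ereal_inf_lbound; exists 0%N.
split=> e.
- move=> N e0; apply: contrapT => /forall2NP h.
  have : (esups u N <= (L - e)%:E)%E.
    apply: ub_ereal_sup => _ [k /= nk <-]; rewrite lee_fin leNgt; apply/negP => hk.
    by have [] := h k.
  apply/negP; rewrite -ltNge; apply: (@lt_le_trans _ _ L%:E).
    by rewrite lte_fin ltrBlDr ltrDl.
  by rewrite -Lfin LE; apply: ereal_inf_lbound; exists N.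
- move=> e0; have : (ereal_inf (range (esups u)) < (L + e)%:E)%E.
    by rewrite -LE Lfin lte_fin ltrDl.
  move=> /ereal_inf_lt[_ [N _ <-] hN]; exists N => n Nn.
  by have := le_lt_trans (usup2 _ _ Nn) hN; rewrite lte_fin.
Qed.

Section measurable_selection.
Context d (Y : measurableType d) (R : realType).

Lemma measurable_least (P : nat -> Y -> Prop) :
  (forall n, measurable [set y | P n y]) -> (forall y, exists n, P n y) ->
  measurable_fun setT (fun y => least (P^~ y)).
Proof.
move=> mP eP _ B _; rewrite setTI.
rewrite (_ : _ @^-1` _ = \bigcup_(n in B)
   ([set y | P n y] `&` \bigcap_(k in [set k | (k < n)%N]) ~` [set y | P k y])).
  apply: bigcup_measurable => n _; apply: measurableI => //.
  by apply: bigcap_measurableType => k _; exact: measurableC.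
apply/seteqP; split => [y /= By|y [n Bn [/= Pn hn]]].
  have [h1 h2] := leastP (eP y).
  by exists (least (P^~ y)) => //; split => // k /= /h2.
rewrite /preimage /=; have [h1 h2] := leastP (eP y).
have [ln|nl|->//] := ltngtP (least (P^~ y)) n; last by have := h2 _ nl.
by have := hn _ ln.
Qed.

Lemma measurable_select d' (Z : measurableType d') (f : nat -> Y -> Z) (s : Y -> nat) :
  (forall n, measurable_fun setT (f n)) -> measurable_fun setT s ->
  measurable_fun setT (fun y => f (s y) y).
Proof.
move=> mf ms _ B mB; rewrite setTI.
rewrite (_ : _ @^-1` _ = \bigcup_n (s @^-1` [set n] `&` f n @^-1` B)).
  apply: bigcupT_measurable => n; apply: measurableI.
    by rewrite -[X in measurable X]setTI; exact: ms.
  by rewrite -[X in measurable X]setTI; exact: mf.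
apply/seteqP; split => [y /= By|y [n _ [/= <-]]]//.
by exists (s y).
Qed.

(* [pick_cvg b] picks, measurably in [y], indices along which [b ^~ y] tends to its limsup. *)
Fixpoint pick_cvg (b : nat -> Y -> R) (j : nat) (y : Y) : nat :=
  if j is j'.+1 then least (fun n => (pick_cvg b j' y < n)%N /\
    fine (limn_esup (fun n => (b n y)%:E)) - j.+1%:R^-1 < b n y)
  else 0%N.

Section pick.
Variable b : nat -> Y -> R.
Hypothesis mb : forall n, measurable_fun setT (b n).
Hypothesis bK : forall y, exists K : R, forall n, `|b n y| <= K.

Let pick_ex j y : exists n, (pick_cvg b j y < n)%N /\
    fine (limn_esup (fun n => (b n y)%:E)) - j.+2%:R^-1 < b n y.
Proof.
have [K /bounded_limn_esup[h _]] := bK y.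
have [|n n1 n2] := h (j.+2%:R^-1) (pick_cvg b j y).+1; first by rewrite invr_gt0.
by exists n.
Qed.

Lemma pick_cvg_lt j y : (pick_cvg b j y < pick_cvg b j.+1 y)%N.
Proof. by rewrite /=; have [[]] := leastP (pick_ex j y). Qed.

Lemma measurable_pick_cvg j : measurable_fun setT (pick_cvg b j).
Proof.
elim: j => [|j IH]; first exact: measurable_cst.
apply: measurable_least; last by move=> y; exact: pick_ex.
move=> n; apply: measurableI.
  have := IH measurableT [set k | (k < n)%N]; rewrite setTI; exact.
have mL : measurable_fun setT (fun y => fine (limn_esup (fun n => (b n y)%:E)) - j.+2%:R^-1).
  apply: measurable_funB; last exact: measurable_cst.
  apply: measurableT_comp => //; apply: measurable_fun_limn_esup => k.
  exact/measurable_EFinP.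
rewrite -[X in measurable X]setTI.
by apply: (measurable_fun_ltr mL (mb n) measurableT (Y := [set true])).
Qed.

Lemma cvg_pick_cvg y : cvgn (fun j => b (pick_cvg b j y) y).
Proof.
apply/cvg_ex; exists (fine (limn_esup (fun n => (b n y)%:E))).
set L := fine _; apply/cvgrPdist_le => e e0.
have [K /bounded_limn_esup[_ /(_ _ e0)[N hN]]] := bK y.
have inc j : (j <= pick_cvg b j y)%N.
  by elim: j => // j /leq_ltn_trans; apply; exact: pick_cvg_lt.
exists (N + (Num.truncn e^-1).+1)%N => // -[|j] /= hj; first by rewrite addnS in hj.
have [[_ h2] _] := leastP (pick_ex j y).
rewrite -/L in h2 hN; set m := least _ in h2 *.
have Nm : (N <= m)%N.
  apply: leq_trans (inc j.+1); apply: leq_trans hj; exact: leq_addr.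
have := hN _ Nm => h3.
have h4 : j.+2%:R^-1 <= e.
  rewrite -[leRHS]invrK lef_pV2 ?posrE ?invr_gt0//.
  apply: le_trans (ltW (truncnS_gt _)) _; rewrite ler_nat.
  by apply: leq_trans (leqW hj); exact: leq_addl.
rewrite ler_norml; apply/andP; split; first by rewrite lerBrDl addrC -lerBrDl opprK ltW.
rewrite lerBlDl -lerBlDr; apply: le_trans (ltW h2); exact: lerB.
Qed.

End pick.

Section diagonal.
Variable a : nat -> nat -> Y -> R.
Hypothesis ma : forall i n, measurable_fun setT (a i n).
Hypothesis aK : forall i y, exists K : R, forall n, `|a i n y| <= K.

Fixpoint diag (i : nat) : nat -> Y -> nat :=
  if i is i'.+1 then fun j y =>
    diag i' (pick_cvg (fun n y => a i' (diag i' n y) y) j y) y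
  else fun j _ => j.

Let b i := fun n y => a i (diag i n y) y.

Let bK i y : exists K : R, forall n, `|b i n y| <= K.
Proof. by have [K hK] := aK i y; exists K => n; exact: hK. Qed.

Lemma measurable_diag i j : measurable_fun setT (diag i j).
Proof.
elim: i j => [|i IH] j; first exact: measurable_cst.
apply: (measurable_select IH); apply: measurable_pick_cvg; last exact: (bK i).
by move=> n; exact: (measurable_select (ma i)).
Qed.

Lemma diag_ge i j y : (j <= diag i j y)%N.
Proof.
elim: i j => [|i IH] j //; apply: leq_trans (IH _).
elim: j => // j /leq_ltn_trans; apply; exact: (pick_cvg_lt (bK i)).
Qed.

Lemma diag_sub i k j y : exists2 l, (j <= l)%N & diag (i + k) j y = diag i l y.
Proof.
elim: k j => [|k IH] j; first by exists j => //; rewrite addn0.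
rewrite addnS /=; set m := pick_cvg _ _ _.
have [l ml ->] := IH m; exists l => //; apply: leq_trans ml.
rewrite {}/m; elim: j => // j /leq_ltn_trans; apply; exact: (pick_cvg_lt (bK _)).
Qed.

Lemma measurable_subsequence : exists s : nat -> Y -> nat,
  [/\ forall j, measurable_fun setT (s j), forall j y, (j <= s j y)%N &
      forall i y, cvgn (fun j => a i (s j y) y)].
Proof.
exists (fun j => diag j j); split => [j|j y|i y]; first exact: measurable_diag.
  exact: diag_ge.
have := @cvg_pick_cvg (b i) (bK i) y => /cvg_ex[l hl]; apply/cvg_ex; exists l.
apply/cvgrPdist_le => e e0; move/cvgrPdist_le : hl => /(_ _ e0)[N _ hN].
exists (N + i.+1)%N => // j /= hj.
have ij : (i.+1 <= j)%N by apply: leq_trans hj; exact: leq_addl.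
have [k jk] := diag_sub i.+1 (j - i.+1) j y; rewrite subnKC// => ->.
by apply: (hN k); apply: leq_trans jk; apply: leq_trans hj; exact: leq_addr.
Qed.

End diagonal.

End measurable_selection.

Lemma cvgn_approx (R : realType) (x : nat -> R) :
  (forall e : R, 0 < e -> exists2 z : nat -> R, cvgn z & forall j, `|x j - z j| <= e) ->
  cvgn x.
Proof.
move=> h; apply: cauchy_cvg; apply: cauchy_exP => e e0.
have [|z /cvg_ex[l /cvgrPdist_lt zl] xz] := h (e / 2); first by rewrite divr_gt0.
have [|N _ hN] := zl (e / 2); first by rewrite divr_gt0.
exists l, N => // j /hN /= h1; rewrite /ball /=.
rewrite -(subrKA (z j)) (le_lt_trans (ler_normD _ _))// [ltRHS]splitr.
by rewrite ltr_leD// distrC.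
Qed.

(** * Weak limits of uniformly integrable densities *)

Section ac_density.
Context d (T : measurableType d) (R : realType).
Variables (nu : {finite_measure set T -> \bar R}) (m : set T -> R).
Hypothesis m_ge0 : forall A, measurable A -> 0 <= m A.
Hypothesis mU : forall A B, measurable A -> measurable B -> A `&` B = set0 ->
  m (A `|` B) = m A + m B.
Hypothesis m_ac : forall e : R, 0 < e -> exists2 del : R, 0 < del &
  forall A, measurable A -> (nu A <= del%:E)%E -> m A <= e.

Let mm (A : set T) : \bar R := `|m A|%:E.

Let mmE A : measurable A -> mm A = (m A)%:E.
Proof. by move=> mA; rewrite /mm ger0_norm// m_ge0. Qed.

Let m0 : m set0 = 0.
Proof.
have := mU measurable0 measurable0 (setI0 _); rewrite setU0.
by move/eqP; rewrite eq_sym -subr_eq0 addrK => /eqP.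
Qed.

Let mm0 : mm set0 = 0%E. Proof. by rewrite /mm m0 normr0. Qed.

Let mm_ge0 A : (0 <= mm A)%E. Proof. by rewrite lee_fin. Qed.

Let mm_sigma : semi_sigma_additive mm.
Proof.
move=> F mF tF mUF.
have mB n : measurable (\big[setU/set0]_(0 <= k < n) F k) by exact: bigsetU_measurable.
have mT n : measurable (\bigcup_(k >= n) F k) by exact: bigcup_measurable.
have sumE n : m (\big[setU/set0]_(0 <= k < n) F k) = \sum_(0 <= k < n) m (F k).
  elim: n => [|n IH]; first by rewrite !big_geq.
  rewrite !big_nat_recr//= -IH mU//.
  apply/seteqP; split => // x [+ Fn]; rewrite big_mkord -bigcup_mkord => -[k /= kn Fk].
  by move/trivIsetP : tF => /(_ k n I I); rewrite ltn_eqF// => /(_ isT)/seteqP[/(_ x)]; case.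
have UE n : m (\bigcup_k F k) = \sum_(0 <= k < n) m (F k) + m (\bigcup_(k >= n) F k).
  rewrite -sumE -mU//.
    congr m; rewrite big_mkord -bigcup_mkord -bigcup_setU; apply: eq_bigcupl.
    by split => [k _|//]; have [kn|nk] := ltnP k n; [left|right].
  apply/seteqP; split => // x []; rewrite big_mkord -bigcup_mkord => -[k /= kn Fk] [l /= nl Fl].
  move/trivIsetP : tF => /(_ k l I I); rewrite ltn_eqF ?(leq_trans kn)//.
  by move=> /(_ isT)/seteqP[/(_ x)]; case.
rewrite mmE//.
rewrite (_ : (fun n => _) = EFin \o (fun n => \sum_(0 <= k < n) m (F k))); last first.
  by apply/funext => n /=; rewrite -sumEFin; apply: eq_bigr => k _; rewrite mmE.
apply: cvg_EFin; first by near=> n.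
apply/cvgrPdist_le => e e0.
have [del del0 hdel] := m_ac e0.
have /fine_cvgP[_ /cvgrPdist_le/(_ _ del0)[N _ hN]] := measure_tail_cvg0 nu mF tF.
exists N => // n /hN /= h; rewrite (UE n) addrAC subrr add0r ger0_norm ?m_ge0//.
apply: hdel => //; rewrite -[leLHS]fineK ?fin_num_measure// lee_fin.
by move: h; rewrite sub0r normrN ger0_norm// fine_ge0.
Unshelve. all: by end_near.
Qed.

HB.instance Definition _ := isMeasure.Build _ _ _ mm mm0 mm_ge0 mm_sigma.

Let mm_fin : fin_num_fun mm. Proof. by []. Qed.

HB.instance Definition _ := @Measure_isFinite.Build _ T _ mm mm_fin.

Lemma ac_density : exists h : T -> R, [/\ forall x, 0 <= h x,
  nu.-integrable setT (EFin \o h) &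
  forall A, measurable A -> m A = \int[nu]_(x in A) h x].
Proof.
have dom : mm `<< nu.
  apply/null_content_dominatesP => A mA A0.
  rewrite mmE//; congr (_%:E); apply/eqP; rewrite eq_le m_ge0// andbT.
  apply/ler_addgt0Pr => e e0; rewrite add0r; have [del del0] := m_ac e0; apply => //.
  by rewrite A0 lee_fin ltW.
have [f [f0 fi fE]] := radon_nikodym_finite dom.
have mf := measurable_int _ fi.
have mff : measurable_fun setT (fine \o f) by exact: measurableT_comp.
have ae : ae_eq nu setT f (EFin \o (fine \o f)).
  by have := integrable_ae measurableT fi; apply: filterS => x h _ /=; rewrite fineK//; exact: h.
exists (fine \o f); split.
- by move=> x; rewrite fine_ge0.
- apply/integrableP; split; first exact/measurable_EFinP.
  move/integrableP : fi => [_]; apply: le_lt_trans; apply: ge0_le_integral => //.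
  + apply: measurableT_comp => //; exact/measurable_EFinP.
  + exact: measurableT_comp.
  + by move=> x _ /=; case: (f x) => //= *; rewrite normr0 leey.
- move=> A mA; rewrite /Rintegral; apply: EFin_inj; rewrite -mmE// fE//.
  have <- : (\int[nu]_(x in A) f x = \int[nu]_(x in A) ((fine \o f) x)%:E)%E.
    apply: ae_eq_integral => //.
    + exact: measurable_funTS.
    + by apply: measurable_funTS; exact/measurable_EFinP.
    + by apply: filterS ae => x h Ax; exact: h.
  by rewrite fineK// integrable_fin_num//; exact: integrableS fi.
Qed.

End ac_density.

Section setfun_limit.
Context d (T : measurableType d) (R : realType).
Variables (nu : {finite_measure set T -> \bar R}) (f : nat -> T -> R).
Hypothesis f_ge0 : forall j x, 0 <= f j x.
Hypothesis fi : forall j, nu.-integrable setT (EFin \o f j).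
Hypothesis f_ui : forall e : R, 0 < e -> exists2 del : R, 0 < del &
  forall A j, measurable A -> (nu A <= del%:E)%E -> \int[nu]_(x in A) f j x <= e.
Variable G : set (set T).
Hypothesis Ggen : @measurable _ T = <<s G >>.
Hypothesis GI : setI_closed G.
Hypothesis Gcvg : forall A, G A -> cvgn (fun j => \int[nu]_(x in A) f j x).
Hypothesis Tcvg : cvgn (fun j => \int[nu]_x f j x).

Let g j A := \int[nu]_(x in A) f j x.

Let fiS j A : measurable A -> nu.-integrable A (EFin \o f j).
Proof. by move=> mA; exact: integrableS (fi j). Qed.

Let gU j A B : measurable A -> measurable B -> A `&` B = set0 ->
  g j (A `|` B) = g j A + g j B.
Proof.
move=> mA mB AB; rewrite /g Rintegral_setU//; first by apply: fiS; exact: measurableU.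
by apply/disj_setPS; rewrite AB.
Qed.

Let gC j A : measurable A -> g j (~` A) = g j setT - g j A.
Proof.
move=> mA; rewrite -(setUv A) gU ?setICr//; last exact: measurableC.
by rewrite addrAC subrr add0r.
Qed.

Lemma setfun_cvg A : measurable A -> cvgn (g^~ A).
Proof.
move=> mA; apply: (@dynkin_induction _ _ G (fun A => cvgn (g^~ A)) Ggen GI).
- exact: Tcvg.
- exact: Gcvg.
- move=> S mS cS; rewrite (_ : g^~ (~` S) = fun j => g j setT - g j S).
    by apply: is_cvgB; [exact: Tcvg|exact: cS].
  by apply/funext => j; exact: gC.
- move=> F mF tF cF; apply: cvgn_approx => e e0.
  have [del del0 hdel] := f_ui e0.
  have /fine_cvgP[_ /cvgrPdist_le/(_ _ del0)[N _ /(_ N (leqnn _)) /= hN]] := measure_tail_cvg0 nu mF tF.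
  have mB n : measurable (\big[setU/set0]_(0 <= k < n) F k) by exact: bigsetU_measurable.
  have mT n : measurable (\bigcup_(k >= n) F k) by exact: bigcup_measurable.
  exists (g^~ (\big[setU/set0]_(0 <= k < N) F k)).
    elim: N {hN} => [|n IH].
      by under eq_fun do rewrite big_geq// /g Rintegral_set0; exact: is_cvg_cst.
    rewrite (_ : g^~ _ = fun j => g j (\big[setU/set0]_(0 <= k < n) F k) + g j (F n)).
      by apply: is_cvgD; [exact: IH|exact: cF].
    apply/funext => j; rewrite big_nat_recr//= gU//.
    apply/seteqP; split => // x [+ Fn]; rewrite big_mkord -bigcup_mkord => -[k /= kn Fk].
    by move/trivIsetP : tF => /(_ k n I I); rewrite ltn_eqF// => /(_ isT)/seteqP[/(_ x)]; case.
  move=> j.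
  rewrite (_ : \bigcup_k F k = \big[setU/set0]_(0 <= k < N) F k `|` \bigcup_(k >= N) F k).
    rewrite gU//; last first.
      apply/seteqP; split => // x []; rewrite big_mkord -bigcup_mkord => -[k /= kn Fk] [l /= nl Fl].
      move/trivIsetP : tF => /(_ k l I I); rewrite ltn_eqF ?(leq_trans kn)//.
      by move=> /(_ isT)/seteqP[/(_ x)]; case.
    rewrite addrAC subrr add0r ger0_norm; last exact: Rintegral_ge0.
    apply: hdel => //; rewrite -[leLHS]fineK ?fin_num_measure// lee_fin.
    by move: hN; rewrite sub0r normrN ger0_norm// fine_ge0.
  rewrite big_mkord -bigcup_mkord -bigcup_setU; apply: eq_bigcupl.
  by split => [k _|//]; have [kn|nk] := ltnP k N; [left|right].
- by rewrite -Ggen.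
Qed.

Lemma setfun_limit_density : exists h : T -> R, [/\ forall x, 0 <= h x,
  nu.-integrable setT (EFin \o h) &
  forall A, measurable A -> g j A @[j --> \oo] --> \int[nu]_(x in A) h x].
Proof.
have [|||h [h0 hi hE]] := @ac_density _ _ _ nu (fun A => limn (g^~ A)).
- by move=> A mA; apply: limr_ge; [exact: setfun_cvg|near=> j; exact: Rintegral_ge0].
- move=> A B mA mB AB; rewrite -limD; [|exact: setfun_cvg|exact: setfun_cvg].
  by congr (limn _); apply/funext => j; exact: gU.
- move=> e e0; have [del del0 hdel] := f_ui e0; exists del => // A mA nA.
  by apply: limr_le; [exact: setfun_cvg|near=> j; exact: hdel].
exists h; split => // A mA; rewrite -(hE A mA); exact: (setfun_cvg mA).
Unshelve. all: by end_near.
Qed.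

End setfun_limit.

Lemma sum_nat_lt (R : nzRingType) (N t : nat) :
  \sum_(k < N) (k < t)%:R = (minn t N)%:R :> R.
Proof.
elim: N => [|N IH]; first by rewrite big_ord0 minn0.
rewrite big_ord_recr /= IH; have [Nt|tN] := ltnP N t.
  by rewrite (minn_idPr Nt) -natr1.
by rewrite (minn_idPl (leqW tN)) addr0.
Qed.

Section weak_limit.
Context d (T : measurableType d) (R : realType).
Variables (nu : {finite_measure set T -> \bar R}) (f : nat -> T -> R) (h : T -> R).
Hypothesis f_ge0 : forall j x, 0 <= f j x.
Hypothesis h_ge0 : forall x, 0 <= h x.
Hypothesis fi : forall j, nu.-integrable setT (EFin \o f j).
Hypothesis hi : nu.-integrable setT (EFin \o h).
Hypothesis fh : forall A, measurable A ->
  \int[nu]_(x in A) f j x @[j --> \oo] --> \int[nu]_(x in A) h x.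

Lemma integrable_bdM (g psi : T -> R) (M : R) : nu.-integrable setT (EFin \o g) ->
  measurable_fun setT psi -> (forall x, `|psi x| <= M) ->
  nu.-integrable setT (EFin \o (fun x => psi x * g x)).
Proof.
move=> gi mpsi bpsi.
apply: (@integrableMr _ _ _ nu setT measurableT psi (EFin \o g)) => //.
by exists M; split; [exact: num_real|move=> x Mx y _; exact: le_trans (bpsi y) (ltW Mx)].
Qed.

Lemma integrable_bdM_indic (g : T -> R) A : nu.-integrable setT (EFin \o g) ->
  measurable A -> nu.-integrable setT (EFin \o (fun x => \1_A x * g x)).
Proof.
move=> gi mA; apply: (integrable_bdM (M := 1) gi) => // x.
by rewrite indicE; case: (x \in A); rewrite ?normr1 ?normr0.
Qed.

Lemma Rintegral_indicM (g : T -> R) A : measurable A ->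
  \int[nu]_x (\1_A x * g x) = \int[nu]_(x in A) g x.
Proof.
move=> mA; rewrite [RHS]Rintegral_mkcond; apply: eq_Rintegral => x _.
by rewrite indicE patchE; case: ifP => _; rewrite ?mul1r ?mul0r.
Qed.

Lemma bounded_step_approx (psi : T -> R) (M e : R) : 0 < e -> 0 <= M ->
  measurable_fun setT psi -> (forall x, `|psi x| <= M) ->
  exists N (A : nat -> set T), (forall k, measurable (A k)) /\
   forall x, `|psi x - (e * (\sum_(k < N) \1_(A k) x) - M)| <= e.
Proof.
move=> e0 M0 mpsi bpsi.
pose z x := (psi x + M) / e.
have mz : measurable_fun setT z.
  by apply: measurable_funM => //; apply: measurable_funD.
exists (Num.truncn (2 * M / e)).+1, (fun k => [set x | k.+1%:R <= z x]); split.
  move=> k; rewrite -[X in measurable X]setTI.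
  by apply: (measurable_fun_ler (measurable_cst _) mz measurableT (Y := [set true])).
move=> x.
have z0 : 0 <= z x.
  by rewrite divr_ge0// ?(ltW e0)//; have := bpsi x; rewrite ler_norml -subr_ge0 opprK => /andP[].
have zN : z x <= 2 * M / e.
  rewrite ler_pM2r ?invr_gt0//; have := bpsi x; rewrite ler_norml => /andP[_].
  by rewrite mulr2n mulrDl mul1r lerD2r.
have -> : \sum_(k < (Num.truncn (2 * M / e)).+1) \1_[set x | k.+1%:R <= z x] x = (Num.truncn (z x))%:R :> R.
  rewrite (eq_bigr (fun k : 'I__ => (k < Num.truncn (z x))%:R)); last first.
    move=> k _; rewrite indicE; congr ((nat_of_bool _)%:R); rewrite truncn_ge_nat//.
    by apply/idP/idP => [/set_mem//|zk]; exact: mem_set.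
  rewrite sum_nat_lt; congr (_%:R); apply/minn_idPl/leqW.
  exact: le_truncn.
have -> : psi x = e * z x - M by rewrite /z mulrC divfK ?gt_eqF// addrK.
rewrite opprB addrA subrK -mulrBr normrM gtr0_norm// ler_piMr ?(ltW e0)//.
have := truncn_itv z0 => /andP[h1 h2].
by rewrite ger0_norm ?subr_ge0// lerBlDl ltW// natr1.
Qed.

Lemma bounded_weak_cvg (psi : T -> R) (M : R) :
  measurable_fun setT psi -> (forall x, `|psi x| <= M) ->
  \int[nu]_x (psi x * f j x) @[j --> \oo] --> \int[nu]_x (psi x * h x).
Proof.
move=> mpsi bpsi; apply/cvgrPdist_le => e e0.
have /cvg_seq_bounded[B [_ hB]] : cvgn (fun j => \int[nu]_x f j x).
  by apply/cvg_ex; exists (\int[nu]_x h x); exact: fh measurableT.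
pose C : R := `|B| + 1 + \int[nu]_x h x.
have C0 : 0 < C by rewrite ltr_wpDr// ?Rintegral_ge0// ltr_wpDl.
have fC j : \int[nu]_x f j x <= `|B| + 1.
  have B1 : B < `|B| + 1 by rewrite (le_lt_trans (ler_norm _))// ltrDl.
  by have := hB _ B1 j I; rewrite /= ger0_norm// Rintegral_ge0.
have M0 : 0 <= `|M| by [].
have bpsi' x : `|psi x| <= `|M| by exact: le_trans (bpsi x) (ler_norm _).
have eC : 0 < e / C / 2 by rewrite !divr_gt0.
have [N [A [mA hA]]] := bounded_step_approx eC M0 mpsi bpsi'.
set e' := e / C / 2 in eC hA.
pose st x := e' * (\sum_(k < N) \1_(A k) x) - `|M|.
have stM g : nu.-integrable setT (EFin \o g) ->
    \int[nu]_x (st x * g x) = e' * (\sum_(k < N) \int[nu]_(x in A k) g x) - `|M| * \int[nu]_x g x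
    /\ nu.-integrable setT (EFin \o (fun x => st x * g x)).
  move=> gi.
  have S n : nu.-integrable setT (EFin \o (fun x => (\sum_(k < n) \1_(A k) x) * g x)) /\
    \int[nu]_x ((\sum_(k < n) \1_(A k) x) * g x) = \sum_(k < n) \int[nu]_(x in A k) g x.
    elim: n => [|n [IH1 IH2]].
      split.
        apply: eq_integrable (integrable0 nu _) => // x _ /=; by rewrite big_ord0 mul0r.
      by rewrite big_ord0; under eq_Rintegral do rewrite big_ord0 mul0r; rewrite Rintegral_cst// mul0r.
    have E x : (\sum_(k < n.+1) \1_(A k) x) * g x = (\sum_(k < n) \1_(A k) x) * g x + \1_(A n) x * g x.
      by rewrite big_ord_recr /= mulrDl.
    have gA := integrable_bdM_indic gi (mA n).
    split.
      apply: eq_integrable (integrableD measurableT IH1 gA) => // x _ /=.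
      by rewrite E EFinD.
    under eq_Rintegral do rewrite E.
    by rewrite RintegralD// IH2 big_ord_recr /= Rintegral_indicM.
  have [S1 S2] := S N.
  have E x : st x * g x = e' * ((\sum_(k < N) \1_(A k) x) * g x) - `|M| * g x.
    by rewrite /st; ring.
  have i1 : nu.-integrable setT (EFin \o (fun x => e' * ((\sum_(k < N) \1_(A k) x) * g x))).
    by apply: eq_integrable (integrableZl measurableT e' S1) => // x _ /=; rewrite EFinM.
  have i2 : nu.-integrable setT (EFin \o (fun x => `|M| * g x)).
    by apply: eq_integrable (integrableZl measurableT `|M| gi) => // x _ /=; rewrite EFinM.
  split.
    by under eq_Rintegral do rewrite E; rewrite RintegralB// !RintegralZl// S2.
  by apply: eq_integrable (integrableB measurableT i1 i2) => // x _ /=; rewrite E EFinB.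
have est g : nu.-integrable setT (EFin \o g) -> (forall x, 0 <= g x) ->
    `|\int[nu]_x (psi x * g x) - \int[nu]_x (st x * g x)| <= e' * \int[nu]_x g x.
  move=> gi g0; have [_ si] := stM _ gi; have pi := integrable_bdM gi mpsi bpsi.
  rewrite -RintegralB//; apply: le_trans (le_normr_Rintegral _ _) _ => //.
    by apply: eq_integrable (integrableB measurableT pi si) => // x _ /=; rewrite EFinB.
  rewrite -RintegralZl//; apply: le_Rintegral => //.
  - have := integrableB measurableT pi si => /integrable_abse; apply: eq_integrable => // x _ /=.
  - by apply: eq_integrable (integrableZl measurableT e' gi) => // x _ /=; rewrite EFinM.
  - by move=> x _; rewrite -mulrBl normrM (ger0_norm (g0 x)) ler_wpM2r// hA.
have : \int[nu]_x (st x * f j x) @[j --> \oo] --> \int[nu]_x (st x * h x).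
  rewrite (stM _ hi).1.
  rewrite (_ : (fun j => _) = fun j => e' * (\sum_(k < N) \int[nu]_(x in A k) f j x) - `|M| * \int[nu]_x f j x); last first.
    by apply/funext => j; rewrite (stM _ (fi j)).1.
  apply: cvgB; last by apply: cvgMr; exact: fh.
  apply: cvgMr; elim: N {hA st stM est} => [|n IH].
    by under eq_fun do rewrite big_ord0; rewrite big_ord0; exact: cvg_cst.
  under eq_fun do rewrite big_ord_recr/=.
  by rewrite big_ord_recr/=; apply: cvgD => //; exact: fh.
have e2 : 0 < e / 2 by rewrite divr_gt0.
move=> /cvgrPdist_le/(_ _ e2)[n _ hn]; exists n => // j /hn /= h1.
have := est _ hi h_ge0; have := est _ (fi j) (f_ge0 j).
set a := \int[nu]_x (psi x * f j x); set b := \int[nu]_x (psi x * h x) => h2 h3.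
set a' := \int[nu]_x (st x * f j x) in h1 h2; set b' := \int[nu]_x (st x * h x) in h1 h3.
have -> : b - a = (b - b') + (b' - a') - (a - a') by ring.
apply: le_trans (ler_normB _ _) _.
apply: le_trans (lerD (ler_normD _ _) (lexx _)) _.
apply: le_trans (lerD (lerD h3 h1) h2) _.
have h4 : e' * \int[nu]_x f j x <= e' * (`|B| + 1) by rewrite ler_pM2l.
have h5 : e' * C = e / 2 by rewrite /e' mulrAC divfK// gt_eqF.
rewrite /C mulrDr in h5; lra.
Qed.

End weak_limit.

Lemma measurable_erestrict d (T : measurableType d) (R : realType) (D : set T)
    (f : T -> \bar R) :
  measurable D -> measurable_fun setT f -> measurable_fun setT (f \_ D).
Proof.
by move=> mD mf; apply/(measurable_restrictT _ mD); exact: measurable_funTS.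
Qed.

(** * Symmetric kernels *)

Section symmetric_modification.
Context d (T : measurableType d) (R : realType).
Variable nu : {finite_measure set T -> \bar R}.
Variable G1 : T * T -> \bar R.
Hypothesis mG : measurable_fun setT G1.
Hypothesis G_ge0 : forall p, (0 <= G1 p)%E.
Let Gs p := G1 (p.2, p.1).
Hypothesis Gfin : (\int[nu \x nu]_p G1 p < +oo)%E.
Hypothesis Grect : forall A B, measurable A -> measurable B ->
  (\int[nu \x nu]_(p in A `*` B) G1 p = \int[nu \x nu]_(p in A `*` B) G1 (p.2, p.1))%E.

Let mswap : measurable_fun setT (fun p : T * T => (p.2, p.1)).
Proof. by apply: measurable_fun_pair => /=; [exact: measurable_snd|exact: measurable_fst]. Qed.

Let mGs : measurable_fun setT Gs.
Proof. exact: (measurableT_comp mG mswap). Qed.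

Lemma symmetric_ae : ae_eq (nu \x nu)%E setT G1 Gs.
Proof.
have all C : measurable C -> (\int[nu \x nu]_(p in C) G1 p = \int[nu \x nu]_(p in C) Gs p)%E.
  move=> mC.
  have mS D : measurable_fun D G1 by exact: measurable_funTS.
  have mSs D : measurable_fun D Gs by exact: measurable_funTS.
  have le D : measurable D -> (\int[nu \x nu]_(p in D) G1 p < +oo)%E.
    by move=> mD; apply: le_lt_trans Gfin; apply: ge0_subset_integral.
  apply: (@dynkin_induction _ _ _ (fun C => (\int[nu \x nu]_(p in C) G1 p = \int[nu \x nu]_(p in C) Gs p)%E)
    (measurable_prod_measurableType T T)).
  - move=> _ _ [A mA [B mB <-]] [A' mA' [B' mB' <-]].
    exists (A `&` A'); first exact: measurableI.
    by exists (B `&` B'); [exact: measurableI|rewrite setXI].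
  - by have := Grect measurableT measurableT; rewrite setXTT.
  - by move=> _ [A mA [B mB <-]]; exact: Grect.
  - move=> S mS1 hS.
    have hT : (\int[nu \x nu]_p G1 p = \int[nu \x nu]_p Gs p)%E.
      by have := Grect measurableT measurableT; rewrite setXTT.
    have split_ H : measurable_fun setT H -> (forall p, 0 <= H p)%E ->
        (\int[nu \x nu]_p H p = \int[nu \x nu]_(p in S) H p + \int[nu \x nu]_(p in ~` S) H p)%E.
      move=> mH H0; rewrite -ge0_integral_setU//; first by rewrite setUv.
      - exact: measurableC.
      - exact: measurable_funTS.
      - by apply/disj_setPS; rewrite setICr.
    have hS' : (\int[nu \x nu]_(p in S) G1 p = \int[nu \x nu]_(p in S) Gs p)%E := hS.
    have := hT; rewrite (split_ G1)// (split_ Gs)//; last by move=> p; exact: G_ge0.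
    rewrite hS' => e.
    have fS : (\int[nu \x nu]_(p in S) Gs p)%E \is a fin_num.
      by rewrite -hS' ge0_fin_numE ?le// integral_ge0.
    rewrite -[LHS](addeK _ fS) -[RHS](addeK _ fS); congr (_ - _)%E.
    by rewrite addeC [RHS]addeC.
  - move=> F mF tF hF.
    rewrite !ge0_integral_bigcup//; last by move=> p _; exact: G_ge0.
    by apply: eq_eseriesr => i _; exact: hF.
  - by rewrite -measurable_prod_measurableType.
apply: integral_ae_eq => //; last by move=> E _ mE; exact: all.
apply/integrableP; split => //.
by under eq_integral do rewrite gee0_abs//.
Qed.

(* Let [N] be the null set of those [y] for which [G1 (., y)] and [G1 (y, .)] differ on a set of
   positive measure. The modification is [G1] on [~` N `*` N], its transpose on [N `*` ~` N],
   and [0] on [N `*` N] and at the remaining pairs where [G1] is not symmetric: every section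
   [G1 (., y)], not just almost every one, is changed only on a null set. *)
Lemma symmetric_modification : exists G : T * T -> \bar R,
  [/\ measurable_fun setT G, forall p, (0 <= G p)%E,
      forall x y, G (x, y) = G (y, x) &
      forall y, {ae nu, forall x, G (x, y) = G1 (x, y)}].
Proof.
pose S := [set p | G1 p != Gs p].
have mS : measurable S.
  have := measurableU _ _ (emeasurable_fun_lt measurableT mG mGs) (emeasurable_fun_lt measurableT mGs mG).
  rewrite !setTI; congr measurable; apply/seteqP; split => p /=.
    by case=> h; rewrite /S /=; [rewrite lt_eqF|rewrite gt_eqF].
  by rewrite /S /= neq_lt => /orP[]; [left|right].
have S0 : (nu \x nu)%E S = 0%E.
  have [N [mN N0 hN]] := symmetric_ae.
  apply/eqP; rewrite eq_le measure_ge0 andbT -[leRHS]N0 le_measure ?inE//.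
  by move=> p /= /eqP Sp; apply: hN => /= /(_ I).
pose N := [set y | nu (ysection S y) != 0].
have mN : measurable N.
  rewrite -[X in measurable X]setTI; apply: emeasurable_neq => //.
  exact: measurable_fun_ysection.
have N0 : nu N = 0%E.
  have : (\int[nu]_y nu (ysection S y) = 0)%E.
    have := fubini_tonelli2 (m1 := nu) (m2 := nu) (EFin \o \1_S).
    rewrite (indic_fubini_tonelli_GE nu mS) => <-.
    - by rewrite integral_indic// setIT.
    - exact/measurable_EFinP.
    - by move=> p; rewrite lee_fin.
  move=> i0.
  have : (\int[nu]_y `|nu (ysection S y)| = 0)%E by under eq_integral do rewrite gee0_abs//.
  move/(ae_eq_integral_abs nu measurableT (measurable_fun_ysection nu mS)).
  move=> [M [mM M0 hM]]; apply/eqP; rewrite eq_le measure_ge0 andbT -[leRHS]M0 le_measure ?inE//.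
  by move=> y /= /eqP Ny; apply: hM => /= /(_ I).
have Ssym x y : ((x, y) \in S) = ((y, x) \in S).
  by apply/idP/idP; rewrite !inE /S /Gs /= eq_sym.
pose A1 := ~` N `*` N; pose A2 := N `*` ~` N; pose A3 := (~` N `*` ~` N) `\` S.
have mA1 : measurable A1 by apply: measurableX => //; exact: measurableC.
have mA2 : measurable A2 by apply: measurableX => //; exact: measurableC.
have mA3 : measurable A3.
  by apply: measurableD => //; apply: measurableX; exact: measurableC.
pose G p := ((G1 \_ A1) p + (Gs \_ A2) p + (G1 \_ A3) p)%E.
have E1 x y : ((x, y) \in A1) = (x \notin N) && (y \in N) by rewrite in_setX in_setC.
have E2 x y : ((x, y) \in A2) = (x \in N) && (y \notin N) by rewrite in_setX in_setC.
have E3 x y : ((x, y) \in A3) = [&& x \notin N, y \notin N & (x, y) \notin S].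
  by rewrite in_setD in_setX !in_setC andbA.
have eqS x y : (x, y) \notin S -> G1 (x, y) = G1 (y, x).
  by rewrite notin_setE /S /= => /negP; rewrite negbK => /eqP.
exists G; split.
- by apply: emeasurable_funD; [apply: emeasurable_funD|]; exact: measurable_erestrict.
- by move=> p; rewrite !adde_ge0// patchE; case: ifP => // _; exact: G_ge0.
- move=> x y; rewrite /G !patchE !E1 !E2 !E3 (Ssym y x) /Gs /=.
  case: (x \in N); case: (y \in N) => //=; rewrite ?adde0 ?add0e//.
  by case: ifP => // /eqS.
- move=> y; have [yN|yN] := boolP (y \in N).
    exists N; split => // x /= h; apply: contrapT => xN; apply: h.
    by rewrite /G !patchE E1 E2 E3 yN memNset//= !adde0.
  have sy0 : nu (ysection S y) = 0%E.
    by move: yN; rewrite notin_setE /N /= => /negP; rewrite negbK => /eqP.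
  exists (N `|` ysection S y); split.
  + by apply: measurableU => //; exact: measurable_ysection.
  + apply/eqP; rewrite eq_le measure_ge0 andbT.
    have U2 : (nu (N `|` ysection S y) <= nu N + nu (ysection S y))%E.
      by apply: measureU2 => //; exact: measurable_ysection.
    by apply: le_trans U2 _; rewrite N0 sy0 adde0.
  + move=> x /= h; apply: contrapT => /not_orP[xN xS]; apply: h.
    have xyS : (x, y) \notin S by apply/negP; move: xS; rewrite /ysection /=.
    by rewrite /G !patchE E1 E2 E3 xyS (negbTE yN) (memNset xN)/= !add0e.
Qed.

End symmetric_modification.

Section green_kernel.
Context d (T : measurableType d) (R : realType).
Variable nu : {finite_measure set T -> \bar R}.
Variable c : nat -> T -> nat.
Hypothesis mc : forall m, measurable_fun setT (c m).
Hypothesis cS : forall m x y, c m.+1 x = c m.+1 y -> c m x = c m y.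
Hypothesis cgen : @measurable _ T = <<s [set A | exists k i, A = c k @^-1` [set i]] >>.
Variable u : set T -> T -> R.
Hypothesis mu_ : forall E, measurable E -> measurable_fun setT (u E).
Hypothesis u_ge0 : forall E x, 0 <= u E x.
Hypothesis uK : exists K : R, forall E, measurable E -> {ae nu, forall x, u E x <= K}.
Hypothesis u_ui : forall e : R, 0 < e -> exists2 del : R, 0 < del &
  forall E, measurable E -> (nu E <= del%:E)%E -> {ae nu, forall x, u E x <= e}.
Hypothesis u_sym : forall E F, measurable E -> measurable F ->
  \int[nu]_(x in F) u E x = \int[nu]_(x in E) u F x.

Let mcell n y : measurable (cell c n y) := measurable_cell mc n y.

Lemma potential_integrable E : measurable E -> nu.-integrable setT (EFin \o u E).
Proof.
move=> mE; have [K hK] := uK.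
apply/integrableP; split; first exact/measurable_EFinP/mu_.
apply: (@le_lt_trans _ _ (`|K|%:E * nu setT)%E).
  apply: integral_le_bound => //; first exact/measurable_EFinP/mu_.
  apply: filterS (hK _ mE) => x h _ /=; rewrite lee_fin ger0_norm//.
  exact: le_trans h (ler_norm _).
by rewrite lte_mul_pinfty// ltey_eq fin_num_measure.
Qed.

Let gam n y A := (fine (nu (cell c n y)))^-1 * \int[nu]_(x in A) u (cell c n y) x.

Lemma avg_le_bound (f : T -> R) n y (e : R) : measurable_fun setT f -> (forall x, 0 <= f x) ->
  0 <= e -> {ae nu, forall x, f x <= e} -> avg nu c n f y <= e.
Proof.
move=> mf f0 e0 he; rewrite /avg.
have : (\int[nu]_(x in cell c n y) (f x)%:E <= e%:E * nu (cell c n y))%E.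
  rewrite -integral_cst//; apply: ae_ge0_le_integral => //.
  - by move=> x _; rewrite lee_fin.
  - by apply/measurable_EFinP; exact: measurable_funTS.
  - by apply: filterS he => x h _; rewrite lee_fin.
have nf : nu (cell c n y) \is a fin_num by exact: fin_num_measure.
move=> h.
have h2 : \int[nu]_(x in cell c n y) f x <= e * fine (nu (cell c n y)).
  rewrite /Rintegral -lee_fin fineK.
    by apply: le_trans h _; rewrite -[in leLHS](fineK nf) -EFinM.
  rewrite ge0_fin_numE; last by apply: integral_ge0 => x _; rewrite lee_fin.
  by apply: le_lt_trans h _; rewrite -(fineK nf) -EFinM ltry.
have [n0|n0] := eqVneq (fine (nu (cell c n y))) 0.
  by rewrite n0 invr0 mul0r.
by rewrite mulrC ler_pdivrMr// lt_neqAle eq_sym n0 fine_ge0.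
Qed.

Lemma gamE n y A : measurable A -> gam n y A = avg nu c n (u A) y.
Proof. by move=> mA; rewrite /gam /avg u_sym. Qed.

Let cellset (i : nat) : set T :=
  if i is i'.+1 then
    if unpickle i' is Some (k, l) then c k @^-1` [set l] else set0
  else setT.

Let mcellset i : measurable (cellset i).
Proof.
case: i => //= i; case: (unpickle i) => [[k l]|//].
exact: measurable_code_preimage.
Qed.

Lemma green_subsequence : exists s : nat -> T -> nat,
  [/\ forall j, measurable_fun setT (s j), forall j y, (j <= s j y)%N &
      forall i y, cvgn (fun j => gam (s j y) y (cellset i))].
Proof.
apply: (@measurable_subsequence _ _ _ (fun i n y => gam n y (cellset i))).
  move=> i n; apply: (measurable_code_factor mc (m := n)) => x y cxy.
  by rewrite /gam (cell_code cxy).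
move=> i y; have [K hK] := uK; exists `|K| => n.
rewrite ger0_norm; last by rewrite mulr_ge0 ?Rintegral_ge0// invr_ge0 fine_ge0.
rewrite gamE//; apply: avg_le_bound => //; first exact: mu_.
by apply: filterS (hK _ (mcellset i)) => x h; exact: le_trans h (ler_norm _).
Qed.

Lemma green_densities (s : nat -> T -> nat) :
  (forall i y, cvgn (fun j => gam (s j y) y (cellset i))) ->
  exists h : T -> T -> R, [/\ forall y x, 0 <= h y x,
    forall y, nu.-integrable setT (EFin \o h y),
    forall y A, measurable A -> gam (s j y) y A @[j --> \oo] --> \int[nu]_(x in A) h y x &
    forall y (psi : T -> R) (M : R), measurable_fun setT psi -> (forall x, `|psi x| <= M) ->
      (fine (nu (cell c (s j y) y)))^-1 * \int[nu]_x (psi x * u (cell c (s j y) y) x) @[j --> \oo]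
      --> \int[nu]_x (psi x * h y x)].
Proof.
move=> scvg.
pose f y j x := (fine (nu (cell c (s j y) y)))^-1 * u (cell c (s j y) y) x.
have q0 j y : 0 <= (fine (nu (cell c (s j y) y)))^-1 by rewrite invr_ge0 fine_ge0.
have f0 y j x : 0 <= f y j x by rewrite mulr_ge0.
have fi y j : nu.-integrable setT (EFin \o f y j).
  apply: eq_integrable (integrableZl measurableT _ (potential_integrable (mcell (s j y) y))) => //.
have fE y j A : measurable A -> \int[nu]_(x in A) f y j x = gam (s j y) y A.
  move=> mA; rewrite /f RintegralZl//; apply: integrableS (potential_integrable _) => //.
have fE' y A : measurable A -> (fun j => \int[nu]_(x in A) f y j x) = (fun j => gam (s j y) y A).
  by move=> mA; apply/funext => j; exact: fE.
have hy y : exists h : T -> R, [/\ forall x, 0 <= h x,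
    nu.-integrable setT (EFin \o h) &
    forall A, measurable A -> gam (s j y) y A @[j --> \oo] --> \int[nu]_(x in A) h x].
  have [|||h [h0 hi hA]] := @setfun_limit_density _ _ _ nu (f y) (f0 y) (fi y) _ (cells c) (cells_gen mc cgen) (cells_setI cS).
  - move=> e e0; have [del del0 hdel] := u_ui e0; exists del => // A j mA nA.
    rewrite fE// gamE//; apply: avg_le_bound => //; [exact: mu_|exact: ltW|exact: hdel].
  - move=> A [->|[k [l ->]]].
      by under eq_fun do rewrite Rintegral_set0; exact: is_cvg_cst.
    rewrite (_ : (fun j => _) = fun j => gam (s j y) y (cellset (pickle (k, l)).+1)); first exact: scvg.
    by apply/funext => j; rewrite fE /= ?pickleK//; exact: measurable_code_preimage.
  - rewrite (_ : (fun j => _) = fun j => gam (s j y) y (cellset 0)); first exact: scvg.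
    by apply/funext => j; rewrite fE.
  by exists h; split => // A mA; rewrite -fE'//; exact: hA.
have [h hP] := choice hy; exists h; split.
- by move=> y; case: (hP y).
- by move=> y; case: (hP y).
- by move=> y; case: (hP y).
- move=> y psi M mpsi bpsi; have [h0 hi hA] := hP y.
  have := @bounded_weak_cvg _ _ _ nu (f y) (h y) (f0 y) h0 (fi y) hi _ psi M mpsi bpsi.
  rewrite (_ : (fun j => \int[nu]_x (psi x * f y j x)) = fun j =>
     (fine (nu (cell c (s j y) y)))^-1 * \int[nu]_x (psi x * u (cell c (s j y) y) x)).
    by apply => A mA; rewrite fE'//; exact: hA.
  apply/funext => j; rewrite -RintegralZl//.
    by apply: eq_Rintegral => x _; rewrite /f mulrCA.
  exact: integrable_bdM (potential_integrable _) mpsi bpsi.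
Qed.

Theorem green_kernel : exists G : T * T -> \bar R,
  [/\ measurable_fun setT G, forall p, (0 <= G p)%E,
      forall x y, G (x, y) = G (y, x) &
      forall y, (\int[nu]_x G (x, y) < +oo)%E /\ exists s : nat -> nat,
        (forall j, (j <= s j)%N) /\
        forall (psi : T -> R) (M l : R), measurable_fun setT psi -> (forall x, `|psi x| <= M) ->
        (fine (nu (cell c (s j) y)))^-1 * \int[nu]_x (psi x * u (cell c (s j) y) x)
          @[j --> \oo] --> l ->
        (\int[nu]_x (G (x, y) * (psi x)%:E) = l%:E)%E].
Proof.
have [s [ms sj scvg]] := green_subsequence.
have [h [h0 hi hA hpsi]] := green_densities scvg.
pose lam y A := \int[nu]_(x in A) h y x.
have mlam A : measurable A -> measurable_fun setT (lam^~ A).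
  move=> mA; apply: (measurable_fun_cvg (h := fun j y => gam (s j y) y A)).
    move=> j; apply: (measurable_select (f := fun n y => gam n y A)) => // n.
    by apply: (measurable_code_factor mc (m := n)) => x y cxy; rewrite /gam (cell_code cxy).
  by move=> y _; exact: hA.
pose G1 (p : T * T) := (`|limn_esup (fun m => ((fine (nu (cell c m p.1)))^-1 *
   lam p.2 (cell c m p.1))%:E)|)%E.
have mG1 : measurable_fun setT G1.
  apply: measurableT_comp => //; apply: measurable_fun_limn_esup => m.
  apply/measurable_EFinP.
  apply: (measurable_select (f := fun i (p : T * T) => (fine (nu (c m @^-1` [set i])))^-1 *
   lam p.2 (c m @^-1` [set i])) (s := fun p : T * T => c m p.1)).
    move=> i; apply: measurable_funM => //.
    apply: (measurableT_comp (mlam _ _)) => //; exact: measurable_code_preimage.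
  exact: measurableT_comp.
have G1_ge0 p : (0 <= G1 p)%E by exact: abse_ge0.
have G1ae y : {ae nu, forall x, G1 (x, y) = (h y x)%:E}.
  have [_] := dyadic_differentiation mc cS cgen (hi y).
  apply: filterS => x hx; rewrite /G1 /=.
  have hx' : ((fine (nu (cell c m x)))^-1 * lam y (cell c m x))%:E @[m --> \oo] --> (h y x)%:E.
    by apply: cvg_EFin; [near=> m|exact: hx].
  by rewrite (cvg_limn_einf_sup hx').2 gee0_abs ?lee_fin.
have lamae A : measurable A -> {ae nu, forall y, lam y A = u A y}.
  move=> mA; have [_] := dyadic_differentiation mc cS cgen (potential_integrable mA).
  apply: filterS => y hy.
  have hs : gam (s j y) y A @[j --> \oo] --> u A y.
    apply/cvgrPdist_le => e e0; move/cvgrPdist_le : hy => /(_ _ e0)[N _ hN].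
    exists N => // j /= Nj; rewrite gamE//; apply: hN => /=; exact: leq_trans Nj (sj _ _).
  exact: (cvg_unique _ (hA y A mA) hs).
have intG1 y A : measurable A -> (\int[nu]_(x in A) G1 (x, y) = (lam y A)%:E)%E.
  move=> mA; rewrite /lam /Rintegral fineK; last first.
    by apply: integrable_fin_num => //; exact: integrableS (hi y).
  apply: ae_eq_integral => //.
  - by apply: measurable_funTS; exact: (measurableT_comp mG1).
  - by apply/measurable_EFinP/measurable_funTS/measurable_EFinP; exact: measurable_int (hi y).
  - by apply: filterS (G1ae y) => x hx _.
have intu A B : measurable A -> measurable B ->
    (\int[nu]_(y in B) (lam y A)%:E = (\int[nu]_(y in B) u A y)%:E)%E.
  move=> mA mB; rewrite /Rintegral fineK; last first.
    by apply: integrable_fin_num => //; exact: integrableS (potential_integrable mA).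
  apply: ae_eq_integral => //.
  - by apply/measurable_EFinP/measurable_funTS; exact: mlam.
  - by apply/measurable_EFinP/measurable_funTS; exact: mu_.
  - by apply: filterS (lamae A mA) => x hx _; rewrite hx.
have rect2 A B : measurable A -> measurable B ->
    (\int[nu \x nu]_(p in A `*` B) G1 p = (\int[nu]_(y in B) u A y)%:E)%E.
  move=> mA mB; rewrite integral_mkcond fubini_tonelli2//; last 2 first.
  - by apply: measurable_erestrict => //; exact: measurableX.
  - by move=> p; rewrite patchE; case: ifP.
  rewrite -intu// [RHS]integral_mkcond; apply: eq_integral => y _.
  rewrite /fubini_G patchE; case: ifPn => yB.
    rewrite -intG1// [RHS]integral_mkcond; apply: eq_integral => x _.
    by rewrite !patchE in_setX /= yB andbT.
  by rewrite integral0_eq// => x _; rewrite patchE in_setX /= (negbTE yB) andbF.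
have rect1 A B : measurable A -> measurable B ->
    (\int[nu \x nu]_(p in A `*` B) G1 (p.2, p.1) = (\int[nu]_(x in A) u B x)%:E)%E.
  move=> mA mB; rewrite integral_mkcond fubini_tonelli1//; last 2 first.
  - apply: measurable_erestrict; first exact: measurableX.
    apply: (measurableT_comp mG1); apply: measurable_fun_pair => /=; [exact: measurable_snd|exact: measurable_fst].
  - by move=> p; rewrite patchE; case: ifP.
  rewrite -intu// [RHS]integral_mkcond; apply: eq_integral => x _.
  rewrite /fubini_F patchE; case: ifPn => xA.
    rewrite -intG1// [RHS]integral_mkcond; apply: eq_integral => y _.
    by rewrite !patchE in_setX /= xA.
  by rewrite integral0_eq// => y _; rewrite patchE in_setX /= (negbTE xA).
have [||G [mG G0 Gsym Gae]] := @symmetric_modification _ _ _ nu G1 mG1 G1_ge0.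
- by have := rect2 _ _ measurableT measurableT; rewrite setXTT => ->; exact: ltry.
- by move=> A B mA mB; rewrite rect1// rect2// u_sym.
exists G; split => // y.
have Gh : {ae nu, forall x, G (x, y) = (h y x)%:E}.
  by apply: filterS2 (Gae y) (G1ae y) => x -> ->.
have mGy : measurable_fun setT (fun x => G (x, y)) by exact: (measurableT_comp mG).
have mh : measurable_fun setT (h y) by apply/measurable_EFinP; exact: measurable_int (hi y).
split.
  rewrite (_ : (\int[nu]_x G (x, y) = \int[nu]_x (h y x)%:E)%E).
    by rewrite ltey_eq (integrable_fin_num measurableT (hi y)).
  apply: ae_eq_integral => //; first exact/measurable_EFinP.
  by apply: filterS Gh => x hx _.
exists (s^~ y); split => // psi M l mpsi bpsi hl.
have -> : l = \int[nu]_x (psi x * h y x) by exact: (cvg_unique _ hl (hpsi y psi M mpsi bpsi)).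
have psih := integrable_bdM (hi y) mpsi bpsi.
rewrite /Rintegral fineK; last exact: integrable_fin_num.
apply: ae_eq_integral => //.
- by apply: emeasurable_funM => //; exact/measurable_EFinP.
- exact: measurable_int psih.
- by apply: filterS Gh => x hx _; rewrite hx -EFinM mulrC.
Unshelve. all: by end_near.
Qed.

End green_kernel.

(** * Potentials of a Dirichlet form *)

Lemma quadratic_ge0_discr (R : realType) (a b c : R) : 0 <= c ->
  (forall t, 0 <= a + 2 * b * t + c * t ^+ 2) -> b ^+ 2 <= a * c.
Proof.
move=> c0 h; have [c00|cn0] := eqVneq c 0.
  have [->|b0] := eqVneq b 0; first by rewrite c00 mulr0 expr0n.
  have := h (- (a + 1) / (2 * b)); rewrite c00 mul0r addr0.
  rewrite [2 * b * _]mulrC divfK ?mulf_neq0//; lra.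
have cp : 0 < c by rewrite lt_neqAle eq_sym cn0.
have := h (- b / c).
have -> : a + 2 * b * (- b / c) + c * (- b / c) ^+ 2 = (a * c - b ^+ 2) / c by field.
by rewrite ler_pdivlMr// mul0r subr_ge0.
Qed.

Section riesz.
Context (T : Type) (R : realType).
Variables (H : set (T -> R)) (B : (T -> R) -> (T -> R) -> R) (l : (T -> R) -> R).
Hypothesis H0 : H (fun=> 0).
Hypothesis HL : forall a u v, H u -> H v -> H (fun x => a * u x + v x).
Hypothesis BC : forall u v, B u v = B v u.
Hypothesis BL : forall a u v z, H u -> H v -> H z ->
  B (fun x => a * u x + v x) z = a * B u z + B v z.
Hypothesis B_ge0 : forall u, 0 <= B u u.
Hypothesis lL : forall a u v, H u -> H v -> l (fun x => a * u x + v x) = a * l u + l v.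

Lemma form_quadratic a u v : H u -> H v ->
  B (fun x => a * u x + v x) (fun x => a * u x + v x) =
  B v v + 2 * B u v * a + B u u * a ^+ 2.
Proof.
move=> Hu Hv; have Huv := HL a Hu Hv.
by rewrite BL// (BC u) (BC v) !BL// (BC v u); ring.
Qed.

Lemma form_cauchy_schwarz u v : H u -> H v -> B u v ^+ 2 <= B v v * B u u.
Proof.
move=> Hu Hv; apply: quadratic_ge0_discr => // t.
by rewrite -form_quadratic.
Qed.

Variable C : R.
Hypothesis C_ge0 : 0 <= C.
Hypothesis lC : forall u, H u -> l u ^+ 2 <= C * B u u.
Hypothesis Bcomplete : forall u_ : nat -> T -> R, (forall n, H (u_ n)) ->
  (forall e, 0 < e -> exists N, forall m n, (N <= m)%N -> (N <= n)%N ->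
     B (fun x => u_ m x - u_ n x) (fun x => u_ m x - u_ n x) <= e) ->
  exists2 u, H u & forall e, 0 < e -> exists2 n, (e^-1 <= n%:R) &
     B (fun x => u x - u_ n x) (fun x => u x - u_ n x) <= e.

Theorem riesz_representation : exists2 u, H u & forall v, H v -> B u v = l v.
Proof.
have subE (u v : T -> R) : (fun x => u x - v x) = fun x => (-1) * v x + u x.
  by apply/funext => x; rewrite mulN1r addrC.
have HB u v : H u -> H v -> H (fun x => u x - v x) by move=> *; rewrite subE; exact: HL.
have BB u v z : H u -> H v -> H z -> B (fun x => u x - v x) z = B u z - B v z.
  by move=> *; rewrite subE BL// mulN1r addrC.
pose J u := B u u - 2 * l u.
have J_ge u : H u -> - C <= J u.
  move=> Hu; have := lC Hu; have := B_ge0 u; rewrite /J.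
  set b := B u u; set x := l u => b0 hx.
  rewrite leNgt; apply/negP => h.
  have h1 : 0 < 2 * x - (b + C) by lra.
  have C0 : 0 <= C by exact: C_ge0.
  have bC : 0 <= b + C by exact: addr_ge0.
  have h2 : 0 < 2 * x + (b + C) by lra.
  have := mulr_gt0 h1 h2; have := sqr_ge0 (b - C); nra.
pose S := [set J u | u in H].
have infS : has_inf S.
  split; first by exists (J (fun=> 0)), (fun=> 0).
  by exists (- C) => _ [u Hu <-]; exact: J_ge.
have ex n : exists u, H u /\ J u < inf S + n.+1%:R^-1.
  have [|_ [u Hu <-] hu] := @inf_adherent _ S (n.+1%:R^-1) _ infS; first by rewrite invr_gt0.
  by exists u.
have [u_ hu_] := choice ex.
have Hu n : H (u_ n) by case: (hu_ n).
have Dn n v : H v -> (B (u_ n) v - l v) ^+ 2 <= n.+1%:R^-1 * B v v.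
  move=> Hv; apply: quadratic_ge0_discr => // t.
  have : inf S <= J (fun x => t * v x + u_ n x).
    by apply: ge_inf; [exact: infS.2|exists (fun x => t * v x + u_ n x) => //; exact: HL].
  have [_] := hu_ n; rewrite /J form_quadratic// lL// (BC v (u_ n)).
  set e1 := n.+1%:R^-1; set b1 := B _ _; set b2 := B _ v; set b3 := B v v; nra.
have [|u Hu' hu'] := Bcomplete Hu.
  move=> e e0; exists (Num.truncn (4 / e)) => m n Nm Nn.
  set v := fun x => _; have Hv : H v by exact: HB.
  have : B v v = (B (u_ m) v - l v) - (B (u_ n) v - l v) by rewrite [LHS]BB//; ring.
  have := Dn m v Hv; have := Dn n v Hv.
  set b := B v v; set p := B _ _ - _; set q := B _ _ - _ => hp hq bE.
  have b0 : 0 <= b by exact: B_ge0.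
  have small k : (Num.truncn (4 / e) <= k)%N -> k.+1%:R^-1 <= e / 4.
    move=> Nk; rewrite -[leRHS]invrK lef_pV2 ?posrE ?invr_gt0 ?divr_gt0//.
    rewrite invf_div; apply: le_trans (ltW (truncnS_gt _)) _; rewrite ler_nat; exact: Nk.
  have := small _ Nm; have := small _ Nn.
  set e1 := n.+1%:R^-1 in hp *; set e2 := m.+1%:R^-1 in hq * => h1 h2.
  have hp' : p ^+ 2 <= e / 4 * b by apply: le_trans hp _; rewrite ler_wpM2r.
  have hq' : q ^+ 2 <= e / 4 * b by apply: le_trans hq _; rewrite ler_wpM2r.
  have : b ^+ 2 <= e * b.
    by rewrite bE; have := sqr_ge0 (p + q); rewrite -bE; nra.
  have [->|bn0] := eqVneq b 0; first by move=> _; exact: ltW.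
  by rewrite expr2 ler_pM2r// lt_neqAle eq_sym bn0.
exists u => // v Hv; apply/eqP; rewrite -subr_eq0 -sqrf_eq0 eq_le sqr_ge0 andbT.
apply/ler_addgt0Pr => e e0; rewrite add0r.
pose e' := e / (4 * (B v v + 1)).
have bv := B_ge0 v.
have e'0 : 0 < e' by rewrite divr_gt0// mulr_gt0// ltr_wpDl.
have [n hn hb] := hu' _ e'0.
set z := (fun x => u x - u_ n x) in hb.
have Hz : H z by exact: HB.
have -> : B u v - l v = B z v + (B (u_ n) v - l v) by rewrite BB//; ring.
have := form_cauchy_schwarz Hz Hv; have := Dn n v Hv.
set p := B _ _ - _; set q := B z v => hp hq.
have hn' : n.+1%:R^-1 <= e'.
  rewrite -[leRHS]invrK lef_pV2 ?posrE ?invr_gt0//; apply: le_trans hn _.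
  by rewrite ler_nat.
have hp' : p ^+ 2 <= e' * B v v by apply: le_trans hp _; rewrite ler_wpM2r.
have hq' : q ^+ 2 <= e' * B v v by apply: le_trans hq _; rewrite mulrC ler_wpM2r.
have E : e' * (4 * (B v v + 1)) = e by rewrite divfK// gt_eqF// mulr_gt0// ltr_wpDl.
have := sqr_ge0 (p - q); rewrite -E; nra.
Qed.

End riesz.

Section weighted_L2.
Context d (S : measurableType d) (R : realType) (m : {measure set S -> \bar R}).
Variable r : S -> R.
Hypothesis mr : measurable_fun setT r.
Hypothesis r_ge0 : forall x, 0 <= r x.

Definition wL2 (f : S -> R) := measurable_fun setT f /\
  m.-integrable setT (EFin \o (fun x => f x ^+ 2 * r x)).

Definition wip (f g : S -> R) : R := \int[m]_x (f x * g x * r x).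

Lemma integrable_dom (f g : S -> R) : measurable_fun setT f ->
  (forall x, `|f x| <= g x) -> m.-integrable setT (EFin \o g) ->
  m.-integrable setT (EFin \o f).
Proof.
move=> mf fg; apply: le_integrable => //; first exact/measurable_EFinP.
by move=> x _ /=; rewrite lee_fin (le_trans (fg x))// ler_norm.
Qed.

Lemma wL2M f g : wL2 f -> wL2 g ->
  m.-integrable setT (EFin \o (fun x => f x * g x * r x)).
Proof.
move=> [mf fi] [mg gi].
apply: (@integrable_dom _ (fun x => f x ^+ 2 * r x + g x ^+ 2 * r x)).
- by apply: measurable_funM => //; apply: measurable_funM.
- move=> x; rewrite normrM (ger0_norm (r_ge0 x)) -mulrDl ler_wpM2r//.
  rewrite normrM -[f x ^+ 2]real_normK ?num_real// -[g x ^+ 2]real_normK ?num_real//.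
  by have := sqr_ge0 (`|f x| - `|g x|); nra.
- by apply: eq_integrable (integrableD measurableT fi gi) => // x _ /=; rewrite EFinD.
Qed.

Lemma wL2_le (f g : S -> R) : wL2 f -> measurable_fun setT g ->
  (forall x, `|g x| <= `|f x|) -> wL2 g.
Proof.
move=> [mf fi] mg gf; split => //; apply: integrable_dom fi.
  by apply: measurable_funM => //; exact: measurable_funX.
move=> x; rewrite normrM (ger0_norm (r_ge0 x)) ler_wpM2r//.
by rewrite normrX -[leRHS]real_normK ?num_real// lerXn2r ?nnegrE.
Qed.

Lemma wL2_lin a f g : wL2 f -> wL2 g -> wL2 (fun x => a * f x + g x).
Proof.
move=> Lf Lg; have [mf fi] := Lf; have [mg gi] := Lg; have fgi := wL2M Lf Lg.
have mL : measurable_fun setT (fun x => a * f x + g x).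
  by apply: measurable_funD => //; exact: measurable_funM.
split => //.
have i1 := integrableZl measurableT (a ^+ 2) fi.
have i2 := integrableZl measurableT (2 * a) fgi.
apply: eq_integrable (integrableD measurableT (integrableD measurableT i1 i2) gi) => // x _ /=.
by rewrite -!EFinM -!EFinD; congr (_%:E); ring.
Qed.

Lemma wipC f g : wip f g = wip g f.
Proof. by apply: eq_Rintegral => x _; rewrite (mulrC (f x)). Qed.

Lemma wip_lin a f g h : wL2 f -> wL2 g -> wL2 h ->
  wip (fun x => a * f x + g x) h = a * wip f h + wip g h.
Proof.
move=> Lf Lg Lh; have fh := wL2M Lf Lh; have gh := wL2M Lg Lh.
rewrite /wip -RintegralZl// -RintegralD//.
  by apply: eq_Rintegral => x _; ring.
by apply: eq_integrable (integrableZl measurableT a fh) => // x _ /=; rewrite EFinM.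
Qed.

Lemma wip_ge0 f : 0 <= wip f f.
Proof. by apply: Rintegral_ge0 => x _; rewrite mulr_ge0// -expr2 sqr_ge0. Qed.

Lemma wL2P (f : S -> R) (c : R) : measurable_fun setT f ->
  (\int[m]_x (f x ^+ 2 * r x)%:E <= c%:E)%E -> wL2 f /\ wip f f <= c.
Proof.
move=> mf h.
have f0 x : 0 <= f x ^+ 2 * r x by rewrite mulr_ge0// sqr_ge0.
have mff : measurable_fun setT (EFin \o (fun x => f x ^+ 2 * r x)).
  by apply/measurable_EFinP; apply: measurable_funM => //; exact: measurable_funX.
split.
  split => //; apply/integrableP; split => //.
  under eq_integral do rewrite gee0_abs ?lee_fin//.
  exact: le_lt_trans h (ltry _).
have -> : wip f f = \int[m]_x (f x ^+ 2 * r x) by apply: eq_Rintegral => x _; rewrite expr2.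
rewrite -lee_fin /Rintegral fineK// ge0_fin_numE; first exact: le_lt_trans h (ltry _).
by apply: integral_ge0 => x _; rewrite lee_fin.
Qed.

Lemma wipE f : wL2 f -> (\int[m]_x (f x ^+ 2 * r x)%:E = (wip f f)%:E)%E.
Proof.
move=> [mf fi]; have -> : wip f f = \int[m]_x (f x ^+ 2 * r x) by apply: eq_Rintegral => x _; rewrite expr2.
by rewrite /Rintegral fineK//; exact: (integrable_fin_num measurableT fi).
Qed.

Lemma wip_fatou (f_ : nat -> S -> R) (f : S -> R) (c : R) : (forall n, wL2 (f_ n)) ->
  measurable_fun setT f -> {ae m, forall x, f_ n x @[n --> \oo] --> f x} ->
  (exists N, forall n, (N <= n)%N -> wip (f_ n) (f_ n) <= c) ->
  wL2 f /\ wip f f <= c.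
Proof.
move=> Lf mf ff [N hN]; apply: wL2P => //.
have mF n : measurable_fun setT (fun x => (f_ n x ^+ 2 * r x)%:E).
  apply/measurable_EFinP; apply: measurable_funM => //.
  by apply: measurable_funX; case: (Lf n).
have F0 n x : (0 <= (f_ n x ^+ 2 * r x)%:E)%E by rewrite lee_fin mulr_ge0// sqr_ge0.
have := fatou m measurableT mF (fun n x _ => F0 n x).
have -> : (\int[m]_x limn_einf (fun n => (f_ n x ^+ 2 * r x)%:E) = \int[m]_x (f x ^+ 2 * r x)%:E)%E.
  apply: ae_eq_integral => //.
  - rewrite (_ : (fun x => _) = fun x => (- limn_esup (fun n => - (f_ n x ^+ 2 * r x)%:E))%E).
      apply: measurableT_comp => //; apply: measurable_fun_limn_esup => n.
      exact: measurableT_comp.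
    by apply/funext => x; rewrite -limn_einfN; congr limn_einf; apply/funext => n /=; rewrite opprK.
  - by apply/measurable_EFinP; apply: measurable_funM => //; exact: measurable_funX.
  - apply: filterS ff => x fx _.
    have := cvg_limn_einf_sup (u := fun n => (f_ n x ^+ 2 * r x)%:E) (l := (f x ^+ 2 * r x)%:E).
    case=> //; apply: cvg_EFin; first by near=> n.
    by apply: cvgMl; apply: cvgM.
move/le_trans; apply.
rewrite limn_einf_lim; apply: lime_le; first exact: is_cvg_einfs.
near=> n; apply: ereal_inf_le; exists (\int[m]_x (f_ (n + N)%N x ^+ 2 * r x)%:E)%E.
  by exists (n + N)%N => //=; exact: leq_addr.
by rewrite wipE// lee_fin hN// leq_addl.
Unshelve. all: by end_near.
Qed.

End weighted_L2.

Lemma L2_fast_cauchy_ae d (T : measurableType d) (R : realType)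
    (m : {measure set T -> \bar R}) (f_ : nat -> T -> R) :
  (forall k, measurable_fun setT (f_ k)) ->
  (forall k, (\int[m]_x ((f_ k.+1 x - f_ k x) ^+ 2)%:E <= ((1 / (2 ^ (k + 1))%:R) ^+ 2)%:E)%E) ->
  exists2 f : T -> R, measurable_fun setT f & {ae m, forall x, f_ k x @[k --> \oo] --> f x}.
Proof.
move=> mf hf.
pose h k : R := 1 / (2 ^ (k + 1))%:R.
have h0 k : 0 < h k by rewrite divr_gt0// ltr0n expn_gt0.
pose df k x := f_ k.+1 x - f_ k x.
have mdf k : measurable_fun setT (df k) by exact: measurable_funB.
pose F k x := (h k)^-1 * df k x ^+ 2.
have mF k : measurable_fun setT (EFin \o F k).
  by apply/measurable_EFinP; apply: measurable_funM => //; exact: measurable_funX.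
have F0 k x : 0 <= F k x by rewrite mulr_ge0 ?sqr_ge0// invr_ge0 ltW.
have geo : (\sum_(0 <= k <oo) (h k)%:E < +oo)%E.
  have /cvg_lim := @cvg_geometric_eseries_half R 1 0.
  by move=> -> //; rewrite ltry.
have sumF : {ae m, forall x, (\sum_(0 <= k <oo) (F k x)%:E < +oo)%E}.
  have mS : measurable_fun setT (fun x => \sum_(0 <= k <oo) (F k x)%:E)%E.
    apply: (ge0_emeasurable_sum (h := fun k => EFin \o F k) (P := xpredT)) => [k x *|k _]; [by rewrite lee_fin|exact: mF].
  have S0 x : (0 <= \sum_(0 <= k <oo) (F k x)%:E)%E by apply: nneseries_ge0 => k _ _; rewrite lee_fin.
  have Si : m.-integrable setT (fun x => \sum_(0 <= k <oo) (F k x)%:E)%E.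
    apply/integrableP; split => //; under eq_integral do rewrite gee0_abs//.
    rewrite integral_nneseries//; last by move=> k x _; rewrite lee_fin.
    apply: le_lt_trans geo; apply: lee_nneseries.
      by move=> k *; apply: integral_ge0 => x _; rewrite lee_fin.
    move=> k _; under eq_integral do rewrite /F EFinM.
    rewrite ge0_integralZl_EFin//; last by rewrite invr_ge0 ltW.
    - have -> : (h k)%:E = ((h k)^-1%:E * ((h k) ^+ 2)%:E)%E.
        by rewrite -EFinM expr2 mulKf// gt_eqF.
      by rewrite lee_pmul2l// ?lte_fin ?invr_gt0//; exact: hf.
    - by move=> x _; rewrite lee_fin sqr_ge0.
    - by apply/measurable_EFinP; exact: measurable_funX.
  apply: filterS (integrable_ae measurableT Si) => x /(_ I).
  by rewrite ge0_fin_numE.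
exists (fun x => fine (limn_esup (fun k => (f_ k x)%:E))).
  apply: measurableT_comp => //; apply: measurable_fun_limn_esup => k.
  exact/measurable_EFinP.
apply: filterS sumF => x hx.
suff /cvg_ex[l hl] : cvgn (f_^~ x).
  have hl' : (f_ k x)%:E @[k --> \oo] --> l%:E by apply: cvg_EFin => //; near=> k.
  by rewrite (cvg_limn_einf_sup hl').2.
have c1 : cvgn (series h) by apply: nnseries_is_cvg => // k; exact: ltW.
have c2 : cvgn (series (F^~ x)) by exact: nnseries_is_cvg.
have c3 : cvgn [normed series (df^~ x)].
  apply: (@series_le_cvg _ _ (h \+ F^~ x)).
  - by move=> k /=; exact: normr_ge0.
  - by move=> k /=; rewrite addr_ge0// ltW.
  - move=> k /=; rewrite /F -[df k x ^+ 2]real_normK ?num_real//.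
    set t := `|df k x|; have t0 : 0 <= t by exact: normr_ge0.
    rewrite -(ler_pM2l (h0 k)) mulrDr mulVKf ?gt_eqF//.
    have := sqr_ge0 (h k - t); have := h0 k; nra.
  - by rewrite -/(series _); exact: is_cvg_seriesD.
have c4 := normed_cvg c3.
rewrite (_ : f_^~ x = fun k => f_ 0%N x + series (df^~ x) k).
  by apply: is_cvgD => //; exact: is_cvg_cst.
apply/funext => k; rewrite (eq_sum_telescope (f_^~ x) k); congr (_ + _).
Unshelve. all: by end_near.
Qed.
Lemma negligible_prodl d (T : measurableType d) (R : realType)
    (mu : {sigma_finite_measure set T -> \bar R}) (N : set T) :
  mu.-negligible N -> (mu \x mu)%E.-negligible (N `*` setT).
Proof.
move=> [M [mM M0 NM]]; exists (M `*` setT); split; first exact: measurableX.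
  have M0' : mu M = 0%E by exact: M0.
  transitivity (mu M * mu setT)%E; first exact: product_measure1E.
  by rewrite M0' mul0e.
by move=> [x y] [/= /NM].
Qed.

Lemma negligible_prodr d (T : measurableType d) (R : realType)
    (mu : {sigma_finite_measure set T -> \bar R}) (N : set T) :
  mu.-negligible N -> (mu \x mu)%E.-negligible (setT `*` N).
Proof.
move=> [M [mM M0 NM]]; exists (setT `*` M); split; first exact: measurableX.
  by rewrite /= product_measure1E// M0 mule0.
by move=> [x y] [/= _ /NM].
Qed.

Lemma ae_prod d (T : measurableType d) (R : realType)
    (mu : {sigma_finite_measure set T -> \bar R}) (P : T -> Prop) :
  {ae mu, forall x, P x} -> {ae (mu \x mu)%E, forall p, P p.1 /\ P p.2}.
Proof.
move=> aeP; have := negligibleU (negligible_prodl aeP) (negligible_prodr aeP).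
apply: negligibleS => -[x y] /= h; apply: contrapT => /not_orP[h1 h2]; apply: h; split.
  by apply: contrapT => nP; apply: h1.
by apply: contrapT => nP; apply: h2.
Qed.

Lemma ae_le_Rintegral d (T : measurableType d) (R : realType)
    (m : {measure set T -> \bar R}) (D : set T) (f g : T -> R) : measurable D ->
  m.-integrable D (EFin \o f) -> m.-integrable D (EFin \o g) ->
  {ae m, forall x, D x -> f x <= g x} ->
  \int[m]_(x in D) f x <= \int[m]_(x in D) g x.
Proof.
move=> mD fi gi fg; rewrite /Rintegral fine_le//; [exact: integrable_fin_num|exact: integrable_fin_num|].
have mf := measurable_int _ fi; have mg := measurable_int _ gi.
have mfg : measurable_fun D (fun x => mine (f x)%:E (g x)%:E).
  exact: measurable_mine.
rewrite (@ae_eq_integral _ _ _ m D (fun x => mine (f x)%:E (g x)%:E))//.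
  apply: le_integral => //; last by move=> x _; rewrite ge_min lexx orbT.
  apply: (le_integrable mD mfg _ (integrableD mD (integrable_abse fi) (integrable_abse gi))).
  move=> x _ /=; rewrite -EFin_min /= lee_fin [leRHS]ger0_norm ?addr_ge0//.
  by case: (leP (f x) (g x)) => _; rewrite ?lerDl ?lerDr.
by apply: filterS fg => x h Dx; apply/esym/min_idPl; rewrite lee_fin h.
Qed.

Section dirichlet.
Context d (T : measurableType d) (R : realType).
Variable mu : {sigma_finite_measure set T -> \bar R}.
Variable w : T * T -> R.
Hypothesis mw : measurable_fun setT w.
Hypothesis w_ge0 : forall p, 0 <= w p.
Variable Om : set T.
Hypothesis mOm : measurable Om.
Hypothesis muOm : (mu Om < +oo)%E.

Let mu2 : {measure set (T * T) -> \bar R} := (mu \x mu)%E.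

Definition incr (u : T -> R) (p : T * T) : R := u p.2 - u p.1.

Definition energy_space (u : T -> R) := [/\ wL2 mu (fun=> 1) u, wL2 mu2 w (incr u) &
  {ae mu, forall x, ~ Om x -> u x = 0}].

Definition energy u v : R := wip mu2 w (incr u) (incr v).

Let H := energy_space.
Let E := energy.
Let ip := wip mu (fun=> 1).
Let m1 : measurable_fun setT (fun _ : T => 1 : R). Proof. exact: measurable_cst. Qed.
Let p1 (x : T) : 0 <= 1 :> R. Proof. exact: ler01. Qed.

Lemma measurable_incr u : measurable_fun setT u -> measurable_fun setT (incr u).
Proof. by move=> mu_; apply: measurable_funB; exact: measurableT_comp. Qed.

Lemma incr_lin a u v : incr (fun x => a * u x + v x) = fun p => a * incr u p + incr v p.
Proof. by apply/funext => p; rewrite /incr; ring. Qed.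

Lemma energy_space_lin a u v : H u -> H v -> H (fun x => a * u x + v x).
Proof.
move=> [u1 u2 u3] [v1 v2 v3]; split.
- exact: wL2_lin.
- by rewrite incr_lin; exact: wL2_lin.
- by apply: filterS2 u3 v3 => x hu hv nx; rewrite hu// hv// mulr0 addr0.
Qed.

Lemma energy_space0 : H (fun=> 0).
Proof.
have z d' (S : measurableType d') (m : {measure set S -> \bar R}) (r : S -> R) : wL2 m r (fun=> 0).
  split; first exact: measurable_cst.
  by apply: eq_integrable (integrable0 m _) => // x _ /=; rewrite expr0n mul0r.
split; [exact: z| |exact: aeW].
by rewrite (_ : incr _ = fun=> 0)//; apply/funext => p; rewrite /incr subrr.
Qed.

Lemma energyC u v : E u v = E v u. Proof. exact: wipC. Qed.

Lemma energy_lin a u v z : H u -> H v -> H z ->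
  E (fun x => a * u x + v x) z = a * E u z + E v z.
Proof. by move=> [_ u2 _] [_ v2 _] [_ z2 _]; rewrite /E /energy incr_lin; exact: wip_lin. Qed.

Lemma energy_ge0 u : 0 <= E u u. Proof. exact: wip_ge0. Qed.

Lemma energy_space_contract (phi : R -> R) u : measurable_fun setT phi -> phi 0 = 0 ->
  (forall a b, `|phi a - phi b| <= `|a - b|) -> H u -> H (phi \o u).
Proof.
move=> mphi phi0 hphi [u1 u2 u3].
have mpu : measurable_fun setT (phi \o u) by apply: measurableT_comp => //; case: u1.
split.
- apply: wL2_le u1 _ _ => // x /=.
  by have := hphi (u x) 0; rewrite phi0 !subr0.
- apply: wL2_le u2 _ _ => //; first exact: measurable_incr.
  by move=> p; exact: hphi.
- by apply: filterS u3 => x h nx /=; rewrite h.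
Qed.

Lemma wL2_indic F : measurable F -> (mu F < +oo)%E -> wL2 mu (fun=> 1) (\1_F).
Proof.
move=> mF F_fin; split; first exact: measurable_indic.
apply: (@eq_integrable _ _ _ _ _ _ (EFin \o \1_F)) => //.
  by move=> x _ /=; rewrite mulr1 indicE; case: (x \in F); rewrite ?expr1n ?expr0n.
apply/integrableP; split; first exact/measurable_EFinP/measurable_indic.
under eq_integral do rewrite gee0_abs ?lee_fin//.
by rewrite integral_indic// setIT.
Qed.

Lemma ip_indic F v : measurable F -> ip (\1_F) v = \int[mu]_(x in F) v x.
Proof.
move=> mF; rewrite [RHS]Rintegral_mkcond; apply: eq_Rintegral => x _.
by rewrite mulr1 indicE patchE; case: ifP => _; rewrite ?mul1r ?mul0r.
Qed.

Lemma ip_indic_sqr F v : measurable F -> (mu F < +oo)%E -> wL2 mu (fun=> 1) v ->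
  (ip (\1_F) v) ^+ 2 <= ip v v * fine (mu F).
Proof.
move=> mF Ff Lv; have LF := wL2_indic mF Ff.
rewrite (_ : fine (mu F) = ip (\1_F) (\1_F)).
  apply: (@form_cauchy_schwarz _ _ (wL2 mu (fun=> 1))) => //.
  - by move=> *; exact: wL2_lin.
  - by move=> *; exact: wipC.
  - by move=> *; exact: wip_lin.
  - by move=> *; exact: wip_ge0.
rewrite ip_indic// /Rintegral; congr fine.
by rewrite integral_indic// setIid.
Qed.

Lemma ip0_ae v : wL2 mu (fun=> 1) v -> ip v v <= 0 -> {ae mu, forall x, v x = 0}.
Proof.
move=> Lv v0; have [mv vi] := Lv.
have : (\int[mu]_x `|(v x ^+ 2 * 1)%:E| = 0)%E.
  under eq_integral do rewrite gee0_abs ?lee_fin ?mulr1 ?sqr_ge0//.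
  have := wipE Lv; under eq_integral do rewrite mulr1.
  by move=> ->; congr (_%:E); apply/eqP; rewrite eq_le v0 wip_ge0.
move/(ae_eq_integral_abs mu measurableT (measurable_int _ vi)).
apply: filterS => x /(_ I) /= [] /eqP; rewrite mulr1 sqrf_eq0 => /eqP.
exact.
Qed.

Variables (cF alpha : R) (D : nat).
Hypothesis cF_gt0 : 0 < cF.
Hypothesis alpha_gt0 : 0 < alpha.
Hypothesis D_gt0 : (0 < D)%N.
Hypothesis FK : forall (s : R) A u, 0 < s -> measurable A -> A `<=` Om ->
  (mu A <= (s ^+ D)%:E)%E -> H u -> {ae mu, forall x, ~ A x -> u x = 0} ->
  ip u u <= cF * s `^ alpha * E u u.

Let s0 := fine (mu Om) + 1.
Let s0_gt0 : 0 < s0. Proof. by rewrite /s0 ltr_wpDl// fine_ge0. Qed.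

Let Om_s0 : (mu Om <= (s0 ^+ D)%:E)%E.
Proof.
have Of : mu Om \is a fin_num by rewrite ge0_fin_numE.
rewrite -(fineK Of) lee_fin; apply: (@le_trans _ _ s0); first by rewrite lerDl.
by rewrite ler_eXnr// lerDr fine_ge0.
Qed.

Let K0 := cF * s0 `^ alpha.
Let K0_gt0 : 0 < K0. Proof. by rewrite mulr_gt0// powR_gt0. Qed.

Lemma energy_coercive u : H u -> ip u u <= K0 * E u u.
Proof. by move=> Hu; apply: (FK s0_gt0 mOm) => //; case: Hu. Qed.

Lemma energy_complete (u_ : nat -> T -> R) : (forall n, H (u_ n)) ->
  (forall e : R, 0 < e -> exists N, forall m n, (N <= m)%N -> (N <= n)%N ->
     E (fun x => u_ m x - u_ n x) (fun x => u_ m x - u_ n x) <= e) ->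
  exists2 u, H u & forall e : R, 0 < e -> exists2 n, (e^-1 <= n%:R) &
     E (fun x => u x - u_ n x) (fun x => u x - u_ n x) <= e.
Proof.
move=> Hu Ecauchy.
have HB u v : H u -> H v -> H (fun x => u x - v x).
  move=> h1 h2; rewrite (_ : (fun x => _) = fun x => (-1) * v x + u x).
    exact: energy_space_lin.
  by apply/funext => x; rewrite mulN1r addrC.
pose h k : R := 1 / (2 ^ (k + 1))%:R.
have h0 k : 0 < h k by rewrite divr_gt0// ltr0n expn_gt0.
have hK k : 0 < h k ^+ 2 / K0 by rewrite divr_gt0// exprn_gt0.
have [N hN] := choice (fun k => Ecauchy _ (hK k)).
pose nn k := (\sum_(i < k.+1) N i + k)%N.
have nnN k i : (k <= i)%N -> (N k <= nn i)%N.
  move=> ki; rewrite /nn; apply: leq_trans (leq_addr _ _).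
  have ki' : (k < i.+1)%N by [].
  by rewrite (bigD1 (Ordinal ki'))//= leq_addr.
have nnk k : (k <= nn k)%N by exact: leq_addl.
have [f mf aef] : exists2 f : T -> R, measurable_fun setT f &
    {ae mu, forall x, u_ (nn k) x @[k --> \oo] --> f x}.
  apply: L2_fast_cauchy_ae => [k|k]; first by case: (Hu (nn k)) => -[].
  have Hd := HB _ _ (Hu (nn k.+1)) (Hu (nn k)).
  have [Ld _ _] := Hd; have := wipE Ld; under eq_integral do rewrite mulr1.
  move=> ->; rewrite lee_fin; apply: le_trans (energy_coercive Hd) _.
  rewrite mulrC -ler_pdivlMr//; apply: hN; exact: nnN.
have lim n (e : R) M : (forall m, (M <= m)%N -> E (fun x => u_ m x - u_ n x) (fun x => u_ m x - u_ n x) <= e) ->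
    wL2 mu (fun=> 1) (fun x => f x - u_ n x) /\
    (wL2 mu2 w (incr (fun x => f x - u_ n x)) /\ E (fun x => f x - u_ n x) (fun x => f x - u_ n x) <= e).
  move=> hM.
  have Hd k := HB _ _ (Hu (nn k)) (Hu n).
  have mun : measurable_fun setT (u_ n) by case: (Hu n) => -[].
  have mfn : measurable_fun setT (fun x => f x - u_ n x) by exact: measurable_funB.
  split.
    apply: (@proj1 _ (ip (fun x => f x - u_ n x) (fun x => f x - u_ n x) <= K0 * e)).
    apply: (@wip_fatou _ _ _ mu (fun=> 1) m1 p1 (fun k x => u_ (nn k) x - u_ n x)) => //.
    - by move=> k; case: (Hd k).
    - by apply: filterS aef => x hx; apply: cvgB => //; exact: cvg_cst.
    - exists M => k Mk; apply: le_trans (energy_coercive (Hd k)) _.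
      by rewrite ler_pM2l//; apply: hM; exact: leq_trans Mk (nnk k).
  apply: (@wip_fatou _ _ _ mu2 w mw w_ge0 (fun k => incr (fun x => u_ (nn k) x - u_ n x))) => //.
  - by move=> k; case: (Hd k).
  - exact: measurable_incr.
  - apply: filterS (ae_prod aef) => p [hp1 hp2]; rewrite /incr.
    by apply: cvgB; apply: cvgB => //; exact: cvg_cst.
  - by exists M => k Mk; apply: hM; exact: leq_trans Mk (nnk k).
have f0 : {ae mu, forall x, ~ Om x -> f x = 0}.
  have u0 : {ae mu, forall x n, ~ Om x -> u_ n x = 0}.
    by apply: ae_foralln => n; case: (Hu n).
  apply: filterS2 aef u0 => x fx ux nx.
  have c0 : u_ (nn k) x @[k --> \oo] --> (0 : R).
    by rewrite (_ : (fun k => _) = fun=> 0); [exact: cvg_cst|apply/funext => k; exact: ux].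
  exact: (cvg_unique _ fx c0).
have Hf : H f.
  have [M hM] := Ecauchy 1 ltr01.
  have [L1 [L2 _]] := lim M 1 M (fun m Mm => hM m M Mm (leqnn _)).
  have [U1 U2 U3] := Hu M.
  have fE : f = fun x => 1 * (f x - u_ M x) + u_ M x by apply/funext => x; rewrite mul1r subrK.
  rewrite fE; apply: energy_space_lin => //; split => //.
  by apply: filterS2 f0 U3 => x a b nx; rewrite a// b// subr0.
exists f => // e e0; have [M hM] := Ecauchy e e0.
exists (M + (Num.truncn e^-1).+1)%N.
  by apply: le_trans (ltW (truncnS_gt _)) _; rewrite ler_nat leq_addl.
have [_ [_]] := lim (M + (Num.truncn e^-1).+1)%N e M (fun m Mm => hM m _ Mm (leq_addr _ _)).
exact.
Qed.

Lemma potential_exists F : measurable F -> F `<=` Om ->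
  exists2 u, H u & forall v, H v -> E u v = ip (\1_F) v.
Proof.
move=> mF FOm.
have Ff : (mu F < +oo)%E by apply: le_lt_trans muOm; rewrite le_measure ?inE.
apply: (@riesz_representation _ _ H E (ip (\1_F)) _ _ _ _ _ _ (fine (mu F) * K0)).
- exact: energy_space0.
- exact: energy_space_lin.
- exact: energyC.
- exact: energy_lin.
- exact: energy_ge0.
- move=> a u v [Lu _ _] [Lv _ _]; rewrite /ip ![wip _ _ (\1_F) _]wipC wip_lin//.
  exact: wL2_indic.
- by rewrite mulr_ge0 ?fine_ge0// ltW.
- move=> u Hu; have [Lu _ _] := Hu.
  apply: le_trans (ip_indic_sqr mF Ff Lu) _.
  by rewrite mulrC -mulrA ler_wpM2l ?fine_ge0// energy_coercive.
- exact: energy_complete.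
Qed.

Definition monotone_contraction (phi : R -> R) := [/\ measurable_fun setT phi, phi 0 = 0 &
  forall a b, a <= b -> phi a <= phi b /\ phi b - phi a <= b - a].

Lemma energy_space_mc phi u : monotone_contraction phi -> H u -> H (phi \o u).
Proof.
move=> [mphi phi0 hphi]; apply: energy_space_contract => // a b.
have [ab|/ltW ba] := leP a b.
  by have [h1 h2] := hphi _ _ ab; rewrite ler0_norm ?ler0_norm ?subr_le0// !opprB.
by have [h1 h2] := hphi _ _ ba; rewrite ger0_norm ?ger0_norm ?subr_ge0.
Qed.

Lemma energy_mc_le phi u : monotone_contraction phi -> H u ->
  E (phi \o u) (phi \o u) <= E u (phi \o u).
Proof.
move=> mc Hu; have [_ _ hphi] := mc.
have [_ Lu _] := Hu; have [_ Lp _] := energy_space_mc mc Hu.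
apply: le_Rintegral => //; [exact: wL2M|exact: wL2M|].
move=> p _; rewrite ler_wpM2r// /incr /=.
have [ab|/ltW ba] := leP (u p.1) (u p.2).
  by have [h1 h2] := hphi _ _ ab; nra.
by have [h1 h2] := hphi _ _ ba; nra.
Qed.

Lemma mc_min0 : monotone_contraction (fun a => Num.min a 0).
Proof.
split; [exact: measurable_minr|by rewrite minxx|move=> a b ab].
by case: (leP a 0); case: (leP b 0) => *; split; lra.
Qed.

Lemma mc_excess (h : R) : 0 <= h -> monotone_contraction (fun a => Num.max (a - h) 0).
Proof.
move=> h0; split.
- apply: measurable_maxr => //; exact: measurable_funB.
- by rewrite sub0r; apply/max_idPr; rewrite oppr_le0.
- move=> a b ab; case: (leP (a - h) 0); case: (leP (b - h) 0) => *; split; lra.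
Qed.

Lemma energy_space_integrable v F : H v -> measurable F -> F `<=` Om ->
  mu.-integrable F (EFin \o v).
Proof.
move=> [Lv _ _] mF FOm; have [mv _] := Lv.
have Ff : (mu F < +oo)%E by apply: le_lt_trans muOm; rewrite le_measure ?inE.
have := wL2M m1 p1 (wL2_indic mF Ff) Lv.
move=> h; apply/(integrable_mkcond _ mF); apply: eq_integrable h => // x _ /=.
by rewrite mulr1 indicE patchE; case: ifP => _; rewrite ?mul1r ?mul0r.
Qed.

Definition potential F u := H u /\ forall v, H v -> E u v = ip (\1_F) v.

Lemma potential_ge0 F u : measurable F -> F `<=` Om -> potential F u -> {ae mu, forall x, 0 <= u x}.
Proof.
move=> mF FOm [Hu hu]; set v := (fun a => Num.min a 0) \o u.
have Hv : H v := energy_space_mc mc_min0 Hu.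
have v0 : ip (\1_F) v <= 0.
  have Ff : (mu F < +oo)%E by apply: le_lt_trans muOm; rewrite le_measure ?inE.
  rewrite ip_indic// -(mul0r (fine (mu F))) -Rintegral_cst//.
  apply: le_Rintegral => //; first exact: energy_space_integrable.
    by apply: measurable_bounded_integrable => //; exact: bounded_cst.
  by move=> x _; rewrite /v /= ge_min lexx orbT.
have Ev : E v v <= 0 by apply: le_trans (energy_mc_le mc_min0 Hu) _; rewrite hu.
have := ip0_ae (let: And3 L _ _ := Hv in L).
have ip0 : ip v v <= 0 by apply: le_trans (energy_coercive Hv) _; rewrite pmulr_rle0.
move=> /(_ ip0); apply: filterS => x; rewrite /v /=.
by case: (leP (u x) 0) => [_ ->//|/ltW].
Qed.

Let Aset u (h : R) := Om `&` [set x | h < u x].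

Let mAset u h : measurable_fun setT u -> measurable (Aset u h).
Proof.
move=> mu_; apply: measurableI => //; rewrite -[X in measurable X]setTI.
by apply: (measurable_fun_ltr (measurable_cst _) mu_ measurableT (Y := [set true])).
Qed.

Let muAset u h : measurable_fun setT u -> (mu (Aset u h) < +oo)%E.
Proof.
move=> mu_; apply: le_lt_trans muOm; rewrite le_measure ?inE//; first exact: mAset.
exact: subIsetl.
Qed.

Lemma excess_mass F u (h s : R) : measurable F -> F `<=` Om -> potential F u -> 0 <= h -> 0 < s ->
  (mu (Aset u h) <= (s ^+ D)%:E)%E ->
  \int[mu]_(x in Aset u h) (u x - h) <= cF * s `^ alpha * fine (mu (Aset u h)).
Proof.
move=> mF FOm [Hu hu] h0 s_gt0 hA.
have mu_ : measurable_fun setT u by case: Hu => -[].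
have mA := mAset h mu_; have Afin := muAset h mu_.
set v := (fun a => Num.max (a - h) 0) \o u.
have Hv : H v := energy_space_mc (mc_excess h0) Hu.
have [Lv _ _] := Hv.
have v0 x : 0 <= v x by rewrite /v /= le_max lexx orbT.
have vA : {ae mu, forall x, ~ Aset u h x -> v x = 0}.
  case: Hu => _ _; apply: filterS => x ux nA; rewrite /v /=; apply/max_idPr.
  have [Ox|Ox] := pselect (Om x); last by rewrite ux// sub0r oppr_le0.
  by rewrite subr_le0 leNgt; apply/negP => hx; apply: nA.
have IE : \int[mu]_(x in Aset u h) (u x - h) = ip (\1_(Aset u h)) v.
  rewrite ip_indic//; apply: eq_Rintegral => x; rewrite inE => -[_ /= hx].
  by rewrite /v /=; apply/esym/max_idPl; rewrite subr_ge0 ltW.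
have FI : ip (\1_F) v <= ip (\1_(Aset u h)) v.
  have LA := wL2_indic mA Afin.
  have Ff : (mu F < +oo)%E by apply: le_lt_trans muOm; rewrite le_measure ?inE.
  have i1 := wL2M m1 p1 (wL2_indic mF Ff) Lv; have i2 := wL2M m1 p1 LA Lv.
  apply: ae_le_Rintegral => //.
  apply: filterS vA => x hx _; rewrite ler_wpM2r//.
  have [Ax|nA] := pselect (Aset u h x); last by rewrite hx// !mulr0.
  by rewrite ler_wpM2r// [leRHS]indicE mem_set//= indicE ler_nat leq_b1.
have ipv := FK s_gt0 mA (@subIsetl _ _ _) hA Hv vA.
have Evv : E v v <= ip (\1_(Aset u h)) v.
  by apply: le_trans (energy_mc_le (mc_excess h0) Hu) _; rewrite hu.
have CS := ip_indic_sqr mA Afin Lv.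
rewrite IE; set I := ip (\1_(Aset u h)) v in Evv CS *.
have I0 : 0 <= I by rewrite /I ip_indic//; apply: Rintegral_ge0.
have [->|In0] := eqVneq I 0; first by rewrite !mulr_ge0 ?fine_ge0 ?powR_ge0// ltW.
have Ip : 0 < I by rewrite lt_neqAle eq_sym In0.
rewrite -(ler_pM2r Ip) -expr2; apply: le_trans CS _.
rewrite mulrC [leRHS]mulrAC [leRHS]mulrC ler_wpM2l ?fine_ge0//.
apply: le_trans ipv _; rewrite ler_wpM2l// mulr_ge0// ?powR_ge0// ltW//.
Qed.

Lemma level_markov F u (h k : R) : measurable F -> F `<=` Om -> potential F u -> 0 <= h -> 0 < k ->
  k * fine (mu (Aset u (h + k))) <= \int[mu]_(x in Aset u h) (u x - h).
Proof.
move=> mF FOm [Hu hu] h0 k0.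
have mu_ : measurable_fun setT u by case: Hu => -[].
have mA := mAset h mu_; have Afin := muAset h mu_.
have mAk := mAset (h + k) mu_; have Akfin := muAset (h + k) mu_.
have ui : mu.-integrable (Aset u h) (EFin \o (fun x => u x - h)).
  have c1 : mu.-integrable (Aset u h) (EFin \o (cst h)).
    by apply: measurable_bounded_integrable => //; exact: bounded_cst.
  have := integrableB mA (energy_space_integrable Hu mA (@subIsetl _ _ _)) c1.
  by apply: eq_integrable => // x _ /=; rewrite EFinB.
rewrite -Rintegral_cst//.
rewrite /Rintegral fine_le//.
- rewrite ge0_fin_numE; last by apply: integral_ge0 => x _; rewrite lee_fin ltW.
  by rewrite integral_cst// lte_mul_pinfty ?lee_fin ?ltW.
- exact: integrable_fin_num ui.
have sub : Aset u (h + k) `<=` Aset u h.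
  by move=> x [Ox /= hx]; split => //=; apply: lt_trans hx; rewrite ltrDl.
apply: (@le_trans _ _ (\int[mu]_(x in Aset u (h + k)) (u x - h)%:E)%E).
  apply: ge0_le_integral => //.
  - by move=> x _; rewrite lee_fin ltW.
  - by apply/measurable_EFinP/measurable_funTS; exact: measurable_funB.
  - by move=> x [_ /= hx]; rewrite lee_fin lerBrDl ltW.
apply: ge0_subset_integral => //.
- exact: measurable_int ui.
- by move=> x [_ /= hx]; rewrite lee_fin subr_ge0 ltW.
Qed.

Let C1 := 2 ^+ D * cF / (1 - 2 `^ (- alpha)).

Let q_lt1 : 2 `^ (- alpha) < 1 :> R.
Proof.
have h : 1 `^ alpha < 2 `^ alpha :> R.
  by apply: gt0_ltr_powR; rewrite ?nnegrE ?ler01 ?ltr1n.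
by rewrite powRN invf_lt1 ?powR_gt0//; move: h; rewrite powR1.
Qed.

Let C1_gt0 : 0 < C1.
Proof. by rewrite divr_gt0 ?subr_gt0// mulr_gt0// exprn_gt0. Qed.

(* Iteration: by [excess_mass] and [level_markov], raising the level by a multiple of
   [s `^ alpha] halves [s]; the increments form a convergent geometric series. *)
Lemma stampacchia F u (h s : R) : measurable F -> F `<=` Om -> potential F u -> 0 <= h -> 0 < s ->
  (mu (Aset u h) <= (s ^+ D)%:E)%E ->
  {ae mu, forall x, u x <= h + C1 * s `^ alpha}.
Proof.
move=> mF FOm pot h0 s_gt0 hA; have [Hu hu] := pot.
have mu_ : measurable_fun setT u by case: Hu => -[].
pose q : R := 2 `^ (- alpha).
have q0 : 0 <= q by exact: powR_ge0.
pose hj j := h + 2 ^+ D * cF * s `^ alpha * \sum_(i < j) q ^+ i.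
pose sj j := s * (2 ^+ j)^-1.
have sj0 j : 0 < sj j by rewrite mulr_gt0// invr_gt0 exprn_gt0.
have sjE j : sj j `^ alpha = s `^ alpha * q ^+ j.
  rewrite /sj -powR_invn// powRM ?powR_ge0 ?(ltW s_gt0)//; congr (_ * _).
  by rewrite -powRrM -[RHS]powR_mulrn// /q -powRrM; congr (_ `^ _); ring.
have d0 j : 0 < 2 ^+ D * cF * sj j `^ alpha by rewrite !mulr_gt0 ?exprn_gt0 ?powR_gt0.
have hj0 j : 0 <= hj j.
  rewrite addr_ge0// mulr_ge0//; first by rewrite !mulr_ge0 ?exprn_ge0 ?powR_ge0// ltW.
  by apply: sumr_ge0 => i _; exact: exprn_ge0.
have step j : (mu (Aset u (hj j)) <= ((sj j) ^+ D)%:E)%E.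
  elim: j => [|j IH]; first by rewrite /hj /sj big_ord0 mulr0 addr0 expr0 invr1 mulr1.
  have hE : hj j.+1 = hj j + 2 ^+ D * cF * sj j `^ alpha.
    by rewrite /hj big_ord_recr /= sjE; ring.
  have Ak : mu (Aset u (hj j)) \is a fin_num by rewrite ge0_fin_numE// muAset.
  have Ak1 : mu (Aset u (hj j.+1)) \is a fin_num by rewrite ge0_fin_numE// muAset.
  rewrite -(fineK Ak1) lee_fin hE.
  have L1 := level_markov mF FOm pot (hj0 j) (d0 j).
  have L2 := excess_mass mF FOm pot (hj0 j) (sj0 j) IH.
  have L3 : fine (mu (Aset u (hj j))) <= sj j ^+ D by rewrite -lee_fin (fineK Ak).
  have := le_trans L1 L2; set m' := fine (mu (Aset u (hj j + _))).
  have -> : 2 ^+ D * cF * sj j `^ alpha * m' = cF * sj j `^ alpha * (2 ^+ D * m') by ring.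
  rewrite ler_pM2l ?mulr_gt0 ?powR_gt0// => L4.
  have -> : sj j.+1 = sj j / 2 by rewrite /sj exprS invfM; ring.
  rewrite expr_div_n ler_pdivlMr ?exprn_gt0// mulrC.
  exact: le_trans L4 L3.
pose hoo := h + C1 * s `^ alpha.
have hjoo j : hj j <= hoo.
  rewrite lerD2l (_ : C1 * _ = 2 ^+ D * cF * s `^ alpha * (1 - q)^-1); last first.
    by rewrite /C1 -/q; ring.
  apply: ler_wpM2l; first by rewrite !mulr_ge0 ?exprn_ge0 ?powR_ge0// ltW.
  have q1 : 0 < 1 - q by rewrite subr_gt0.
  rewrite -(ler_pM2l q1) divff ?gt_eqF//.
  have -> : (1 - q) * (\sum_(i < j) q ^+ i) = 1 - q ^+ j by rewrite -opprB mulNr -subrX1 opprB.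
  by rewrite lerBlDr lerDl exprn_ge0.
have sub j : Aset u hoo `<=` Aset u (hj j).
  by move=> x [Ox /= hx]; split => //=; exact: le_lt_trans (hjoo j) hx.
have z : mu (Aset u hoo) = 0%E.
  apply/eqP; rewrite eq_le measure_ge0 andbT; apply/lee_addgt0Pr => e e0; rewrite add0e.
  pose j := (Num.truncn (s ^+ D / e)).+1.
  apply: (@le_trans _ _ (mu (Aset u (hj j)))).
    by rewrite le_measure ?inE//; exact: mAset.
  apply: le_trans (step j) _; rewrite lee_fin.
  have sjs : sj j <= s.
    by rewrite ler_piMr ?(ltW s_gt0)// invf_le1 ?exprn_gt0// exprn_ege1// ler1n.
  apply: (@le_trans _ _ (s ^+ D * (2 ^+ j)^-1)).
    have e1 (t : R) : t ^+ D = t * t ^+ D.-1 by rewrite -exprS prednK.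
    rewrite (e1 (sj j)) (e1 s) [leRHS]mulrAC -/(sj j).
    by rewrite ler_wpM2l ?(ltW (sj0 j))// lerXn2r ?nnegrE// ltW.
  rewrite ler_pdivrMr ?exprn_gt0// mulrC -ler_pdivrMr//.
  apply: le_trans (ltW (truncnS_gt _)) _.
  by rewrite -natrX ler_nat -/j ltnW// ltn_expl.
have [_ _ u0] := Hu.
have An : mu.-negligible (Aset u hoo) by exists (Aset u hoo); split => //; exact: mAset.
have : {ae mu, forall x, ~ Aset u hoo x}.
  by apply: negligibleS An => x /= /contrapT.
move=> nA; apply: filterS2 nA u0 => x nA ux.
have [Ox|Ox] := pselect (Om x); first by rewrite leNgt; apply/negP => hx; apply: nA.
by rewrite ux// addr_ge0// mulr_ge0 ?powR_ge0// ltW.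
Qed.

Theorem potential_theory : exists U : set T -> T -> R, exists K : R,
  [/\ forall F, measurable F -> F `<=` Om ->
        [/\ energy_space (U F),
            forall v, energy_space v -> energy (U F) v = \int[mu]_(x in F) v x,
            {ae mu, forall x, 0 <= U F x} & {ae mu, forall x, U F x <= K}] &
      forall e : R, 0 < e -> exists2 del : R, 0 < del &
        forall F, measurable F -> F `<=` Om -> (mu F <= del%:E)%E ->
        {ae mu, forall x, U F x <= e}].
Proof.
have ex F : exists u, measurable F /\ F `<=` Om -> potential F u.
  have [[mF FOm]|h] := pselect (measurable F /\ F `<=` Om); last by exists (fun=> 0).
  by have [u Hu hu] := potential_exists mF FOm; exists u.
have [U hU] := choice ex.
have pot F : measurable F -> F `<=` Om -> potential F (U F).
  by move=> mF FOm; exact: hU.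
pose K := 0 + C1 * s0 `^ alpha.
have K_gt0 : 0 < K by rewrite /K add0r mulr_gt0// powR_gt0.
have UK F : measurable F -> F `<=` Om -> {ae mu, forall x, U F x <= K}.
  move=> mF FOm; apply: (stampacchia mF FOm (pot F mF FOm)) => //.
  apply: le_trans Om_s0; rewrite le_measure ?inE//; last exact: subIsetl.
  by apply: mAset; case: (pot F mF FOm) => -[[]].
exists U, K; split => [F mF FOm|e e0].
  have [HU hUF] := pot F mF FOm; split => //.
  - by move=> v Hv; rewrite -ip_indic//; exact: hUF.
  - exact: (potential_ge0 mF FOm (pot F mF FOm)).
  - exact: UK.
pose s := (e / 2 / C1) `^ (alpha^-1).
have s_gt0 : 0 < s by rewrite powR_gt0// divr_gt0// divr_gt0.
have sE : C1 * s `^ alpha = e / 2.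
  rewrite /s -powRrM mulVf ?gt_eqF// powRr1; last by rewrite ltW// divr_gt0// divr_gt0.
  by rewrite mulrC divfK// gt_eqF.
pose del := s ^+ D * (e / 2) / K.
exists del; first by rewrite divr_gt0// mulr_gt0 ?exprn_gt0// divr_gt0.
move=> F mF FOm Fdel.
have potF := pot F mF FOm; have [HU hUF] := potF.
have mUF : measurable_fun setT (U F) by case: HU => -[].
have e20 : 0 < e / 2 by rewrite divr_gt0.
have -> : e = e / 2 + C1 * s `^ alpha by rewrite sE -splitr.
apply: (stampacchia mF FOm potF) => //; first exact: ltW.
have Afin : mu (Aset (U F) (e / 2)) \is a fin_num by rewrite ge0_fin_numE// muAset.
have Ffin : mu F \is a fin_num.
  by rewrite ge0_fin_numE//; apply: le_lt_trans muOm; rewrite le_measure ?inE.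
rewrite -(fineK Afin) lee_fin.
have L1 := level_markov mF FOm potF (lexx 0) e20; rewrite add0r in L1.
have L2 : \int[mu]_(x in Aset (U F) 0) (U F x - 0) <= \int[mu]_(x in Om) U F x.
  under eq_Rintegral do rewrite subr0.
  have mA := mAset 0 mUF; have Afn := muAset 0 mUF; have LU : wL2 mu (fun=> 1) (U F) by case: HU.
  rewrite -!ip_indic//; apply: ae_le_Rintegral => //.
  - exact: (wL2M m1 p1 (wL2_indic mA Afn) LU).
  - exact: (wL2M m1 p1 (wL2_indic mOm muOm) LU).
  apply: filterS (potential_ge0 mF FOm potF) => x ux _; rewrite ler_wpM2r// ler_wpM2r//.
  have [Ax|nA] := pselect (Aset (U F) 0 x); last by rewrite indicE memNset.
  by rewrite !indicE !mem_set//; case: Ax.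
have L3 : \int[mu]_(x in Om) U F x = \int[mu]_(x in F) U Om x.
  have [HO hO] := pot Om mOm (@subset_refl _ _).
  by rewrite -ip_indic// -hO// energyC hUF// ip_indic.
have L4 : \int[mu]_(x in F) U Om x <= K * fine (mu F).
  have [HO _] := pot Om mOm (@subset_refl _ _).
  rewrite -Rintegral_cst//; apply: ae_le_Rintegral => //.
  - exact: energy_space_integrable.
  - apply: measurable_bounded_integrable => //; last exact: bounded_cst.
    by rewrite -ge0_fin_numE.
  - by apply: filterS (UK Om mOm (@subset_refl _ _)).
rewrite -(ler_pM2l e20); apply: le_trans L1 _; apply: le_trans L2 _; rewrite L3.
apply: le_trans L4 _; rewrite mulrC -ler_pdivlMr// [e / 2 * _]mulrC -/del.
by rewrite -lee_fin (fineK Ffin).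
Qed.

End dirichlet.

(** * Lebesgue measure on tuples *)

Section integral_ae_insensitive.
Context d (T : measurableType d) (R : realType) (m : {measure set T -> \bar R}).
Import HBNNSimple.

Let ge0_le_integral_ae (f g : T -> \bar R) : (forall x, 0 <= f x)%E -> (forall x, 0 <= g x)%E ->
  {ae m, forall x, f x = g x} -> (\int[m]_x f x <= \int[m]_x g x)%E.
Proof.
move=> f0 g0 [N [mN N0 hN]]; rewrite !ge0_integralTE//.
apply: ub_ereal_sup => _ [h /= hf <-].
have mNC : measurable (~` N) by exact: measurableC.
pose h' : {nnsfun T >-> R} := mul_nnsfun h (indic_nnsfun R mNC).
have -> : sintegral m h = sintegral m h'.
  rewrite -!integralT_nnsfun; apply: ae_eq_integral => //; try exact/measurable_EFinP.
  exists N; split => // x /= hx; apply: contrapT => nN; apply: hx => _.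
  by rewrite /h' /= mindicE mem_set// mulr1.
apply: ereal_sup_ubound; exists h' => //= x.
have [Nx|Nx] := pselect (N x).
  by rewrite mindicE memNset ?mulr0//; exact.
rewrite mindicE mem_set// mulr1; apply: le_trans (hf x) _.
by have -> : f x = g x by apply: contrapT => fg; apply: Nx; apply: hN.
Qed.

(* Unlike [ae_eq_integral], no measurability is required. *)
Lemma integral_ae_eqW (f g : T -> \bar R) : {ae m, forall x, f x = g x} ->
  (\int[m]_x f x = \int[m]_x g x)%E.
Proof.
have key h k : (forall x, 0 <= h x)%E -> (forall x, 0 <= k x)%E ->
    {ae m, forall x, h x = k x} -> (\int[m]_x h x = \int[m]_x k x)%E.
  move=> h0 k0 hk; apply/eqP; rewrite eq_le !ge0_le_integral_ae//.
  by apply: filterS hk => x ->.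
move=> fg; rewrite [LHS]integralE [RHS]integralE; congr (_ - _)%E; apply: key => //.
  by apply: filterS fg => x; rewrite !funeposE => ->.
by apply: filterS fg => x; rewrite !funenegE => ->.
Qed.

End integral_ae_insensitive.

Section transport.
Context d1 d2 (X : measurableType d1) (Y : measurableType d2) (R : realType).
Variables (m : {measure set X -> \bar R}) (phi : X -> Y) (psi : Y -> X).
Hypothesis m_sf : sigma_finite setT m.
Hypothesis mphi : measurable_fun setT phi.
Hypothesis mpsi : measurable_fun setT psi.
Hypothesis phiK : cancel phi psi.

Let tr (A : set Y) : \bar R := m (phi @^-1` A).

Let mpre A : measurable A -> measurable (phi @^-1` A).
Proof. by move=> mA; rewrite -[X in measurable X]setTI; exact: mphi. Qed.

Let tr0 : tr set0 = 0%E. Proof. by rewrite /tr preimage_set0 measure0. Qed.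

Let tr_ge0 A : (0 <= tr A)%E. Proof. exact: measure_ge0. Qed.

Let tr_sigma : semi_sigma_additive tr.
Proof.
move=> F mF tF mUF; rewrite /tr preimage_bigcup.
apply: measure_semi_sigma_additive.
- by move=> n; exact: mpre.
- apply/trivIsetP => /= i j _ _ ij; rewrite -preimage_setI.
  by move/trivIsetP : tF => /(_ i j I I ij) ->; rewrite preimage_set0.
- by rewrite -preimage_bigcup; exact: mpre.
Qed.

HB.instance Definition _ := isMeasure.Build _ _ _ tr tr0 tr_ge0 tr_sigma.

Let tr_sf : sigma_finite setT tr.
Proof.
have [F TF hF] := m_sf.
exists (fun k => psi @^-1` F k).
  apply/seteqP; split => // y _; have : setT (psi y) by [].
  by rewrite TF => -[k _ Fk]; exists k.
move=> k; have [mF Fk] := hF k; split.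
  by rewrite -[X in measurable X]setTI; exact: mpsi.
rewrite /tr (_ : phi @^-1` _ = F k)//; apply/seteqP; split => x /=; rewrite /preimage /= phiK//.
Qed.

HB.instance Definition _ := @Measure_isSigmaFinite.Build _ _ _ tr tr_sf.

Lemma transport_measure : exists m' : {sigma_finite_measure set Y -> \bar R},
  [/\ forall A, m' A = m (phi @^-1` A),
      forall f, measurable_fun setT f -> (forall y, 0 <= f y)%E ->
        (\int[m']_y f y = \int[m]_x f (phi x))%E &
      forall f, m'.-integrable setT f -> m.-integrable setT (f \o phi) /\
        (\int[m']_y f y = \int[m]_x f (phi x))%E].
Proof.
have ge0 f : measurable_fun setT f -> (forall y, 0 <= f y)%E ->
    (\int[tr]_y f y = \int[m]_x f (phi x))%E.
  move=> mf f0; have := ge0_integral_pushforward mphi m measurableT mf (fun y _ => f0 y).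
  by rewrite preimage_setT => <-; apply: eq_measure_integral.
exists tr; split => // f fi.
have mf := measurable_int _ fi.
have fp : m.-integrable setT (f \o phi).
  apply/integrableP; split; first exact: measurableT_comp.
  move/integrableP : (fi) => [_]; rewrite ge0//; exact: measurableT_comp.
split => //.
have fp' : m.-integrable (phi @^-1` setT) (f \o phi) by rewrite preimage_setT.
have := integral_pushforward mphi mf fp' measurableT.
by rewrite preimage_setT => <-; apply: eq_measure_integral.
Qed.

End transport.

Lemma prod_sigma_finite d1 d2 (T1 : measurableType d1) (T2 : measurableType d2) (R : realType)
    (m1 : {sigma_finite_measure set T1 -> \bar R}) (m2 : {sigma_finite_measure set T2 -> \bar R}) :
  sigma_finite setT (m1 \x m2)%E.
Proof.
have [F TF hF] := sigma_finiteT m1; have [G TG hG] := sigma_finiteT m2.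
exists (fun i => if unpickle i is Some (n, k) then F n `*` G k else set0).
  apply/seteqP; split => // -[x y] _.
  have [n _ Fx] : (\bigcup_i F i) x by rewrite -TF.
  have [k _ Gy] : (\bigcup_i G i) y by rewrite -TG.
  by exists (pickle (n, k)) => //; rewrite pickleK; split.
move=> i; case: (unpickle i) => [[n k]|]; last by rewrite measure0.
have [mF Fn] := hF n; have [mG Gk] := hG k; split; first exact: measurableX.
by rewrite product_measure1E// lte_mul_pinfty// ge0_fin_numE.
Qed.

Section lebesgue_tuple.
Variable R : realType.

Let leb : {sigma_finite_measure set (measurableTypeR R) -> \bar R} := @lebesgue_measure R.

Definition consT n (p : measurableTypeR R * n.-tuple R) : n.+1.-tuple R :=
  [the n.+1.-tuple R of p.1 :: p.2].

Definition unconsT n (x : n.+1.-tuple R) : measurableTypeR R * n.-tuple R :=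
  (thead x, [tuple of behead x]).

Lemma measurable_consT n : measurable_fun setT (@consT n).
Proof. exact: measurable_cons. Qed.

Lemma measurable_unconsT n : measurable_fun setT (@unconsT n).
Proof.
apply: measurable_fun_pair; first exact: measurable_tnth.
exact: measurable_behead.
Qed.

Lemma consTK n : cancel (@consT n) (@unconsT n).
Proof.
move=> [t x]; rewrite /unconsT /consT /thead tnth0; congr (_, _); exact: val_inj.
Qed.

Definition lint_measure n (m : {sigma_finite_measure set (n.-tuple R) -> \bar R}) :=
  (forall f, measurable_fun setT f -> (forall x, 0 <= f x)%E -> lint f = (\int[m]_x f x)%E) /\
  (forall f g, m.-integrable setT g -> {ae m, forall x, f x = g x} ->
    lint f = (\int[m]_x g x)%E).

Lemma lint_measure0 : exists m, @lint_measure 0 m.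
Proof.
pose a := [tuple] : 0.-tuple R.
exists (dirac a : {sigma_finite_measure set (0.-tuple R) -> \bar R}); split.
  by move=> f mf f0; rewrite integral_dirac//= diracT mul1e.
move=> f g gi [N [mN N0 hN]]; rewrite integral_dirac//=; last exact: measurable_int gi.
rewrite diracT mul1e /=.
have : ~ N a by move=> Na; move: N0; rewrite /= diracE mem_set//= => /eqP; rewrite onee_eq0.
by move=> Na; apply: contrapT => fg; apply: Na; apply: hN.
Qed.

Lemma lint_measureS n m : @lint_measure n m -> exists m', @lint_measure n.+1 m'.
Proof.
move=> [m_ge0 m_int].
pose P : {measure set (measurableTypeR R * n.-tuple R)%type -> \bar R} := (leb \x m)%E.
have [m' [hm' ge0P intP]] := transport_measure (prod_sigma_finite leb m : sigma_finite setT P)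
  (@measurable_consT n) (@measurable_unconsT n) (@consTK n).
exists m'; split.
  move=> f mf f0; rewrite ge0P// /P fubini_tonelli1//=; last first.
    by apply: (measurableT_comp mf); exact: measurable_consT.
  apply: eq_integral => t _; rewrite m_ge0//.
  apply: (measurableT_comp mf).
  exact: (measurable_cons (measurable_cst _) (@measurable_id _ _ _)).
move=> f g gi [N [mN N0 hN]].
have mg := measurable_int _ gi.
have [gP intE] := intP g gi.
rewrite intE -(@integral12_prod_meas1 _ _ _ _ _ leb m (g \o @consT n))//.
apply: integral_ae_eqW.
have NP : P (@consT n @^-1` N) = 0%E by rewrite -hm'.
have mNP : measurable (@consT n @^-1` N).
  by rewrite -[X in measurable X]setTI; exact: measurable_consT.
have aeN : {ae leb, forall t, m (xsection (@consT n @^-1` N) t) = 0%E}.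
  have : (\int[leb]_t `|m (xsection (@consT n @^-1` N) t)| = 0)%E.
    by under eq_integral do rewrite gee0_abs//; exact: NP.
  move/(ae_eq_integral_abs leb measurableT (measurable_fun_xsection m mNP)).
  by apply: filterS => t /(_ I).
apply: filterS2 (ae_integrable1 gP) aeN => t gt Nt.
apply: m_int => //.
exists (xsection (@consT n @^-1` N) t); split => //; first exact: measurable_xsection.
move=> x /= fx; rewrite /xsection /= inE; apply: hN => /= h; apply: fx.
by rewrite /= -h.
Qed.

Lemma lint_measure_exists n : exists m, @lint_measure n m.
Proof. by elim: n => [|n [m hm]]; [exact: lint_measure0|exact: lint_measureS hm]. Qed.

Definition lebT n : {sigma_finite_measure set (n.-tuple R) -> \bar R} :=
  projT1 (cid (lint_measure_exists n)).

Lemma lint_ge0 n (f : n.-tuple R -> \bar R) : measurable_fun setT f -> (forall x, 0 <= f x)%E ->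
  lint f = (\int[lebT n]_x f x)%E.
Proof. by rewrite /lebT; case: cid => m /= [h _]; exact: h. Qed.

Lemma lint_integrable n (f g : n.-tuple R -> \bar R) : (lebT n).-integrable setT g ->
  {ae lebT n, forall x, f x = g x} -> lint f = (\int[lebT n]_x g x)%E.
Proof. by rewrite /lebT; case: cid => m /= [_ h]; exact: h. Qed.

Lemma lint_indic n (A : set (n.-tuple R)) : measurable A -> lint (ind A) = lebT n A.
Proof.
move=> mA; rewrite lint_ge0; first by rewrite integral_indic// setIT.
  exact/measurable_EFinP/measurable_indic.
by move=> x; rewrite lee_fin.
Qed.

Definition box n (a b : 'I_n -> R) : set (n.-tuple R) :=
  [set x | forall i, a i <= tnth x i < b i].

Lemma measurable_box n (a b : 'I_n -> R) : measurable (box a b).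
Proof.
have -> : box a b = \bigcap_(i in [set: 'I_n]) ((fun x : n.-tuple R => tnth x i) @^-1` `[a i, b i[).
  apply/seteqP; split => x h i; first by move=> _ /=; rewrite in_itv /= h.
  by have := h i I; rewrite /= in_itv.
apply: fin_bigcap_measurable => // i _.
rewrite -[X in measurable X]setTI; exact: measurable_tnth.
Qed.

Lemma lebT_box n (a b : 'I_n -> R) : (forall i, a i <= b i) ->
  lebT n (box a b) = (\prod_(i < n) (b i - a i))%:E.
Proof.
move=> ab; rewrite -lint_indic; last exact: measurable_box.
elim: n a b ab => [|n IH] a b ab.
  by rewrite big_ord0 /= /ind indicE mem_set// => -[].
rewrite big_ord_recl /=.
pose a' i := a (lift ord0 i); pose b' i := b (lift ord0 i).
rewrite (_ : (fun t => _) = fun t => ((\1_`[a ord0, b ord0[ t)%:E * (\prod_(i < n) (b' i - a' i))%:E)%E); last first.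
  apply/funext => t; rewrite -(IH a' b'); last by move=> i; exact: ab.
  have E x : ind (box a b) (cons_tuple t x) = ((\1_`[a ord0, b ord0[ t)%:E * ind (box a' b') x)%E.
    rewrite /ind -EFinM; congr (_%:E); rewrite !indicE -natrM mulnb; congr (_%:R)%R.
    congr nat_of_bool; apply/idP/andP.
      rewrite inE => h; split; first by rewrite inE /= in_itv /=; have := h ord0; rewrite tnth0.
      by rewrite inE => i; have := h (lift ord0 i); rewrite tnthS.
    rewrite !inE /= in_itv /= => -[h0 h] i.
    case: (unliftP ord0 i) => [j ->|->]; last by rewrite tnth0.
    by rewrite tnthS; exact: h.
  rewrite (_ : (fun x => ind (box a b) (cons_tuple t x)) = fun x => ((\1_`[a ord0, b ord0[ t)%:E * ind (box a' b') x)%E).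
    have mi : measurable_fun setT (ind (box a' b')).
      by apply/measurable_EFinP/measurable_indic; exact: measurable_box.
    have i0 x : (0 <= ind (box a' b') x)%E by rewrite lee_fin.
    rewrite !lint_ge0//; first by rewrite ge0_integralZl_EFin.
      by apply: emeasurable_funM.
    by move=> x; rewrite mule_ge0 ?lee_fin.
  by apply/funext => x; exact: E.
rewrite ge0_integralZr//; last 2 first.
- exact/measurable_EFinP/measurable_indic.
- by rewrite lee_fin; apply: prodr_ge0 => i _; rewrite subr_ge0 ab.
have -> : (\int[@lebesgue_measure R]_x (\1_`[a ord0, b ord0[ x)%:E = (@lebesgue_measure R) `[a ord0, b ord0[)%E.
  by rewrite integral_indic// setIT.
rewrite lebesgue_measure_itv/= lte_fin; case: ifPn => [_|]; first by rewrite -EFinB -EFinM.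
rewrite -leNgt => ba; have -> : a ord0 = b ord0 by apply/le_anti; rewrite ab ba.
by rewrite subrr mul0e mul0r.
Qed.

End lebesgue_tuple.

(** * Dyadic cubes *)

Section dyadic.
Variables (R : realType) (d : nat).
Implicit Types (x y : d.-tuple R) (m : nat).

Lemma edist_coord x y i : `|tnth y i - tnth x i| <= edist x y.
Proof.
rewrite /edist -sqrtr_sqr ler_wsqrtr// (bigD1 i)//= lerDl.
by apply: sumr_ge0 => j _; exact: sqr_ge0.
Qed.

Lemma edist_le x y (s : R) : (forall i, `|tnth y i - tnth x i| <= s) ->
  edist x y <= Num.sqrt d%:R * s.
Proof.
have [d0|d0] := posnP d.
  by move=> _; rewrite /edist big1 ?sqrtr0 ?d0 ?sqrtr0 ?mul0r// => -[i lti]; exfalso; move: lti; rewrite d0.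
move=> h.
have s0 : 0 <= s by apply: le_trans (h (Ordinal d0)).
rewrite -[X in _ * X](ger0_norm s0) -[X in _ * X]sqrtr_sqr -sqrtrM ?ler0n//.
rewrite ler_wsqrtr// (@le_trans _ _ (\sum_(i < d) s ^+ 2))//.
  by apply: ler_sum => i _; rewrite -[leLHS]real_normK ?num_real// lerXn2r ?nnegrE.
by rewrite sumr_const card_ord mulr_natl.
Qed.

Lemma measurable_edist : measurable_fun setT (fun p : d.-tuple R * d.-tuple R => edist p.1 p.2).
Proof.
apply: (@measurableT_comp _ _ _ _ _ _ (@Num.sqrt R)); first exact: (continuous_measurable_fun (@sqrt_continuous R)).
apply: measurable_sum => i; apply: measurable_funX; apply: measurable_funB.
  exact: (measurableT_comp (measurable_tnth i)).
exact: (measurableT_comp (measurable_tnth i)).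
Qed.

Lemma measurable_eball x (r : R) : measurable (eball x r).
Proof.
rewrite -[X in measurable X]setTI; apply: measurable_fun_ltr => //.
exact: (measurableT_comp measurable_edist (pair1_measurable x)).
Qed.

Definition dyad m x : nat := pickle (map_tuple (fun t => Num.floor (2 ^+ m * t)) x).

Lemma dyadP m x y : dyad m x = dyad m y <->
  forall i, Num.floor (2 ^+ m * tnth x i) = Num.floor (2 ^+ m * tnth y i).
Proof.
split=> [/(pcan_inj pickleK) e i|e].
  by move: (congr1 (fun t => tnth t i) e); rewrite !tnth_map.
by rewrite /dyad; congr pickle; apply: eq_from_tnth => i; rewrite !tnth_map.
Qed.

Lemma dyad_refine m x y : dyad m.+1 x = dyad m.+1 y -> dyad m x = dyad m y.
Proof.
have key (a b : R) : Num.floor (2 * a) = Num.floor (2 * b) -> Num.floor a = Num.floor b.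
  wlog: a b / Num.floor a <= Num.floor b => [hw e|ab e].
    by have [/hw->//|/ltW /hw->] := leP (Num.floor a) (Num.floor b).
  apply/eqP; rewrite eq_le ab /= leNgt; apply/negP => ba.
  have b1 := floor_le b; have a1 := floorD1_gt a.
  have fab : Num.floor a + 1 <= Num.floor b by rewrite lezD1.
  have : (2 * (Num.floor a + 1))%:~R <= 2 * b.
    by rewrite intrM ler_pM2l// (le_trans _ b1)// ler_int.
  rewrite -floor_ge_int -e floor_ge_int intrM ler_pM2l//; lra.
by move=> /dyadP e; apply/dyadP => i; apply: key; rewrite !mulrA -exprS.
Qed.

Lemma cell_dyadE m x : cell dyad m x =
  box (fun i => (Num.floor (2 ^+ m * tnth x i))%:~R / 2 ^+ m)
      (fun i => (Num.floor (2 ^+ m * tnth x i) + 1)%:~R / 2 ^+ m).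
Proof.
have p0 : 0 < 2 ^+ m :> R by rewrite exprn_gt0.
apply/seteqP; split => y /=.
  move/dyadP => h i; have /eqP := h i.
  by rewrite floor_eq ler_pdivrMr// ltr_pdivlMr// ![tnth y i * _]mulrC.
move=> h; apply/dyadP => i; apply/eqP; rewrite floor_eq.
by have := h i; rewrite ler_pdivrMr// ltr_pdivlMr// ![tnth y i * _]mulrC.
Qed.

Lemma measurable_dyad m : measurable_fun setT (dyad m).
Proof.
move=> _ B _; rewrite setTI.
rewrite (_ : _ @^-1` _ = \bigcup_(i in B) (dyad m @^-1` [set i])); last first.
  by apply/seteqP; split => x /= => [Bx|[i Bi /= ->]//]; exists (dyad m x).
apply: bigcup_measurable => i _.
have [[x xi]|h] := pselect (exists x, dyad m x = i).
  by rewrite -xi -/(cell dyad m x) cell_dyadE; exact: measurable_box.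
by rewrite (_ : _ @^-1` _ = set0)//; apply/seteqP; split => // x xi; apply: h; exists x.
Qed.

Lemma lebT_cell m x : lebT R d (cell dyad m x) = ((2 ^- m) ^+ d)%:E.
Proof.
have p0 : 0 < 2 ^+ m :> R by rewrite exprn_gt0.
rewrite cell_dyadE lebT_box; last first.
  by move=> i; rewrite ler_pM2r ?invr_gt0// ler_int lerDl.
congr (_%:E); under eq_bigr do rewrite -mulrBl -intrB (addrC (Num.floor _)) addrK mul1r.
by rewrite prodr_const card_ord.
Qed.

Lemma cell_in_ball x (r : R) : 0 < r ->
  exists m, forall k, (m <= k)%N -> cell dyad k x `<=` eball x r.
Proof.
move=> r0; pose N := Num.truncn ((Num.sqrt d%:R + 1) / r).
have hN : (Num.sqrt d%:R + 1) / r < N.+1%:R by exact: truncnS_gt.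
exists N.+1 => k Nk y /= yx; rewrite /eball /=.
have p0 : 0 < 2 ^+ k :> R by rewrite exprn_gt0.
have pk : N.+1%:R <= 2 ^+ k :> R.
  by rewrite -natrX ler_nat (leq_trans Nk)// ltnW// ltn_expl.
have s0 : 0 <= Num.sqrt d%:R :> R by exact: sqrtr_ge0.
have : edist x y <= Num.sqrt d%:R * (2 ^+ k)^-1.
  apply: edist_le => i; move/dyadP : yx => /(_ i) e.
  have := floor_itv (2 ^+ k * tnth x i); have := floor_itv (2 ^+ k * tnth y i).
  rewrite e => /andP[h1 h2] /andP[h3 h4]; rewrite -(ler_pM2l p0) mulfV ?gt_eqF//.
  rewrite -[X in X * _](gtr0_norm p0) -normrM mulrBr ler_norml.
  by move: h2 h4; rewrite !intrD => h2 h4; apply/andP; split; lra.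
move/le_lt_trans; apply; rewrite ltr_pdivrMr//.
rewrite ltr_pdivrMr// in hN; have : r * N.+1%:R <= r * 2 ^+ k by rewrite ler_pM2l.
lra.
Qed.

Lemma eopen_cells (U : set (d.-tuple R)) : eopen U ->
  <<s [set A | exists k i, A = dyad k @^-1` [set i]] >> U.
Proof.
move=> oU.
pose F (j : nat) : set (d.-tuple R) := match unpickle j with
  | Some (k, i) => if `[< dyad k @^-1` [set i] `<=` U >] then dyad k @^-1` [set i] else set0
  | None => set0 end.
have -> : U = \bigcup_j F j.
  apply/seteqP; split => x.
    move=> Ux; have [r r0 hr] := oU _ Ux; have [m hm] := cell_in_ball x r0.
    exists (pickle (m, dyad m x)) => //; rewrite /F pickleK asboolT//.
    exact: subset_trans (hm m _) hr.
  by move=> [j _]; rewrite /F; case: unpickle => // -[k i]; case: ifPn => // /asboolP; apply.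
have sa := @smallest_sigma_algebra _ setT [set A | exists k i, A = dyad k @^-1` [set i]].
case: sa => s0 sC sU.
apply: sU => j; rewrite /F; case: unpickle => // -[k i]; case: ifPn => // _.
by apply: sub_sigma_algebra; exists k, i.
Qed.

Lemma cells_sub_measurable :
  <<s [set A | exists k i, A = dyad k @^-1` [set i]] >> `<=` @measurable _ (d.-tuple R).
Proof.
apply: smallest_sub; first exact: sigma_algebra_measurable.
by move=> _ [k [i ->]]; exact: measurable_code_preimage measurable_dyad _ _.
Qed.

Lemma eopen_measurable (U : set (d.-tuple R)) : eopen U -> measurable U.
Proof. by move=> /eopen_cells; exact: cells_sub_measurable. Qed.

Lemma dyad_gen : @measurable _ (d.-tuple R) =
  <<s [set A | exists k i, A = dyad k @^-1` [set i]] >>.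
Proof.
apply/seteqP; split; last exact: cells_sub_measurable.
apply: smallest_sub; first exact: smallest_sigma_algebra.
have key (i : 'I_d) : preimage_set_system setT (fun x : d.-tuple R => tnth x i) (@measurable _ (measurableTypeR R)) `<=`
    <<s [set A | exists k i, A = dyad k @^-1` [set i]] >>.
  rewrite RGenInftyO.measurableE -g_sigma_preimageE.
  apply: smallest_sub; first exact: smallest_sigma_algebra.
  move=> _ [_ [r ->] <-]; rewrite setTI; apply: eopen_cells => x /=.
  rewrite in_itv /= => xr; exists (r - tnth x i); first by rewrite subr_gt0.
  move=> y; rewrite /eball /= in_itv /= => h.
  have := le_lt_trans (edist_coord x y i) h.
  by rewrite ltr_norml; lra.
elim/big_ind : _ => //.
by move=> A B hA hB C [/hA|/hB].
Qed.

Lemma lebT_ebounded (U : set (d.-tuple R)) : measurable U -> ebounded U -> (lebT R d U < +oo)%E.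
Proof.
move=> mU [M hM]; pose a (i : 'I_d) : R := - (`|M| + 1).
apply: (@le_lt_trans _ _ (lebT R d (box a (fun i => `|M| + 1)))).
  apply: le_measure; rewrite ?inE//; first exact: measurable_box.
  move=> x Ux i; have := le_trans (edist_coord _ _ i) (hM _ Ux).
  rewrite tnth_nseq subr0 ler_norml /a; have := ler_norm M; lra.
by rewrite lebT_box ?ltry// => i; rewrite /a; have := normr_ge0 M; lra.
Qed.

End dyadic.

(** * The constant of the fractional kernel *)

Section gamma.
Variable R : realType.
Notation leb1 := (@lebesgue_measure R).

Lemma powR_continuousW (p a b : R) : 0 < a -> {within `[a, b], continuous (fun t : R => t `^ p)}.
Proof.
move=> a0; apply: continuous_in_subspaceT => t /[!inE]/=; rewrite in_itv/= => /andP[at_ _].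
apply/differentiable_continuous/derivable1_diffP; apply: derivable_powR.
by rewrite in_itv/= andbT (lt_le_trans a0).
Qed.

Lemma powR_integral01 (s : R) : 0 < s ->
  (\int[leb1]_(t in `]0%R, 1%R]) (t `^ (s - 1))%:E <= (s^-1)%:E)%E.
Proof.
move=> s0; pose F (n : nat) : set R := `[n.+1%:R^-1, 1%R]%classic.
have mp : measurable_fun setT (fun t : R => (t `^ (s - 1))%:E).
  by apply/measurable_EFinP; exact: measurable_powR.
have UF : `]0%R, 1%R]%classic = \bigcup_n F n :> set R.
  apply/seteqP; split => t /=; rewrite in_itv/=.
    move=> /andP[t0 t1]; exists (Num.truncn (t^-1)) => //; rewrite /F /= in_itv/= t1 andbT.
    by rewrite invf_ple ?posrE ?ltr0Sn// ltW// truncnS_gt.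
  by move=> [n _]; rewrite /F /= in_itv/= => /andP[nt ->]; rewrite andbT (lt_le_trans _ nt).
have cvF : (\int[leb1]_(t in F i) (t `^ (s - 1))%:E @[i --> \oo] -->
    \int[leb1]_(t in \bigcup_i F i) (t `^ (s - 1))%:E)%E.
  apply: ge0_nondecreasing_set_cvg_integral.
  - apply/nondecreasing_seqP => n; rewrite subsetEset => t; rewrite /F /= !in_itv/= => /andP[nt ->]; rewrite andbT (le_trans _ nt)//.
    by rewrite lef_pV2 ?posrE// ler_nat.
  - by move=> i; exact: measurable_itv.
  - by move=> i; exact: measurable_funTS.
  - by move=> i t _; rewrite lee_fin powR_ge0.
rewrite UF -(cvg_lim _ cvF)//; apply: lime_le; first by apply/cvg_ex; eexists; exact: cvF.
apply: nearW => n; rewrite /F.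
have [n1|n1] := eqVneq n 0%N.
  rewrite n1 invr1 set_itv1 (@integral_Sset1 _ _ _ 1%R)//.
  by rewrite lee_fin invr_ge0 ltW.
have a0 : 0 < n.+1%:R^-1 :> R by [].
rewrite (@continuous_FTC2 _ _ (fun t : R => s^-1 * t `^ s)).
- rewrite powR1 mulr1 -EFinB lee_fin gerBl mulr_ge0 ?powR_ge0// invr_ge0 ltW//.
- by rewrite invf_lt1// ltr1n ltnS lt0n.
- exact: powR_continuousW.
- have dF t : 0 < t -> derivable (fun t : R => s^-1 * t `^ s) t 1.
    by move=> t0; apply: derivableM => //; apply: derivable_powR; rewrite in_itv/= andbT.
  have cF t : 0 < t -> {for t, continuous (fun t : R => s^-1 * t `^ s)}.
    by move=> t0; apply/differentiable_continuous/derivable1_diffP/dF.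
  split.
  + by move=> t; rewrite in_itv/= => /andP[at_ _]; apply: dF; exact: lt_trans at_.
  + by apply: cvg_at_right_filter; exact: cF.
  + by apply: cvg_at_left_filter; exact: cF.
- move=> t; rewrite in_itv/= => /andP[at_ _].
  have t0 : 0 < t by exact: lt_trans at_.
  rewrite derive1E deriveZ//=; last by apply: derivable_powR; rewrite in_itv/= andbT.
  by rewrite -derive1E powR_derive1 ?in_itv/= ?andbT// /GRing.scale /= mulrA mulVf ?gt_eqF// mul1r.
Qed.

Lemma Gamma_int_gt0 (s : R) : 0 < s -> 0 < Gamma_int s.
Proof.
move=> s0; rewrite /Gamma_int.
have -> : [set t : R | 0 <= t] = `[0, +oo[%classic by rewrite set_itvE.
pose f (t : R) : R := t `^ (s - 1) * expR (- t).
have f0 t : 0 <= f t by rewrite mulr_ge0 ?powR_ge0 ?expR_ge0.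
have mf : measurable_fun setT f.
  apply: measurable_funM; first exact: measurable_powR.
  by apply: measurableT_comp => //; exact: measurable_expR.
have mEf : measurable_fun setT (EFin \o f) by exact/measurable_EFinP.
apply: fine_gt0; apply/andP; split.
  apply: (@lt_le_trans _ _ (\int[leb1]_(t in `[1%R, 2%R]) (f t)%:E)%E); last first.
    apply: ge0_subset_integral => //=; first exact: measurable_funTS.
      by move=> t _; rewrite lee_fin.
    by move=> t /=; rewrite !in_itv/= => /andP[t1 _]; rewrite andbT (le_trans _ t1).
  apply: (@lt_le_trans _ _ (\int[leb1]_(t in `[1%R, 2%R]) (2^-1 * expR (- 2))%:E)%E).
    rewrite integral_cst//= lebesgue_measure_itv/= lte_fin.
    rewrite ifT; last by lra.
    by rewrite -EFinB -EFinM lte_fin mulr_gt0 ?mulr_gt0 ?expR_gt0//; lra.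
  apply: ge0_le_integral => //=.
    exact: measurable_funTS.
  move=> t; rewrite in_itv/= lee_fin => /andP[t1 t2].
  apply: ler_pM => //; rewrite ?expR_ge0// ?ler_expR; last by lra.
  have := @ler_powR R t t1 (-1) (s - 1); rewrite powR_inv1; last lra.
  move=> h; apply: le_trans (h _); last by lra.
  by rewrite lef_pV2 ?posrE//; lra.
pose n := Num.truncn s.
pose C : R := 2 ^+ n.+1 * n.+1`!%:R.
have C1 : 1 <= C.
  by rewrite -[leLHS]mulr1 ler_pM// ?exprn_ege1 ?ler1n ?fact_gt0//; lra.
pose g (t : R) : \bar R := (((fun t : R => (t `^ (s - 1))%:E) \_ `]0%R, 1%R]) t
  + (C * 2)%:E * (exponential_pdf 2^-1 t)%:E)%E.
have e0 t : 0 <= exponential_pdf 2^-1 t :> R by apply: exponential_pdf_ge0; lra.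
have mp : measurable_fun setT ((fun t : R => (t `^ (s - 1))%:E) \_ `]0%R, 1%R]).
  apply/(measurable_restrictT _ _).1 => //; apply: measurable_funTS.
  by apply/measurable_EFinP; exact: measurable_powR.
have me : measurable_fun setT (EFin \o exponential_pdf (2^-1 : R)).
  by apply/measurable_EFinP; exact: measurable_exponential_pdf.
have p0 t : (0 <= ((fun t : R => (t `^ (s - 1))%:E) \_ `]0%R, 1%R]) t)%E.
  by apply: erestrict_ge0 => u _; rewrite lee_fin powR_ge0.
have Ce0 t : (0 <= (C * 2)%:E * (exponential_pdf 2^-1 t)%:E)%E.
  by rewrite mule_ge0 ?lee_fin//; lra.
rewrite integral_mkcond.
apply: (@le_lt_trans _ _ (\int[leb1]_t g t)%E).
  apply: ge0_le_integral => //=.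
  - by move=> t _; apply: erestrict_ge0 => u _; rewrite lee_fin; exact: f0.
  - by apply/(measurable_restrictT _ _).1 => //; exact: measurable_funTS.
  - by apply: emeasurable_funD => //; exact: emeasurable_funM.
  move=> t _; rewrite /g !patchE; case: ifPn => [|_]; last first.
    by rewrite adde_ge0// -[X in (0 <= X)%E]/(((fun t : R => (t `^ (s - 1))%:E) \_ `]0%R, 1%R]) t).
  rewrite inE/= in_itv/= andbT => t0.
  have [t1|t1] := boolP (t \in `]0%R, 1%R]%classic).
    rewrite -[leLHS]adde0; apply: leeD => //.
    by rewrite lee_fin -[leRHS]mulr1 ler_wpM2l ?powR_ge0// -expR0 ler_expR oppr_le0.
  rewrite add0e /exponential_pdf patchE mem_set; last by rewrite /= in_itv/= t0.
  rewrite -EFinM lee_fin mulrA mulfK//.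
  have {}t1 : t = 0 \/ 1 < t.
    move: t1; rewrite notin_setE/= in_itv/= => /negP; rewrite negb_and -leNgt -ltNge.
    by move=> /orP[h|h]; [left; apply/le_anti; rewrite h t0|right].
  case: t1 => [->|t1].
    rewrite oppr0 mulr0 expR0 !mulr1 (le_trans _ C1)//.
    by have [->|h] := eqVneq (s - 1) 0; rewrite ?powRr0// powR0.
  apply: (@le_trans _ _ (t ^+ n.+1 * expR (- t))).
    rewrite ler_wpM2r ?expR_ge0// -powR_mulrn//; apply: ler_powR; first exact: ltW.
    by have := truncnS_gt s; rewrite -/n; lra.
  have -> : - t = - (t / 2) + - 2^-1 * t by field.
  rewrite expRD mulrA ler_wpM2r ?expR_ge0// expRN ler_pdivrMr ?expR_gt0//.
  have t2 : 0 <= t / 2 by lra.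
  have := expR_ge1Dxn n t2; rewrite exprMn exprVn => h.
  have q0 : 0 < (2 ^+ n.+1 : R) by rewrite exprn_gt0.
  have q1 : 0 < (n.+1`!%:R : R) by rewrite ltr0n fact_gt0.
  have : t ^+ n.+1 / 2 ^+ n.+1 / n.+1`!%:R <= expR (t / 2) by lra.
  by rewrite ler_pdivrMr// ler_pdivrMr// => /le_trans; apply; have -> : C * expR (t / 2) = expR (t / 2) * n.+1`!%:R * 2 ^+ n.+1 by rewrite /C; ring.
rewrite ge0_integralD//=; last exact: emeasurable_funM.
rewrite ge0_integralZl_EFin//; last 2 first.
- by move=> t _; rewrite lee_fin.
- lra.
rewrite integral_exponential_pdf; last by lra.
rewrite -integral_mkcond mule1 lte_add_pinfty ?ltry//.
exact: le_lt_trans (powR_integral01 s0) (ltry _).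
Qed.

Definition kalpha_const (d : nat) (alpha : R) : R :=
  2 `^ alpha * GammaR ((d%:R + alpha) / 2) / (pi `^ (d%:R / 2) * `|GammaR (- (alpha / 2))|).

Lemma kalpha_const_gt0 (d : nat) (alpha : R) : 0 < alpha < 2 -> 0 < kalpha_const d alpha.
Proof.
move=> /andP[a0 a2]; have dge : 0 <= d%:R :> R by [].
rewrite /kalpha_const divr_gt0 ?mulr_gt0 ?powR_gt0 ?pi_gt0//.
  by rewrite /GammaR ifT ?Gamma_int_gt0//; lra.
rewrite normr_gt0 /GammaR ifF; last by apply/negbTE; rewrite -leNgt; lra.
apply: mulf_neq0; first by rewrite gt_eqF// Gamma_int_gt0//; lra.
by rewrite invr_eq0 lt_eqF//; lra.
Qed.

End gamma.

(** * The form [form k] and its Faber-Krahn inequality *)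

Section form_energy.
Variables (R : realType) (d : nat).
Notation T := (d.-tuple R).
Notation m := (lebT R d).
Notation m2 := (lebT R d \x lebT R d)%E.

Lemma lint_on_integrable (U : set T) (f g : T -> \bar R) : measurable U ->
  m.-integrable U g -> {ae m, forall x, U x -> f x = g x} ->
  lint_on U f = (\int[m]_(x in U) g x)%E.
Proof.
move=> mU gi fg; rewrite integral_mkcond; apply: lint_integrable.
  by rewrite -(integrable_mkcond _ mU).
apply: filterS fg => x hx; rewrite /ind indicE patchE; case: ifPn => xU.
  by rewrite mul1e hx//; move: xU; rewrite inE.
by rewrite mul0e.
Qed.

Lemma lint_on_ge0 (U : set T) (f : T -> \bar R) : measurable U -> measurable_fun setT f ->
  (forall x, 0 <= f x)%E -> lint_on U f = (\int[m]_(x in U) f x)%E.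
Proof.
move=> mU mf f0.
have E : (fun x => ind U x * f x)%E = f \_ U.
  by apply/funext => x; rewrite /ind indicE patchE; case: ifPn => _; rewrite ?mul1e ?mul0e.
rewrite /lint_on E lint_ge0 -?integral_mkcond//; first exact: measurable_erestrict.
by move=> x; exact: erestrict_ge0.
Qed.

Lemma formU_ge0 (K : T -> T -> R) (U : set T) (u : T -> R) :
  measurable_fun setT (fun p : T * T => K p.1 p.2) -> (forall x y, x <> y -> 0 <= K x y) ->
  measurable U -> measurable_fun setT u ->
  formU K U u u = (\int[m2]_p (\1_U p.1 * \1_U p.2 * (incr u p ^+ 2 * `|K p.1 p.2|))%:E)%E.
Proof.
move=> mK K0 mU mu_.
pose F (p : T * T) : R := \1_U p.1 * \1_U p.2 * (incr u p ^+ 2 * `|K p.1 p.2|).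
have mF : measurable_fun setT F.
  apply: measurable_funM.
    by apply: measurable_funM; apply: measurableT_comp => //; exact: measurable_indic.
  apply: measurable_funM; first by apply: measurable_funX; exact: measurable_incr.
  exact: measurableT_comp.
have F0 p : 0 <= F p by apply: mulr_ge0; apply: mulr_ge0; rewrite ?sqr_ge0.
have mEF : measurable_fun setT (EFin \o F) by exact/measurable_EFinP.
have E0 p : (0 <= (EFin \o F) p)%E by rewrite /= lee_fin.
rewrite (fubini_tonelli1 _ mEF E0) /fubini_F /formU /lint_on -lint_ge0; last 2 first.
- exact: measurable_fun_fubini_tonelli_F.
- by move=> x; exact: integral_ge0.
congr lint; apply/funext => x.
have mFx : measurable_fun setT (fun y => (F (x, y))%:E).
  by apply: (measurableT_comp mEF); exact: pair1_measurable.
rewrite -lint_ge0//.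
have [Ux|nUx] := pselect (U x); last first.
  rewrite /ind indicE memNset// mul0e; apply/esym.
  rewrite (_ : (fun y => (F (x, y))%:E) = cst 0%E).
    by rewrite lint_ge0// integral_cst// mul0e.
  by apply/funext => y; rewrite /F /= indicE memNset// !mul0r.
rewrite /ind indicE mem_set// mul1e; congr lint; apply/funext => y.
rewrite -EFinM /F /incr /= [in RHS]indicE mem_set// mul1r; congr (_ * _)%:E.
have [->|/eqP xy] := eqVneq x y; first by rewrite subrr expr0n /= !mul0r.
by rewrite -expr2 ger0_norm// K0.
Qed.

Variable k : T -> T -> R.
Hypothesis mk : measurable_fun setT (fun p : T * T => k p.1 p.2).
Hypothesis k_ge0 : forall x y, x <> y -> 0 <= k x y.

(* [k] may be negative on the diagonal, where all increments vanish. *)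
Let w (p : T * T) : R := `|k p.1 p.2|.

Let mw : measurable_fun setT w. Proof. exact: measurableT_comp. Qed.
Let w0 p : 0 <= w p. Proof. exact: normr_ge0. Qed.

Lemma form_diagE (u : T -> R) : measurable_fun setT u ->
  form k u u = (\int[m2]_p (incr u p ^+ 2 * w p)%:E)%E.
Proof.
move=> mu_; rewrite /form formU_ge0//; apply: eq_integral => p _.
by rewrite !indicE !in_setT !mul1r.
Qed.

Lemma formE (u v : T -> R) : wL2 m2 w (incr u) -> wL2 m2 w (incr v) ->
  form k u v = (energy m w u v)%:E.
Proof.
move=> Lu Lv; pose g (p : T * T) : R := incr u p * incr v p * w p.
have gi : m2.-integrable setT (EFin \o g) by exact: (wL2M mw w0 Lu Lv).
rewrite /energy /wip /Rintegral fineK; last exact: integrable_fin_num.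
rewrite -(integral12_prod_meas1 gi) /form /formU.
rewrite /lint_on; apply: lint_integrable; first exact: integrable_fubini_F.
apply: filterS (ae_integrable1 gi) => x gx.
rewrite /ind indicE in_setT mul1e; apply: lint_integrable => //.
apply: nearW => y; rewrite indicE in_setT mul1e /g /incr /w /=; congr (_%:E).
have [->|/eqP xy] := eqVneq x y; first by rewrite !subrr !mul0r.
by rewrite ger0_norm// k_ge0.
Qed.

Lemma ae_lebT_null (U : set T) (u : T -> R) : measurable U -> measurable_fun setT u ->
  leb [set x | ~ U x /\ u x <> 0] = 0%E <-> {ae m, forall x, ~ U x -> u x = 0}.
Proof.
move=> mU mu_.
have mN : measurable [set x | ~ U x /\ u x <> 0].
  apply: measurableI; first exact: measurableC.
  rewrite -[X in measurable X]setTI.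
  by apply: (mu_ measurableT (~` [set 0])); apply: measurableC; exact: measurable_set1.
rewrite /leb lint_indic//; split => [N0|[N [mN' N0 hN]]].
  exists [set x | ~ U x /\ u x <> 0]; split => // x /= h.
  by split => [Ux|ux]; apply: h => // _; exact: ux.
apply/eqP; rewrite -measure_le0 -N0 le_measure ?inE// => x [h1 h2]; apply: hN => h.
exact: h2 (h h1).
Qed.

Lemma inH0_energy_space (Om : set T) (u : T -> R) : measurable Om ->
  inH0 k Om u <-> energy_space m w Om u.
Proof.
move=> mOm; rewrite /inH0 /inH /inL2.
have iw p : 0 <= incr u p ^+ 2 * w p by apply: mulr_ge0; rewrite ?sqr_ge0.
split.
  move=> [[[mu_ L2u] fu] Nu]; split; last exact/ae_lebT_null.
    split => //; apply/integrableP; split.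
      by apply/measurable_EFinP; apply: measurable_funM => //; exact: measurable_funX.
    apply: le_lt_trans L2u; rewrite lint_ge0.
    - by under eq_integral do rewrite /= mulr1 ger0_norm ?sqr_ge0//.
    - by apply/measurable_EFinP; exact: measurable_funX.
    - by move=> x; rewrite lee_fin sqr_ge0.
  have mi := measurable_incr mu_.
  split => //; apply/integrableP; split.
    by apply/measurable_EFinP; apply: measurable_funM => //; exact: measurable_funX.
  move: fu; rewrite form_diagE//; apply: le_lt_trans.
  by under eq_integral do rewrite /= ger0_norm ?iw//.
move=> [[mu_ L2u] [mi Lu] Nu]; split; last exact/ae_lebT_null.
split.
  split => //; rewrite lint_ge0.
  - move/integrableP : L2u => [_]; apply: le_lt_trans.
    by under [leRHS]eq_integral do rewrite /= mulr1 ger0_norm ?sqr_ge0//.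
  - by apply/measurable_EFinP; exact: measurable_funX.
  - by move=> x; rewrite lee_fin sqr_ge0.
rewrite form_diagE//; move/integrableP : Lu => [_]; apply: le_lt_trans.
by under [leRHS]eq_integral do rewrite /= ger0_norm ?iw//.
Qed.

End form_energy.

Section faber_krahn.
Variables (R : realType) (d : nat).
Notation T := (d.-tuple R).
Notation m := (lebT R d).
Notation m2 := (lebT R d \x lebT R d)%E.

Lemma edist_gt0 (x y : T) : x <> y -> 0 < edist x y.
Proof.
move=> xy; rewrite lt_neqAle sqrtr_ge0 andbT; apply/eqP => e.
apply: xy; apply: eq_from_tnth => i; have := edist_coord x y i; rewrite -e normr_le0 subr_eq0.
by move/eqP.
Qed.

Variables (alpha : R).
Hypothesis alpha02 : 0 < alpha < 2.

Lemma measurable_kalpha : measurable_fun setT (fun p : T * T => kalpha alpha p.1 p.2).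
Proof.
apply: measurable_funM => //; apply: (measurableT_comp (measurable_powR _)).
exact: measurable_edist.
Qed.

Lemma kalpha_ge0 (x y : T) : 0 <= kalpha alpha x y.
Proof.
by apply: mulr_ge0; rewrite ?powR_ge0//; exact/ltW/kalpha_const_gt0.
Qed.

Lemma kalpha_ge (x y : T) (s : R) : x <> y ->
  (forall i, `|tnth y i - tnth x i| <= s) ->
  kalpha_const d alpha * (Num.sqrt d%:R * s) `^ (- (d%:R + alpha)) <= kalpha alpha x y.
Proof.
move=> xy h; have /andP[a0 _] := alpha02; have e0 := edist_gt0 xy; have el := edist_le h.
apply: ler_wpM2l; first exact/ltW/kalpha_const_gt0.
have dge : 0 <= d%:R :> R by [].
rewrite !powRN lef_pV2 ?posrE ?powR_gt0//; last exact: lt_le_trans el.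
apply: ge0_ler_powR; rewrite ?nnegrE; [lra|exact: ltW|exact/ltW/(lt_le_trans e0)|exact: el].
Qed.

Variables (k : T -> T -> R) (cl : R) (Om : set T).
Hypothesis mk : measurable_fun setT (fun p : T * T => k p.1 p.2).
Hypothesis k_ge0 : forall x y, x <> y -> 0 <= k x y.
Hypothesis cl_gt0 : 0 < cl.
Hypothesis d_gt0 : (0 < d)%N.
Hypothesis bOm : ebounded Om.
Hypothesis kE : cond_Ege k alpha cl.

Let w (p : T * T) : R := `|k p.1 p.2|.

Definition fk_const : R := cl * kalpha_const d alpha * Num.sqrt d%:R `^ (- (d%:R + alpha)).

Lemma fk_const_gt0 : 0 < fk_const.
Proof.
apply: mulr_gt0; first by apply: mulr_gt0 => //; exact: kalpha_const_gt0.
by rewrite powR_gt0// sqrtr_gt0 ltr0n.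
Qed.

(* Each [x] in [A] sees a portion of measure at least [s ^+ d] of the cube of half-side [s]
   around it on which [u] vanishes; only these pairs of points are used. *)
Lemma faber_krahn (s : R) (A : set T) (u : T -> R) : 0 < s -> measurable A -> A `<=` Om ->
  (m A <= (s ^+ d)%:E)%E -> energy_space m w Om u -> {ae m, forall x, ~ A x -> u x = 0} ->
  wip m (fun=> 1) u u <= fk_const^-1 * s `^ alpha * energy m w u u.
Proof.
move=> s0 mA AOm mAs Hu uA; have [L2u Lu _] := Hu; have [mu_ _] := L2u.
have /andP[a0 _] := alpha02.
have m1 : measurable_fun setT (fun _ : T => 1 : R) by exact: measurable_cst.
have mw : measurable_fun setT w by exact: measurableT_comp.
have w0 p : 0 <= w p by exact: normr_ge0.
have [M hM] := bOm.
pose r := Num.sqrt d%:R * (`|M| + s) + 1.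
pose B := eball (nseq_tuple d 0 : T) r.
have mB : measurable B by exact: measurable_eball.
have inB x : (forall i, `|tnth x i| <= `|M| + s) -> B x.
  move=> h; rewrite /B /eball /= (@le_lt_trans _ _ (Num.sqrt d%:R * (`|M| + s)))//.
    by apply: edist_le => i; rewrite tnth_nseq subr0.
  by rewrite /r ltrDl.
have inA x i : A x -> `|tnth x i| <= `|M|.
  move=> /AOm /hM h; have := le_trans (edist_coord (nseq_tuple d 0) x i) h.
  by rewrite tnth_nseq subr0 => /le_trans; apply; exact: ler_norm.
have AB : A `<=` B by move=> x Ax; apply: inB => i; rewrite (le_trans (inA _ i Ax))// lerDl ltW.
have [N [mN N0 hN]] := uA.
pose A' := A `|` N.
have mA' : measurable A' by exact: measurableU.
have mA's : (m A' <= (s ^+ d)%:E)%E.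
  apply: le_trans (measureU2 _ mA mN) _.
  by rewrite -[leRHS]adde0; apply: leeD => //; move: N0 => /eqP; rewrite eq_le => /andP[].
have uA' y : ~ A' y -> u y = 0.
  by move=> nA'; apply: contrapT => uy; apply: (nA'); right; apply: hN => h; apply: uy; apply: h => Ay; apply: nA'; left.
pose bx (x : T) : set T := box (fun i => tnth x i - s) (fun i => tnth x i + s).
have mbx x : measurable (bx x) by exact: measurable_box.
pose Q (x : T) := bx x `\` A'.
have mQ x : measurable (Q x) by exact: measurableD.
have Qs x : ((s ^+ d)%:E <= m (Q x))%E.
  have sd0 : 0 <= s ^+ d by rewrite exprn_ge0// ltW.
  have E : m (bx x) = ((2 * s) ^+ d)%:E.
    rewrite lebT_box; last by move=> i; lra.
    congr (_%:E); rewrite (eq_bigr (fun=> 2 * s)) ?prodr_const ?card_ord// => i _; lra.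
  have E2 : ((2 * s) ^+ d)%:E = (m (Q x) + m (bx x `&` A'))%E.
    by rewrite -E; exact: measureDI.
  have Is : (m (bx x `&` A') <= (s ^+ d)%:E)%E.
    by apply: le_trans mA's; rewrite le_measure ?inE//; exact: measurableI.
  have : (((2 * s) ^+ d)%:E <= m (Q x) + (s ^+ d)%:E)%E by rewrite E2 leeD2l.
  rewrite -leeBlDr// -EFinB; apply: le_trans; rewrite lee_fin lerBrDr exprMn.
  have : 2 <= 2 ^+ d :> R by rewrite -[leLHS]expr1 ler_weXn2l// ler1n.
  move=> h2; have := ler_wpM2r sd0 h2; lra.
pose c1 := kalpha_const d alpha * (Num.sqrt d%:R * s) `^ (- (d%:R + alpha)).
have c10 : 0 <= c1 by rewrite mulr_ge0 ?powR_ge0//; exact/ltW/kalpha_const_gt0.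
pose F (p : T * T) : R := \1_B p.1 * \1_B p.2 * (incr u p ^+ 2 * `|kalpha alpha p.1 p.2|).
have mF : measurable_fun setT F.
  apply: measurable_funM.
    by apply: measurable_funM; apply: measurableT_comp => //; exact: measurable_indic.
  apply: measurable_funM; first by apply: measurable_funX; exact: measurable_incr.
  by apply: measurableT_comp => //; exact: measurable_kalpha.
have F0 p : 0 <= F p by apply: mulr_ge0; apply: mulr_ge0; rewrite ?sqr_ge0.
have inner x : ((\1_A x * (u x ^+ 2 * (c1 * s ^+ d)))%:E <= \int[m]_y (F (x, y))%:E)%E.
  have [Ax|nAx] := pselect (A x); last first.
    by rewrite indicE memNset// mul0r integral_ge0// => y _; rewrite lee_fin.
  rewrite indicE mem_set// mul1r.
  apply: (@le_trans _ _ (\int[m]_(y in Q x) (u x ^+ 2 * c1)%:E)%E).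
    rewrite integral_cst// mulrA EFinM; apply: lee_wpmul2l => //.
      by rewrite lee_fin mulr_ge0// sqr_ge0.
    exact: Qs.
  rewrite [leLHS]integral_mkcond; apply: ge0_le_integral => //.
  - by move=> y _; apply: erestrict_ge0 => z _; rewrite lee_fin mulr_ge0// sqr_ge0.
  - by apply: measurable_erestrict.
  - by apply: (measurableT_comp (_ : measurable_fun setT (EFin \o F))); [exact/measurable_EFinP|exact: pair1_measurable].
  move=> y _; rewrite patchE; case: ifPn => [|_]; last by rewrite lee_fin.
  rewrite inE => -[by_ nA']; rewrite lee_fin /F /incr /= (uA' y nA') sub0r sqrrN.
  have yx i : `|tnth y i - tnth x i| <= s.
    by have := by_ i; rewrite ler_norml => /andP[h1 h2]; apply/andP; split; lra.
  have By : B y.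
    apply: inB => i; have := inA x i Ax; have := yx i; have := ler_normD (tnth y i - tnth x i) (tnth x i).
    rewrite subrK; lra.
  rewrite !indicE !mem_set//; last exact: AB.
  rewrite !mul1r ler_wpM2l ?sqr_ge0// ger0_norm ?kalpha_ge0//.
  by apply: kalpha_ge => // e; apply: nA'; left; rewrite -e.
have mEF : measurable_fun setT (EFin \o F) by exact/measurable_EFinP.
have E0 p : (0 <= (EFin \o F) p)%E by rewrite /= lee_fin.
have outer : ((c1 * s ^+ d * wip m (fun=> 1) u u)%:E <= formU (kalpha alpha) B u u)%E.
  rewrite formU_ge0//; last 2 first.
  - exact: measurable_kalpha.
  - by move=> x y _; exact: kalpha_ge0.
  rewrite (fubini_tonelli1 _ mEF E0).
  apply: (@le_trans _ _ (\int[m]_x (\1_A x * (u x ^+ 2 * (c1 * s ^+ d)))%:E)%E); last first.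
    apply: ge0_le_integral => //.
    - move=> x _; rewrite lee_fin mulr_ge0// mulr_ge0 ?sqr_ge0// mulr_ge0//.
      by rewrite exprn_ge0// ltW.
    - apply/measurable_EFinP; apply: measurable_funM; first exact: measurable_indic.
      by apply: measurable_funM => //; exact: measurable_funX.
    - exact: measurable_fun_fubini_tonelli_F.
  rewrite EFinM -(wipE L2u) -ge0_integralZl_EFin//; last 3 first.
  - by move=> x _; rewrite lee_fin mulr1 sqr_ge0.
  - by apply/measurable_EFinP; apply: measurable_funM => //; exact: measurable_funX.
  - by rewrite mulr_ge0// exprn_ge0// ltW.
  rewrite (@integral_ae_eqW _ _ _ m _ (fun x => (\1_A x * (u x ^+ 2 * (c1 * s ^+ d)))%:E))//.
  apply: filterS uA => x hx; rewrite -EFinM; congr (_%:E); rewrite mulr1.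
  have [Ax|nAx] := pselect (A x); first by rewrite indicE mem_set// mul1r mulrC.
  by rewrite hx// expr0n/= mulr0 mul0r mulr0.
have L2B : (lint_on B (fun x => (u x ^+ 2)%:E) < +oo)%E.
  have mu2 : measurable_fun setT (fun x => (u x ^+ 2)%:E) by apply/measurable_EFinP; exact: measurable_funX.
  rewrite lint_on_ge0//; last by move=> x; rewrite lee_fin sqr_ge0.
  apply: (@le_lt_trans _ _ (\int[m]_x (u x ^+ 2 * 1)%:E)%E); last by rewrite (wipE L2u) ltry.
  under [leRHS]eq_integral do rewrite mulr1.
  by apply: ge0_subset_integral => // x _; rewrite lee_fin sqr_ge0.
have upper : (formU k B u u <= (energy m w u u)%:E)%E.
  rewrite formU_ge0// -(wipE Lu); apply: ge0_le_integral => //.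
  - by move=> p _; rewrite lee_fin; apply: mulr_ge0; apply: mulr_ge0; rewrite ?sqr_ge0.
  - apply/measurable_EFinP; apply: measurable_funM.
      by apply: measurable_funM; apply: measurableT_comp => //; exact: measurable_indic.
    by apply: measurable_funM => //; apply: measurable_funX; exact: measurable_incr.
  - apply/measurable_EFinP; apply: measurable_funM => //.
    by apply: measurable_funX; exact: measurable_incr.
  move=> p _; rewrite lee_fin -[leRHS]mul1r; apply: ler_wpM2r.
    by apply: mulr_ge0; rewrite ?sqr_ge0.
  by rewrite !indicE; case: (_ \in _); case: (_ \in _); rewrite ?mul1r ?mulr0 ?mul0r.
have key : cl * (c1 * s ^+ d * wip m (fun=> 1) u u) <= energy m w u u.
  rewrite -lee_fin EFinM; apply: le_trans upper; apply: le_trans (kE mu_ L2B).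
  by apply: lee_wpmul2l outer; rewrite lee_fin ltW.
rewrite -(ler_pM2l fk_const_gt0) !mulrA mulfV ?gt_eqF ?fk_const_gt0// mul1r.
have sa0 : 0 < s `^ alpha by exact: powR_gt0.
rewrite -ler_pdivrMl//; apply: le_trans key.
rewrite le_eqVlt; apply/orP; left; apply/eqP; rewrite /c1 /fk_const.
rewrite powRM ?sqrtr_ge0//; last exact: ltW.
have -> : s `^ (- (d%:R + alpha)) = (s `^ alpha)^-1 * (s ^+ d)^-1.
  by rewrite powRN powRD ?(gt_eqF s0) ?implybT// invfM powR_mulrn ?ltW// mulrC.
have sd : s ^+ d != 0 by rewrite gt_eqF// exprn_gt0.
by field; rewrite sd gt_eqF.
Qed.

End faber_krahn.

(** * The Green function *)

Section measure_restriction.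
Context d (T : measurableType d) (R : realType) (m : {measure set T -> \bar R}).
Variable D : set T.
Hypothesis mD : measurable D.
Hypothesis mDoo : (m D < +oo)%E.

Let nu : {measure set T -> \bar R} := mfrestr mD mDoo.

Lemma ae_mfrestr (P : T -> Prop) : {ae m, forall x, P x} -> {ae nu, forall x, P x}.
Proof.
move=> [N [mN N0 hN]]; exists N; split => //; apply/eqP; rewrite -measure_le0 -N0.
by rewrite /= /mfrestr /mrestr; apply: le_measure; rewrite ?inE//; exact: measurableI.
Qed.

Lemma integral_mfrestr (E : set T) (f : T -> \bar R) :
  (\int[nu]_(x in E) f x = \int[m]_(x in E `&` D) f x)%E.
Proof.
rewrite integral_mkcond (@integral_ae_eqW _ _ _ nu _ ((f \_ E) \_ D)).
  rewrite -integral_mkcond (eq_measure_integral m) ?integral_mkcondl// => A mA AD.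
  by rewrite /= /mfrestr /mrestr setIidl.
exists (~` D); split; first exact: measurableC.
  by rewrite /= /mfrestr /mrestr setICl measure0.
by move=> x /= h Dx; apply: h; rewrite [RHS]patchE mem_set.
Qed.

Lemma Rintegral_mfrestr (E : set T) (f : T -> R) :
  \int[nu]_(x in E) f x = \int[m]_(x in E `&` D) f x.
Proof. by rewrite /Rintegral integral_mfrestr. Qed.

End measure_restriction.

Lemma average_close d (T : measurableType d) (R : realType) (m : {measure set T -> \bar R})
    (Q : set T) (f : T -> R) (a e : R) : measurable Q -> (0 < m Q < +oo)%E ->
  m.-integrable Q (EFin \o f) -> (forall x, Q x -> `|f x - a| <= e) ->
  `|(fine (m Q))^-1 * \int[m]_(x in Q) f x - a| <= e.
Proof.
move=> mQ /andP[Q0 Qoo] fi fa.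
have q0 : 0 < fine (m Q) by rewrite fine_gt0// Q0.
have ci (c : R) : m.-integrable Q (EFin \o (fun=> c)).
  by apply: measurable_bounded_integrable => //; exact: bounded_cst.
have h1 : \int[m]_(x in Q) (a - e) <= \int[m]_(x in Q) f x.
  apply: ae_le_Rintegral => //; apply: nearW => x Qx.
  by have := fa x Qx; rewrite ler_norml => /andP[? ?]; lra.
have h2 : \int[m]_(x in Q) f x <= \int[m]_(x in Q) (a + e).
  apply: ae_le_Rintegral => //; apply: nearW => x Qx.
  by have := fa x Qx; rewrite ler_norml => /andP[? ?]; lra.
move: h1 h2; rewrite !Rintegral_cst// => h1 h2.
rewrite ler_distl; apply/andP; split; first by rewrite ler_pdivlMl// mulrC.
by rewrite ler_pdivrMl// mulrC.
Qed.

Lemma clip_bounded (R : realType) (M x : R) : 0 <= M -> `|Num.max (- M) (Num.min M x)| <= M.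
Proof. by move=> M0; rewrite ler_norml le_max lexx /= ge_max ge_min lexx andbT ge0_cp. Qed.

Lemma clip_id (R : realType) (M x : R) : `|x| <= M -> Num.max (- M) (Num.min M x) = x.
Proof.
by rewrite ler_norml => /andP[h1 h2]; rewrite (min_idPr _)// (max_idPr _).
Qed.

Section green_function.
Variables (R : realType) (d : nat).
Notation T := (d.-tuple R).
Notation m := (lebT R d).
Variables (k : T -> T -> R) (Om : set T).
Hypothesis mk : measurable_fun setT (fun p : T * T => k p.1 p.2).
Hypothesis k_ge0 : forall x y, x <> y -> 0 <= k x y.
Hypothesis oOm : eopen Om.
Hypothesis bOm : ebounded Om.

Let w (p : T * T) : R := `|k p.1 p.2|.
Let mOm : measurable Om. Proof. exact: eopen_measurable. Qed.
Let Omoo : (m Om < +oo)%E. Proof. exact: lebT_ebounded. Qed.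
Let nu : {finite_measure set T -> \bar R} := mfrestr mOm Omoo.

Variables (U : set T -> T -> R) (K : R).
Hypothesis hU : forall F, measurable F -> F `<=` Om ->
  [/\ energy_space m w Om (U F),
      forall v, energy_space m w Om v -> energy m w (U F) v = \int[m]_(x in F) v x,
      {ae m, forall x, 0 <= U F x} & {ae m, forall x, U F x <= K}].
Hypothesis U_ui : forall e : R, 0 < e -> exists2 del : R, 0 < del &
  forall F, measurable F -> F `<=` Om -> (m F <= del%:E)%E -> {ae m, forall x, U F x <= e}.

Let u (E : set T) (x : T) : R := Num.max (U (E `&` Om) x) 0.

Let mEOm E : measurable E -> measurable (E `&` Om).
Proof. by move=> mE; exact: measurableI. Qed.

Let u_ae E : measurable E -> {ae m, forall x, u E x = U (E `&` Om) x}.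
Proof.
move=> mE; have [_ _ U0 _] := hU (mEOm mE) (@subIsetr _ _ _).
by apply: filterS U0 => x h; exact/max_idPl.
Qed.

Let Rintegral_u E F : measurable E -> measurable F ->
  \int[nu]_(x in F) u E x = energy m w (U (F `&` Om)) (U (E `&` Om)).
Proof.
move=> mE mF; have [HE _ _ _] := hU (mEOm mE) (@subIsetr _ _ _).
have [_ hF _ _] := hU (mEOm mF) (@subIsetr _ _ _).
rewrite hF// (Rintegral_mfrestr mOm Omoo) /Rintegral; congr fine.
rewrite integral_mkcond [RHS]integral_mkcond; apply: integral_ae_eqW.
by apply: filterS (u_ae mE) => x h; rewrite !patchE; case: ifP => // _; rewrite h.
Qed.

Let green_nu : exists G : T * T -> \bar R,
  [/\ measurable_fun setT G, forall p, (0 <= G p)%E, forall x y, G (x, y) = G (y, x) &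
    forall y, (\int[nu]_x G (x, y) < +oo)%E /\
      exists s : nat -> nat, (forall j, (j <= s j)%N) /\
        forall (psi : T -> R) (M l : R), measurable_fun setT psi -> (forall x, `|psi x| <= M) ->
          (fine (nu (cell (@dyad R d) (s j) y)))^-1 *
            \int[nu]_x (psi x * u (cell (@dyad R d) (s j) y) x) @[j --> \oo] --> l ->
          (\int[nu]_x (G (x, y) * (psi x)%:E) = l%:E)%E].
Proof.
apply: (@green_kernel _ _ _ nu (@dyad R d) (@measurable_dyad R d) (@dyad_refine R d) (@dyad_gen R d) u).
- move=> E mE; apply: measurable_maxr => //.
  by have [[[]]] := hU (mEOm mE) (@subIsetr _ _ _).
- by move=> E x; rewrite le_max lexx orbT.
- exists (Num.max K 0) => E mE; apply: ae_mfrestr.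
  have [_ _ _ UK] := hU (mEOm mE) (@subIsetr _ _ _).
  by apply: filterS UK => x h; rewrite ge_max !le_max h lexx orbT.
- move=> e e0; have [del del0 hdel] := U_ui e0; exists del => // E mE Edel.
  apply: ae_mfrestr; apply: filterS (hdel _ (mEOm mE) (@subIsetr _ _ _) Edel) => x h.
  by rewrite ge_max h ltW.
- by move=> E F mE mF; rewrite !Rintegral_u// energyC.
Qed.

Lemma potential_average (phi psi psi' : T -> R) (M : R) (y : T) (s : nat -> nat) :
  Om y -> energy_space m w Om phi -> contOn Om phi ->
  (forall v, energy_space m w Om v -> form k phi v = lint_on Om (fun x => (psi x * v x)%:E)) ->
  measurable_fun setT psi' -> (forall x, `|psi' x| <= M) ->
  {ae m, forall x, Om x -> psi x = psi' x} -> (forall j, (j <= s j)%N) ->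
  (fine (nu (cell (@dyad R d) (s j) y)))^-1 *
    \int[nu]_x (psi' x * u (cell (@dyad R d) (s j) y) x) @[j --> \oo] --> phi y.
Proof.
move=> Omy Hphi cphi eqphi mpsi' bpsi' psiE sj; apply/cvgrPdist_le => e e0.
have [del del0 hdel] := cphi y Omy e e0.
have [r r0 rOm] := oOm Omy.
have [N1 hN1] := cell_in_ball y r0; have [N2 hN2] := cell_in_ball y del0.
exists (maxn N1 N2) => // j /=; rewrite geq_max => /andP[j1 j2].
set Q := cell _ _ _.
have QOm : Q `<=` Om by apply: subset_trans rOm; apply: hN1; exact: leq_trans (sj j).
have mQ : measurable Q by exact: measurable_code_preimage (@measurable_dyad R d) _ _.
have QI : Q `&` Om = Q by exact: setIidl.
have nuQ : nu Q = m Q by rewrite /nu /= /mfrestr /mrestr QI.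
have mQ0 : (0 < m Q < +oo)%E by rewrite /Q lebT_cell ltry andbT lte_fin exprn_gt0// invr_gt0 exprn_gt0.
have [HQ hQ _ _] := hU mQ QOm.
have key : \int[nu]_x (psi' x * u Q x) = \int[m]_(x in Q) phi x.
  rewrite -hQ// energyC; apply: EFin_inj.
  have [_ Lphi _] := Hphi; have [_ LQ _] := HQ.
  rewrite -(formE mk k_ge0)// eqphi//.
  have psiU : m.-integrable Om (fun x => (psi' x * U Q x)%:E).
    apply: (@integrableMr _ _ _ m Om mOm psi' (EFin \o U Q)) => //.
    - exact: measurable_funTS.
    - by exists M; split; [exact: num_real|move=> x Mx z _; exact: le_trans (bpsi' z) (ltW Mx)].
    - exact: (energy_space_integrable mOm Omoo HQ).
  rewrite (@lint_on_integrable _ _ Om _ (fun x => (psi' x * U Q x)%:E))//; last first.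
    by apply: filterS psiE => x h Omx; rewrite h.
  rewrite (Rintegral_mfrestr mOm Omoo) setTI.
  rewrite -[RHS]fineK; last exact: integrable_fin_num.
  congr (_%:E); rewrite /Rintegral; congr fine; rewrite integral_mkcond [RHS]integral_mkcond.
  apply: integral_ae_eqW; apply: filterS (u_ae mQ) => x; rewrite QI => h.
  by rewrite !patchE; case: ifP => // _; rewrite h.
rewrite key nuQ distrC; apply: average_close => //.
  exact: (energy_space_integrable mOm Omoo Hphi).
move=> x Qx; apply: ltW; apply: hdel; first exact: QOm.
by apply: hN2 Qx; exact: leq_trans (sj j).
Qed.

Lemma symmetric_green_function : exists G : T -> T -> \bar R,
  isGreen k Om G /\ (forall x y, G x y = G y x).
Proof.
have [G [mG G0 Gsym hG]] := green_nu.
pose G' x y := (G \_ (Om `*` Om)) (x, y).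
have G'0 x y : (0 <= G' x y)%E by rewrite /G'; exact: erestrict_ge0.
have G'E x y : Om x -> Om y -> G' x y = G (x, y).
  by move=> Ox Oy; rewrite /G' patchE mem_set.
have mG' : measurable_fun setT (fun p : T * T => G' p.1 p.2).
  have -> : (fun p : T * T => G' p.1 p.2) = G \_ (Om `*` Om) by apply/funext => -[].
  by apply: measurable_erestrict => //; exact: measurableX.
have mG'y y : measurable_fun setT (G'^~ y).
  exact: (measurableT_comp mG' (pair2_measurable y)).
have G'fin y : Om y -> (\int[m]_(x in Om) G' x y < +oo)%E.
  move=> Oy; have [h _] := hG y; move: h; rewrite (integral_mfrestr mOm Omoo) setTI.
  by apply: le_lt_trans; rewrite le_eqVlt; apply/orP; left; apply/eqP; apply: eq_integral => x /[!inE] Ox; rewrite G'E.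
exists G'; split; last first.
  by move=> x y; rewrite /G' !patchE !in_setX andbC Gsym.
split => //.
- move=> y Oy; split => //; rewrite lint_on_ge0//; last first.
    by apply: measurableT_comp.
  by under eq_integral do rewrite gee0_abs//; exact: G'fin.
- rewrite (_ : [set p | _] = set0).
    rewrite /leb2 (_ : (fun x : T => _) = cst 0%E).
      by rewrite lint_ge0// integral_cst// mul0e.
    apply/funext => x; rewrite (_ : (fun y : T => _) = cst 0%E).
      by rewrite lint_ge0// integral_cst// mul0e.
    by apply/funext => y; rewrite indic0.
  apply/seteqP; split => // -[x y] /= [h]; apply.
  by rewrite /G' patchE memNset.
move=> y phi psi Oy Hphi cphi [mpsi [M hM]] eqphi.
pose psi' x := Num.max (- `|M|) (Num.min `|M| (psi x)).
have mpsi' : measurable_fun setT psi'.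
  by apply: measurable_maxr => //; exact: measurable_minr.
have bpsi' x : `|psi' x| <= `|M| by exact: clip_bounded.
have psiE : {ae m, forall x, Om x -> psi x = psi' x}.
  have mN : measurable [set x | Om x /\ M < `|psi x|].
    apply: measurableI => //; rewrite -[X in measurable X]setTI.
    by apply: measurable_fun_ltr => //; exact: measurableT_comp.
  rewrite /leb lint_indic// in hM.
  exists [set x | Om x /\ M < `|psi x|]; split => // x /= h; split.
    by apply: contrapT => nO; apply: h.
  rewrite ltNge; apply/negP => pM; apply: h => _; rewrite /psi' clip_id//.
  exact: le_trans (ler_norm _).
have [_ [s [sj hs]]] := hG y.
have Gi : m.-integrable Om (fun x => (G' x y * (psi' x)%:E)%E).
  apply: (@integrableMl _ _ _ m Om mOm (G'^~ y) psi').
  - apply/integrableP; split; first exact: measurable_funTS.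
    by under eq_integral do rewrite gee0_abs//; exact: G'fin.
  - exact: measurable_funTS.
  - by exists `|M|; split; [exact: num_real|move=> x Mx z _; exact: le_trans (bpsi' z) (ltW Mx)].
rewrite (@lint_on_integrable _ _ Om _ (fun x => (G' x y * (psi' x)%:E)%E))//; last first.
  by apply: filterS psiE => x h Ox; rewrite h.
rewrite -(hs psi' `|M| (phi y))//.
  rewrite (integral_mfrestr mOm Omoo) setTI; apply: eq_integral => x /[!inE] Ox.
  by rewrite G'E.
apply: (potential_average Oy _ cphi _ mpsi' bpsi' psiE sj).
  exact/(inH0_energy_space mk k_ge0).
by move=> v Hv; apply: eqphi; exact/(inH0_energy_space mk k_ge0).
Qed.

End green_function.

Theorem mainTheorem5 (R : realType) (d : nat) (k : d.-tuple R -> d.-tuple R -> R)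
  (alpha cl cU : R) (Om : set (d.-tuple R)) :
  (3 <= d)%N -> admissible_kernel k ->
  0 < alpha < 2 -> 0 < cl -> 0 < cU ->
  eopen Om -> ebounded Om ->
  cond_Ege k alpha cl -> cond_U1 k alpha cU ->
  exists G : d.-tuple R -> d.-tuple R -> \bar R,
    isGreen k Om G /\
    (forall x y, Om x -> Om y -> x <> y -> G x y = G y x).
Proof.
move=> d3 [mk k_ge0 _ _] alpha02 cl0 _ oOm bOm kE _.
have d0 : (0 < d)%N by exact: leq_trans d3.
have mOm := eopen_measurable oOm.
have Omoo := lebT_ebounded mOm bOm.
have /andP[a0 _] := alpha02.
have mw : measurable_fun setT (fun p : d.-tuple R * d.-tuple R => `|k p.1 p.2|).
  exact: measurableT_comp.
have cF0 : 0 < (fk_const d alpha cl)^-1 by rewrite invr_gt0 fk_const_gt0.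
have [U [K [hU U_ui]]] := potential_theory mw (fun p => normr_ge0 _) mOm Omoo cF0 a0 d0
  (@faber_krahn _ _ _ alpha02 _ _ _ mk k_ge0 cl0 d0 bOm kE).
have [G [GG Gsym]] := symmetric_green_function mk k_ge0 oOm bOm hU U_ui.
by exists G; split => // x y *; exact: Gsym.
Qed.
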